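(* Let $n\ge1$, $1\le p<\infty$, let $m$ satisfy (i)–(ii) of the context, and let $J_{m,s}$ and $b_s$ be as in the context. Assume that the limit $b(x)=\lim_{s\downarrow 0}b_s(x)$ exists for a.e. $x\in\mathbb{R}^n$. If $u\in W^{s_0,p}(\mathbb{R}^n)$ for some $s_0\in(0,1)$, then $$\lim_{s\downarrow 0}s\,J_{m,s}(u)=\int_{\mathbb{R}^n}|u|^p\,b(x)\,dx .$$
   Context: $\mathbb{S}^{n-1}$ is the unit sphere in $\mathbb{R}^n$ and $\mathcal{H}^{n-1}$ is $(n-1)$-dimensional Hausdorff measure. The kernel $m=m(x,h)$, $m\in L^\infty(\mathbb{R}^n\times\mathbb{R}^n)$, satisfies: (i) $m_-\le m(x,h)\le m_+$ for some constants $0<m_-\le m_+<\infty$; (ii) $m(x,h)=m(x-h,-h)$. For $s\in(0,1)$, $W^{s,p}(\mathbb{R}^n)$ is the space of $u\in L^p(\mathbb{R}^n)$ with $\iint_{\mathbb{R}^n\times\mathbb{R}^n}\frac{|u(x)-u(x-h)|^p}{|h|^{n+sp}}\,dx\,dh<\infty$, and $$J_{m,s}(u)=\frac{1-s}{p}\iint_{\mathbb{R}^n\times\mathbb{R}^n}m(x,h)\frac{|u(x)-u(x-h)|^p}{|h|^{n+sp}}\,dx\,dh,$$ $$b_s(x)=2s\int_{\mathbb{S}^{n-1}}\int_{2|x|}^\infty\frac{m(x,r\omega)}{r^{sp+1}}\,dr\,d\mathcal{H}^{n-1}(\omega).$$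
   Formalization: The right-hand side carries an extra factor 1/p: the limit proved is (1/p)∫|u|^p b dx, since with the stated J_{m,s} and b_s the printed identity fails for every p>1 (e.g. m=1, u≠0); for p=1 the two agree. *)

(* Defs.v *)
From HB Require Import structures.
From mathcomp Require Import all_boot all_order all_algebra.
From mathcomp Require Import all_classical all_reals all_analysis.

Set Implicit Arguments.
Unset Strict Implicit.
Unset Printing Implicit Defensive.

Import Order.TTheory GRing.Theory Num.Theory.
Import numFieldNormedType.Exports.

Local Open Scope classical_set_scope.
Local Open Scope ring_scope.

(* The library equips n.-tuple T with the product sigma-algebra, here the Borel
   sets of R^n, but with no vector space structure. *)
Notation Rn R n := (n.-tuple (measurableTypeR R)).

Section euclidean.
Context {R : realType} {n : nat}.
Implicit Types (x y : Rn R n) (r : R).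

Definition vopp x : Rn R n := [tuple - (tnth x i : R) | i < n].
Definition vsub x y : Rn R n := [tuple (tnth x i : R) - tnth y i | i < n].
Definition vscale r x : Rn R n := [tuple r * (tnth x i : R) | i < n].
Definition enorm x : R := Num.sqrt (\sum_(i < n) (tnth x i : R) ^+ 2).

Definition unit_sphere : set (Rn R n) := [set x | enorm x = 1].
Definition unit_ball : set (Rn R n) := [set x | enorm x <= 1].

(* diam set0 = -oo *)
Definition diam (C : set (Rn R n)) : \bar R :=
  ereal_sup [set (enorm (vsub z.1 z.2))%:E | z in C `*` C].

End euclidean.

Section lebesgue_measure_Rn.
Context {R : realType}.
Local Open Scope ereal_scope.

Definition cons_Rn n (z : measurableTypeR R * Rn R n) : Rn R n.+1 :=
  [tuple of z.1 :: z.2].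

Let uncons_Rn n (x : Rn R n.+1) : measurableTypeR R * Rn R n :=
  (thead x, [tuple of behead x]).

Let cons_RnK n : cancel (@cons_Rn n) (@uncons_Rn n).
Proof. by move=> [a t]; congr pair; exact/val_inj. Qed.

Lemma measurable_cons_Rn n : measurable_fun [set: _] (@cons_Rn n).
Proof. exact: measurable_cons. Qed.

Let measurable_uncons_Rn n : measurable_fun [set: _] (@uncons_Rn n).
Proof.
apply/measurable_fun_pairP; split; last exact: measurable_behead.
exact: measurable_tnth.
Qed.

(* The n-fold product of the one-dimensional Lebesgue measure. *)
Fixpoint lebesgue_Rn (n : nat) : set (Rn R n) -> \bar R :=
  match n return set (Rn R n) -> \bar R with
  | 0 => \d_[tuple]
  | n'.+1 => pushforward (@lebesgue_measure R \x @lebesgue_Rn n') (@cons_Rn n')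
  end.
Arguments lebesgue_Rn : clear implicits.

Section pushforward_cons_Rn.
Variables (n : nat) (mu : {sigma_finite_measure set (Rn R n) -> \bar R}).

Let nu : set (Rn R n.+1) -> \bar R :=
  pushforward (@lebesgue_measure R \x mu) (@cons_Rn n).

Let mpre A : measurable A -> measurable (@cons_Rn n @^-1` A).
Proof.
by move=> mA; rewrite -[X in measurable X]setTI; exact: measurable_cons_Rn.
Qed.

Let nu0 : nu set0 = 0.
Proof. by rewrite /nu /pushforward preimage_set0 measure0. Qed.

Let nu_ge0 A : 0 <= nu A.
Proof. by rewrite /nu /pushforward measure_ge0. Qed.

Let nu_sigma_additive : semi_sigma_additive nu.
Proof.
move=> F mF tF mUF; rewrite /nu /pushforward preimage_bigcup.
apply: measure_semi_sigma_additive.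
- by move=> i; exact: mpre.
- apply/trivIsetP => /= i j _ _ ij; rewrite -preimage_setI.
  by move/trivIsetP : tF => /(_ _ _ _ _ ij) ->//; rewrite preimage_set0.
- by rewrite -preimage_bigcup; exact: mpre.
Qed.

HB.instance Definition _ := isMeasure.Build _ _ _ nu
  nu0 nu_ge0 nu_sigma_additive.

Let nu_sigma_finite : sigma_finite setT nu.
Proof.
have /sigma_finiteP[F [FT ndF Foo]] := sigma_finiteT (@lebesgue_measure R).
have /sigma_finiteP[G [GT ndG Goo]] := sigma_finiteT mu.
pose FG i := F i `*` G i.
have FGT : [set: _] = \bigcup_i FG i.
  apply/esym; rewrite -subTset => -[a t] _.
  have [i _ Fia] : (\bigcup_i F i) a by rewrite -FT.
  have [j _ Gjt] : (\bigcup_j G j) t by rewrite -GT.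
  exists (maxn i j) => //; split => /=.
    by move: a Fia; exact/subsetPset/ndF/leq_maxl.
  by move: t Gjt; exact/subsetPset/ndG/leq_maxr.
exists (fun i => @uncons_Rn n @^-1` FG i).
  by rewrite -preimage_bigcup -FGT preimage_setT.
move=> i; have [mF Fi] := Foo i; have [mG Gi] := Goo i; split.
  by rewrite -[X in measurable X]setTI; apply: measurable_uncons_Rn => //; exact: measurableX.
rewrite /nu /pushforward -comp_preimage.
rewrite (_ : _ \o _ = id) /=; last by apply/funext => z; exact: cons_RnK.
by rewrite preimage_id product_measure1E// lte_mul_pinfty// ge0_fin_numE.
Qed.

HB.instance Definition _ := Measure_isSigmaFinite.Build _ _ _ nu
  nu_sigma_finite.

Lemma pushforward_cons_Rn :
  exists mu' : {sigma_finite_measure set (Rn R n.+1) -> \bar R},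
    mu' = pushforward (@lebesgue_measure R \x mu) (@cons_Rn n)
      :> (set (Rn R n.+1) -> \bar R).
Proof. by exists nu. Qed.

End pushforward_cons_Rn.

Let lebesgue_RnP n : exists mu : {sigma_finite_measure set (Rn R n) -> \bar R},
  mu = lebesgue_Rn n :> (set (Rn R n) -> \bar R).
Proof.
elim: n => [|n [mu muE]]; first by exists (\d_([tuple] : Rn R 0)).
by have [mu' mu'E] := pushforward_cons_Rn mu; exists mu'; rewrite mu'E muE.
Qed.

Section instances.
Variable n : nat.

Let lebesgue_Rn0 : lebesgue_Rn n set0 = 0.
Proof. by have [mu <-] := lebesgue_RnP n; rewrite measure0. Qed.

Let lebesgue_Rn_ge0 A : 0 <= lebesgue_Rn n A.
Proof. by have [mu <-] := lebesgue_RnP n. Qed.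

Let lebesgue_Rn_sigma_additive : semi_sigma_additive (lebesgue_Rn n).
Proof.
by have [mu <-] := lebesgue_RnP n; exact: measure_semi_sigma_additive.
Qed.

HB.instance Definition _ := isMeasure.Build _ _ _ (lebesgue_Rn n)
  lebesgue_Rn0 lebesgue_Rn_ge0 lebesgue_Rn_sigma_additive.

Let lebesgue_Rn_sigma_finite : sigma_finite setT (lebesgue_Rn n).
Proof. by have [mu <-] := lebesgue_RnP n; exact: sigma_finiteT. Qed.

HB.instance Definition _ := Measure_isSigmaFinite.Build _ _ _ (lebesgue_Rn n)
  lebesgue_Rn_sigma_finite.

End instances.

End lebesgue_measure_Rn.
Arguments lebesgue_Rn R n : clear implicits.

Section hausdorff_measure.
Context {R : realType} {n : nat}.
Local Open Scope ereal_scope.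

(* omega_k (diam C / 2)^k, where omega_k is the volume of the unit ball of R^k;
   set0 has gauge 0 for every k, a nonempty set has gauge 1 for k = 0. *)
Definition hausdorff_gauge (k : nat) (C : set (Rn R n)) : \bar R :=
  if C == set0 then 0
  else lebesgue_Rn R k unit_ball * (diam C * (2^-1)%:E) ^+ k.

Definition hausdorff_content (k : nat) (delta : R) (A : set (Rn R n)) : \bar R :=
  ereal_inf [set \sum_(i <oo) hausdorff_gauge k (C i) | C in
    [set C : nat -> set (Rn R n) |
      A `<=` \bigcup_i C i /\ forall i, diam (C i) <= delta%:E]].

Definition hausdorff_measure (k : nat) (A : set (Rn R n)) : \bar R :=
  ereal_sup [set hausdorff_content k delta A | delta in [set d : R | (0 < d)%R]].

End hausdorff_measure.

Section nonlocal_energy.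
Context {R : realType} {n : nat}.
Local Open Scope ereal_scope.
Notation mu := (lebesgue_Rn R n).

(* |u(x) - u(x-h)|^p / |h|^(n+sp) at z = (x, h); it is 0 where h = 0. *)
Definition diff_quotient (s p : R) (u : Rn R n -> R) (z : Rn R n * Rn R n) : R :=
  (`|u z.1 - u (vsub z.1 z.2)| `^ p / enorm z.2 `^ (n%:R + s * p))%R.

Definition in_Wsp (s p : R) (u : Rn R n -> R) : Prop :=
  u \in Lfun mu p%:E /\ \int[mu \x mu]_z (diff_quotient s p u z)%:E < +oo.

(* J_energy carries a factor p^-1 that b_coef does not, so that
   s * J_energy m p s u tends to p^-1 * \int |u|^p b. For m = 1,
   s * \int\int diff_quotient tends to (2 |S^(n-1)| / p) * \int |u|^p
   (Maz'ya-Shaposhnikova) and b_coef to 2 |S^(n-1)| / p. *)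
Definition J_energy (m : Rn R n * Rn R n -> R) (p s : R) (u : Rn R n -> R) :
    \bar R :=
  ((1 - s) / p)%:E * \int[mu \x mu]_z (m z * diff_quotient s p u z)%:E.

Definition b_coef (m : Rn R n * Rn R n -> R) (p s : R) (x : Rn R n) : \bar R :=
  (2 * s)%:E * \int[@hausdorff_measure R n n.-1]_(w in unit_sphere)
    \int[lebesgue_measure]_(r in `](2 * enorm x)%R, +oo[%classic)
      (m (x, vscale r w) / r `^ (s * p + 1))%:E.

End nonlocal_energy.

(* Main.v *)
(* Reflecting (x, h) to (x - h, -h) preserves m, and the part |h| <= 1 of the
   double integral stays bounded as s -> 0, since u is in W^(s_0,p). For |h| > 1
   the regions 2|x| < |h| and 2|x - h| < |h| are disjoint and exchanged by the
   reflection. On the first one |u(x) - u(x - h)|^p equals |u(x)|^p up to a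
   factor 1 + eta and a multiple of |u(x - h)|^p, because
   (a + b)^p <= (1 + eta) a^p + c(eta) b^p. The errors, and the contribution of
   the remaining pairs, are bounded by the integral of |u(x)|^p |h|^(-n-sp) over
   1 < |h| <= 2|x|, which is o(1/s) by dominated convergence. The main term is
   2 s times the integral of m(x,h) |u(x)|^p |h|^(-n-sp) over the first region;
   by polar coordinates 2 s times its integral in h alone is |u(x)|^p times
   b_s(x) + O(s) for x <> 0, and dominated convergence applies again.

   Polar coordinates produce the cone measure on the sphere. It is the Hausdorff
   measure because both have the same density on small sets: coverings are
   compared with it through the gnomonic projection and the isodiametric
   inequality (Steiner symmetrization), and small caps through Vitali's
   selection of disjoint balls. *)
From HB Require Import structures.
Require Import Defs.
From mathcomp Require Import all_boot all_order all_algebra.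
From mathcomp Require Import all_classical all_reals all_analysis.
From mathcomp Require Import measurable_realfun ring lra.

Set Implicit Arguments.
Unset Strict Implicit.
Unset Printing Implicit Defensive.

Import Order.TTheory GRing.Theory Num.Theory.
Import numFieldNormedType.Exports.

Local Open Scope classical_set_scope.
Local Open Scope ring_scope.

(** * Euclidean geometry of tuples *)

Section euclidean_geometry.
Context {R : realType} {n : nat}.
Implicit Types (x y z v : Rn R n) (r : R).

(** Several objects in the statement carry less structure than the analysis wants, and this shapes
    the proof. The bounds and the symmetry of [m] hold almost everywhere only, so [m] is traded for
    a version [M] that has both everywhere; since [b_coef] integrates [m] along rays, the
    exceptional null set has to be followed into polar coordinates. [hausdorff_measure] is a bare
    set function: the integral in [b_coef] is moved to the cone measure solely from their agreement
    on Borel subsets of the sphere. The limit [b] comes without measurability and is handled as an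
    upper limit of measurable functions. Finally, the constant $c(\eta)$ may blow up as $\eta\to0$,
    so $\eta$ stays fixed while $s\to0$; what has to be shown is a two-sided comparison with factors
    $1+\eta$ whose error terms vanish for each $\eta$. This is done along sequences, because
    dominated convergence is sequential. *)

Definition coord x (i : 'I_n) : R := tnth x i.

Definition dot x y : R := \sum_(i < n) coord x i * coord y i.

Lemma Rn_ext x y : (forall i, coord x i = coord y i) -> x = y.
Proof. by move=> xy; apply: eq_from_tnth. Qed.

Lemma coord_mktuple (f : 'I_n -> R) i :
  coord ([tuple f i | i < n] : Rn R n) i = f i.
Proof. by rewrite /coord tnth_mktuple. Qed.

Lemma coord_vsub x y i : coord (vsub x y) i = coord x i - coord y i.
Proof. exact: coord_mktuple. Qed.

Lemma coord_vopp x i : coord (vopp x) i = - coord x i.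
Proof. exact: coord_mktuple. Qed.

Lemma coord_vscale r x i : coord (vscale r x) i = r * coord x i.
Proof. exact: coord_mktuple. Qed.

Definition coordE := (coord_vsub, coord_vopp, coord_vscale).

Lemma dotC x y : dot x y = dot y x.
Proof. by apply: eq_bigr => i _; rewrite mulrC. Qed.

Lemma dot_vsubl x y z : dot (vsub x y) z = dot x z - dot y z.
Proof.
rewrite /dot -sumrB; apply: eq_bigr => i _.
by rewrite coordE mulrBl.
Qed.

Lemma dot_vsubr x y z : dot z (vsub x y) = dot z x - dot z y.
Proof. by rewrite dotC dot_vsubl !(dotC z). Qed.

Lemma dot_vscalel r x y : dot (vscale r x) y = r * dot x y.
Proof.
rewrite /dot mulr_sumr; apply: eq_bigr => i _.
by rewrite coordE mulrA.
Qed.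

Lemma dot_vscaler r x y : dot y (vscale r x) = r * dot y x.
Proof. by rewrite dotC dot_vscalel dotC. Qed.

Definition dotE := (dot_vsubl, dot_vsubr, dot_vscalel, dot_vscaler).

Lemma dot_ge0 x : 0 <= dot x x.
Proof. by apply: sumr_ge0 => i _; rewrite -expr2 sqr_ge0. Qed.

Lemma enormE x : enorm x = Num.sqrt (dot x x).
Proof. by congr Num.sqrt; apply: eq_bigr => i _; rewrite expr2. Qed.

Lemma enorm_ge0 x : 0 <= enorm x.
Proof. exact: sqrtr_ge0. Qed.

Lemma sqr_enorm x : enorm x ^+ 2 = dot x x.
Proof. by rewrite enormE sqr_sqrtr// dot_ge0. Qed.

Lemma enorm_eq x y : dot x x = dot y y -> enorm x = enorm y.
Proof. by rewrite !enormE => ->. Qed.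

Lemma enorm_le x r : 0 <= r -> (enorm x <= r) = (dot x x <= r ^+ 2).
Proof. by move=> r0; rewrite -sqr_enorm ler_pXn2r// nnegrE enorm_ge0. Qed.

(** For $x\ne0$, expanding $|\langle x,y\rangle x-|x|^2y|^2\ge0$ gives the squared inequality
    multiplied by $|x|^2$. *)
Lemma cauchy_schwarz x y : dot x y <= enorm x * enorm y.
Proof.
have [x0|x0] := eqVneq (dot x x) 0.
  have x_eq0 i : coord x i = 0.
    have /eqP := x0; rewrite psumr_eq0 => [/allP /(_ i)|j _].
      by rewrite mem_index_enum => /(_ isT) /=; rewrite -expr2 sqrf_eq0 => /eqP.
    by rewrite -expr2 sqr_ge0.
  rewrite /dot big1 => [|i _]; last by rewrite x_eq0 mul0r.
  by rewrite mulr_ge0 ?enorm_ge0.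
have x_gt0 : 0 < dot x x by rewrite lt0r x0 dot_ge0.
have [|xy0] := leP (dot x y) 0.
  by move=> /le_trans; apply; rewrite mulr_ge0 ?enorm_ge0.
rewrite -(@ler_pXn2r _ 2)// ?nnegrE ?(ltW xy0) ?mulr_ge0 ?enorm_ge0//.
rewrite exprMn !sqr_enorm.
have := dot_ge0 (vsub (vscale (dot x y) x) (vscale (dot x x) y)).
rewrite !dotE (dotC y x).
rewrite (_ : _ - _ = dot x x * (dot x x * dot y y - dot x y ^+ 2)); last first.
  by ring.
by rewrite pmulr_rge0// subr_ge0.
Qed.

Lemma enorm_vopp x : enorm (vopp x) = enorm x.
Proof.
apply: enorm_eq; rewrite /dot; apply: eq_bigr => i _.
by rewrite coordE mulrNN.
Qed.

Lemma vsubK x y : vsub (vsub x y) (vopp y) = x.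
Proof. by apply: Rn_ext => i; rewrite !coordE; ring. Qed.

Lemma vsubKC x y : vsub x (vsub x y) = y.
Proof. by apply: Rn_ext => i; rewrite !coordE; ring. Qed.

Lemma voppK x : vopp (vopp x) = x.
Proof. by apply: Rn_ext => i; rewrite !coordE opprK. Qed.

Lemma vopp_vsub x y : vopp (vsub x y) = vsub y x.
Proof. by apply: Rn_ext => i; rewrite !coordE opprB. Qed.

Lemma enorm_vsubC x y : enorm (vsub x y) = enorm (vsub y x).
Proof. by rewrite -vopp_vsub enorm_vopp. Qed.

Lemma enorm_vscale r x : enorm (vscale r x) = `|r| * enorm x.
Proof.
by rewrite !enormE !dotE mulrA -expr2 sqrtrM ?sqr_ge0// sqrtr_sqr.
Qed.

Lemma ler_enormB x y : enorm (vsub x y) <= enorm x + enorm y.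
Proof.
rewrite enorm_le ?addr_ge0 ?enorm_ge0// !dotE (dotC y x).
have := cauchy_schwarz (vopp x) y; rewrite enorm_vopp.
have -> : dot (vopp x) y = - dot x y.
  by rewrite /dot -sumrN; apply: eq_bigr => i _; rewrite coordE mulNr.
by rewrite sqrrD !sqr_enorm; lra.
Qed.

Lemma ler_enormD x y : enorm x <= enorm (vsub x y) + enorm y.
Proof. by have := ler_enormB (vsub x y) (vopp y); rewrite vsubK enorm_vopp. Qed.

Lemma edist_triangle z x y :
  enorm (vsub x y) <= enorm (vsub x z) + enorm (vsub z y).
Proof.
have := ler_enormB (vsub x z) (vsub y z).
rewrite (_ : vsub (vsub x z) _ = vsub x y) ?(enorm_vsubC y)//.
by apply: Rn_ext => i; rewrite !coordE; ring.
Qed.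

Lemma ler_coord_enorm x i : `|coord x i| <= enorm x.
Proof.
rewrite enormE -sqrtr_sqr ler_wsqrtr// /dot (bigD1 i)//= -expr2 lerDl.
by apply: sumr_ge0 => j _; rewrite -expr2 sqr_ge0.
Qed.

Lemma enorm_le_coord x r : 0 <= r ->
  (forall i, `|coord x i| <= r) -> enorm x <= n%:R * r.
Proof.
move=> r0 xr.
rewrite enorm_le ?mulr_ge0//; apply: (@le_trans _ _ (\sum_(i < n) r ^+ 2)).
  apply: ler_sum => i _; rewrite -expr2 -[leLHS]ger0_norm ?sqr_ge0// normrX.
  by rewrite ler_pXn2r// nnegrE.
rewrite sumr_const card_ord -(mulr_natl (r ^+ 2)) exprMn ler_wpM2r ?sqr_ge0//.
rewrite -natrX ler_nat; have [->//|n0] := posnP n.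
by rewrite -{1}(expn1 n) leq_pexp2l.
Qed.

Lemma enorm_vsub_eq0 x y : enorm (vsub x y) = 0 -> x = y.
Proof.
move=> xy0; apply: Rn_ext => i; apply/eqP; rewrite -subr_eq0 -coord_vsub.
by rewrite -normr_le0 -xy0 ler_coord_enorm.
Qed.

Lemma vsubxx x : enorm (vsub x x) = 0.
Proof.
by rewrite enormE /dot big1 ?sqrtr0// => i _; rewrite coordE subrr mul0r.
Qed.

Lemma vscaleA r (s : R) x : vscale r (vscale s x) = vscale (r * s) x.
Proof. by apply: Rn_ext => i; rewrite !coordE mulrA. Qed.

Lemma vscale1 x : vscale 1 x = x.
Proof. by apply: Rn_ext => i; rewrite !coordE mul1r. Qed.

Lemma vscale_vsub r x y : vscale r (vsub x y) = vsub (vscale r x) (vscale r y).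
Proof. by apply: Rn_ext => i; rewrite !coordE mulrBr. Qed.

End euclidean_geometry.

Section euclidean_measurability.
Context {R : realType} {n : nat}.

Lemma measurable_coord i : measurable_fun setT (fun x : Rn R n => coord x i).
Proof. exact: measurable_tnth. Qed.

Lemma measurable_Rn d (T : measurableType d) (f : T -> Rn R n) :
  (forall i, measurable_fun setT (fun t => coord (f t) i)) ->
  measurable_fun setT f.
Proof. by move=> mf; apply/measurable_fun_tnthP => i; exact: mf. Qed.

Lemma measurable_dot d (T : measurableType d) (f g : T -> Rn R n) :
  measurable_fun setT f -> measurable_fun setT g ->
  measurable_fun setT (fun t => dot (f t) (g t)).
Proof.
move=> mf mg; apply: measurable_sum => i.
apply: measurable_funM.
  exact: measurableT_comp (measurable_coord i) mf.
exact: measurableT_comp (measurable_coord i) mg.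
Qed.

Lemma measurable_enorm : measurable_fun setT (@enorm R n).
Proof.
rewrite (_ : enorm = fun x => Num.sqrt (dot x x)); last first.
  by apply/funext => x; rewrite enormE.
apply: (@measurableT_comp _ _ _ _ _ _ (@Num.sqrt R)); last exact: measurable_dot.
by apply: continuous_measurable_fun; exact: sqrt_continuous.
Qed.

Lemma measurable_vsub d (T : measurableType d) (f g : T -> Rn R n) :
  measurable_fun setT f -> measurable_fun setT g ->
  measurable_fun setT (fun t => vsub (f t) (g t)).
Proof.
move=> mf mg; apply: measurable_Rn => i.
under eq_fun do rewrite coord_vsub.
apply: measurable_funB.
  exact: measurableT_comp (measurable_coord i) mf.
exact: measurableT_comp (measurable_coord i) mg.
Qed.

Lemma measurable_vscale d (T : measurableType d) (f : T -> R)
    (g : T -> Rn R n) :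
  measurable_fun setT f -> measurable_fun setT g ->
  measurable_fun setT (fun t => vscale (f t) (g t)).
Proof.
move=> mf mg; apply: measurable_Rn => i.
under eq_fun do rewrite coord_vscale.
apply: measurable_funM => //.
exact: measurableT_comp (measurable_coord i) mg.
Qed.

Lemma measurable_vopp d (T : measurableType d) (g : T -> Rn R n) :
  measurable_fun setT g -> measurable_fun setT (fun t => vopp (g t)).
Proof.
move=> mg; apply: measurable_Rn => i.
under eq_fun do rewrite coord_vopp.
apply: measurableT_comp => //.
exact: measurableT_comp (measurable_coord i) mg.
Qed.

Lemma measurable_vscalel (r : R) : measurable_fun setT (@vscale R n r).
Proof. exact: measurable_vscale. Qed.

End euclidean_measurability.

Section indicators.
Context d (T : measurableType d) {R : realType}.
Local Open Scope ereal_scope.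

Lemma measurable_EFin_indic (A : set T) : measurable A ->
  measurable_fun setT (fun x => (\1_A x : R)%:E).
Proof. by move=> mA; exact/measurable_EFinP/measurable_indic. Qed.

Lemma integral_indicT (mu : {measure set T -> \bar R}) (A : set T) :
  measurable A -> \int[mu]_x (\1_A x)%:E = mu A.
Proof. by move=> mA; rewrite integral_indic// setIT. Qed.

Lemma indic_ge0 (A : set T) x : 0 <= (\1_A x : R)%:E.
Proof. by rewrite lee_fin. Qed.

Lemma measurable_preimageT d' (T' : measurableType d') (f : T -> T')
  (A : set T') : measurable_fun setT f -> measurable A ->
  measurable (f @^-1` A).
Proof. by move=> mf mA; rewrite -[X in measurable X]setTI; exact: mf. Qed.

Lemma measurable_set_le (f g : T -> R) :
  measurable_fun setT f -> measurable_fun setT g ->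
  measurable [set t | (f t <= g t)%R].
Proof.
move=> mf mg; have /(_ measurableT [set true]) := measurable_fun_ler mf mg.
by rewrite setTI; exact.
Qed.

Lemma measurable_set_lt (f g : T -> R) :
  measurable_fun setT f -> measurable_fun setT g ->
  measurable [set t | (f t < g t)%R].
Proof.
move=> mf mg; have /(_ measurableT [set true]) := measurable_fun_ltr mf mg.
by rewrite setTI; exact.
Qed.

End indicators.

(** * Integration over R^n *)

Set Implicit Arguments.
Unset Strict Implicit.
Unset Printing Implicit Defensive.

Import Order.TTheory GRing.Theory Num.Theory.
Import numFieldNormedType.Exports.

Local Open Scope classical_set_scope.
Local Open Scope ring_scope.
Section cons_Rn_algebra.
Context {R : realType} {n : nat}.
Implicit Types (a b : R) (x y : Rn R n).

Lemma coord_cons0 a x : coord (cons_Rn (a, x)) ord0 = a.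
Proof. by rewrite /coord tnth0. Qed.

Lemma coord_consS a x i : coord (cons_Rn (a, x)) (lift ord0 i) = coord x i.
Proof. by rewrite /coord tnthS. Qed.

Definition coord_consE := (coord_cons0, coord_consS).

Lemma cons_Rn_surj (v : Rn R n.+1) : exists a x, v = cons_Rn (a, x).
Proof.
by exists (thead v), [tuple of behead v]; rewrite [LHS]tuple_eta.
Qed.

Lemma Rn_extS (v w : Rn R n.+1) : coord v ord0 = coord w ord0 ->
  (forall i, coord v (lift ord0 i) = coord w (lift ord0 i)) -> v = w.
Proof.
move=> h0 hS; apply: Rn_ext => i.
by have [j ->|->] := unliftP ord0 i.
Qed.

Lemma vsub_cons a b x y :
  vsub (cons_Rn (a, x)) (cons_Rn (b, y)) = cons_Rn (a - b, vsub x y).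
Proof. by apply: Rn_extS => [|i]; rewrite coord_vsub !coord_consE ?coordE. Qed.

Lemma vscale_cons (c : R) a x :
  vscale c (cons_Rn (a, x)) = cons_Rn (c * a, vscale c x).
Proof. by apply: Rn_extS => [|i]; rewrite coord_vscale !coord_consE ?coordE. Qed.

Lemma dot_cons a b x y :
  dot (cons_Rn (a, x)) (cons_Rn (b, y)) = a * b + dot x y.
Proof.
rewrite /dot big_ord_recl !coord_consE; congr (_ + _).
by apply: eq_bigr => i _; rewrite !coord_consE.
Qed.

End cons_Rn_algebra.

Section lebesgue_Rn_integral.
Context {R : realType}.
Local Open Scope ereal_scope.
Notation lam := (@lebesgue_measure R).

Lemma integral_Rn0 (f : Rn R 0 -> \bar R) : measurable_fun setT f ->
  \int[lebesgue_Rn R 0]_x f x = f [tuple].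
Proof. by move=> mf; rewrite integral_dirac// diracT mul1e. Qed.

Lemma lebesgue_RnSE n (A : set (Rn R n.+1)) :
  lebesgue_Rn R n.+1 A = (lam \x lebesgue_Rn R n) (@cons_Rn R n @^-1` A).
Proof. by []. Qed.

Section successor.
Variables (n : nat) (f : Rn R n.+1 -> \bar R).
Hypotheses (mf : measurable_fun setT f) (f0 : forall x, 0 <= f x).

Let mfc : measurable_fun setT (f \o @cons_Rn R n).
Proof. exact: measurableT_comp mf (@measurable_cons_Rn R n). Qed.

Let integral_prod : \int[lebesgue_Rn R n.+1]_x f x =
  \int[lam \x lebesgue_Rn R n]_z f (cons_Rn z).
Proof.
have -> : \int[lebesgue_Rn R n.+1]_x f x =
  \int[pushforward (lam \x lebesgue_Rn R n) (@cons_Rn R n)]_x f x by [].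
by rewrite ge0_integral_pushforward//; exact: measurable_cons_Rn.
Qed.

Lemma integral_RnS : \int[lebesgue_Rn R n.+1]_x f x =
  \int[lam]_a \int[lebesgue_Rn R n]_y f (cons_Rn (a, y)).
Proof. by rewrite integral_prod (fubini_tonelli1 _ mfc (fun z => f0 _)). Qed.

Lemma integral_RnS_sym : \int[lebesgue_Rn R n.+1]_x f x =
  \int[lebesgue_Rn R n]_y \int[lam]_a f (cons_Rn (a, y)).
Proof. by rewrite integral_prod (fubini_tonelli2 _ mfc (fun z => f0 _)). Qed.

End successor.

(** By uniqueness of Lebesgue measure it suffices to compare on the intervals []a, b]]. For [c < 0]
    the preimage is open on the other side, which does not change its length. *)
Lemma lebesgue_measure_affine (c v : R) (A : set R) : (c != 0)%R ->
  measurable A ->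
  lam [set a | A (c * a - v)%R] = (`|c|^-1)%:E * lam A.
Proof.
move=> c0 mA.
pose phi (a : measurableTypeR R) : measurableTypeR R := (c * a - v)%R.
have mphi : measurable_fun setT phi.
  by apply: measurable_funB => //; apply: measurable_funM.
have k0 : (0 <= `|c|)%R by [].
pose mu : {measure set (measurableTypeR R) -> \bar R} :=
  mscale (NngNum k0) (measure_function_pushforward__canonical__measure_function_Measure lam mphi).
suff /(_ A mA) -> : forall B, measurable B -> lam B = mu B.
  by rewrite /mu /= /mscale /= muleA -EFinM mulVf ?normr_eq0// mul1e.
apply: lebesgue_measure_unique => _ [[a b] _ <-]/=.
rewrite /mu /= /mscale /= /pushforward.
have cgt : (0 < `|c|)%R by rewrite normr_gt0.
have [cpos|cneg] := ltrP 0 c.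
  rewrite (_ : _ @^-1` _ = `]((a + v) / c)%R, ((b + v) / c)%R]%classic); last first.
    apply/seteqP; split => x /=; rewrite /phi !in_itv/= => /andP[h1 h2].
      by apply/andP; split; rewrite ?ltr_pdivrMr// ?ler_pdivlMr//; lra.
    by move: h1 h2; rewrite ltr_pdivrMr// ler_pdivlMr// => h1 h2; lra.
  rewrite !lebesgue_measure_itv/= !lte_fin ltr_pM2r ?invr_gt0// ltrD2r.
  case: ifPn => ab; last by rewrite mule0.
  rewrite -!EFinD -EFinM gtr0_norm//; congr EFin; field.
  by rewrite gt_eqF.
have {}cneg : (c < 0)%R by rewrite lt_neqAle c0.
rewrite (_ : _ @^-1` _ = `[((b + v) / c)%R, ((a + v) / c)%R[%classic); last first.
  apply/seteqP; split => x /=; rewrite /phi !in_itv/= => /andP[h1 h2].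
    by apply/andP; split; rewrite ?ler_ndivrMr// ?ltr_ndivlMr//; lra.
  by move: h1 h2; rewrite ler_ndivrMr// ltr_ndivlMr// => h1 h2; lra.
rewrite !lebesgue_measure_itv/= !lte_fin ltr_nM2r ?invr_lt0// ltrD2r.
case: ifPn => ab; last by rewrite mule0.
rewrite -!EFinD -EFinM ltr0_norm//; congr EFin; field.
by rewrite lt_eqF.
Qed.

Lemma integral_affine (c v : R) (f : R -> \bar R) : (c != 0)%R ->
  measurable_fun setT f -> (forall a, 0 <= f a) ->
  \int[lam]_a f (c * a - v)%R = (`|c|^-1)%:E * \int[lam]_a f a.
Proof.
move=> c0 mf f0.
pose phi (a : measurableTypeR R) : measurableTypeR R := (c * a - v)%R.
have mphi : measurable_fun setT phi.
  by apply: measurable_funB => //; apply: measurable_funM.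
have k0 : (0 <= `|c|^-1)%R by [].
rewrite -(@ge0_integral_mscale _ _ _ lam setT measurableT (NngNum k0))//.
pose mu1 : {measure set (measurableTypeR R) -> \bar R} :=
  measure_function_pushforward__canonical__measure_function_Measure lam mphi.
pose mu2 : {measure set (measurableTypeR R) -> \bar R} := mscale (NngNum k0) lam.
transitivity (\int[mu1]_a f a).
  by rewrite [RHS]ge0_integral_pushforward.
apply: (@eq_measure_integral _ _ _ setT mu2 mu1) => A mA _.
exact: (@lebesgue_measure_affine c v A).
Qed.

(** Induction on the dimension: each coordinate contributes one factor $|c|^{-1}$. Translations,
    reflections ($c=-1$) and dilations are all instances. *)
Lemma integral_Rn_affine n (c : R) (v : Rn R n) (f : Rn R n -> \bar R) :
  (c != 0)%R -> measurable_fun setT f -> (forall x, 0 <= f x) ->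
  \int[lebesgue_Rn R n]_x f (vsub (vscale c x) v) =
  (`|c| ^- n)%:E * \int[lebesgue_Rn R n]_x f x.
Proof.
move=> c0; elim: n v f => [|n IH] v f mf f0.
  have mfa : measurable_fun setT (fun x => f (vsub (vscale c x) v)).
    apply: measurableT_comp mf _; apply: measurable_vsub => //.
    exact: measurable_vscale.
  rewrite (integral_Rn0 mfa) (integral_Rn0 mf) expr0 invr1 mul1e.
  by congr f; apply: Rn_ext => -[].
have mfa : measurable_fun setT (fun x => f (vsub (vscale c x) v)).
  apply: measurableT_comp mf _; apply: measurable_vsub => //.
  exact: measurable_vscale.
rewrite !integral_RnS//; have [b [w vE]] := cons_Rn_surj v.
have mfc a : measurable_fun setT (fun y => f (cons_Rn (a, y))).
  apply: measurableT_comp mf _; apply: measurableT_comp => //.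
  exact: measurable_cons_Rn.
pose F (a : measurableTypeR R) : \bar R :=
  \int[lebesgue_Rn R n]_y f (cons_Rn (a, y)).
have mF : measurable_fun setT F.
  apply: (measurable_fun_fubini_tonelli_F (f \o @cons_Rn R n)) => [|z].
    exact: measurableT_comp mf (@measurable_cons_Rn R n).
  exact: f0.
have F0 a : 0 <= F a by exact: integral_ge0.
transitivity (\int[lam]_a ((`|c| ^- n)%:E *
    \int[lebesgue_Rn R n]_y f (cons_Rn ((c * a - b)%R, y)))).
  apply: eq_integral => a _.
  rewrite -(IH w (fun y => f (cons_Rn ((c * a - b)%R, y))))//.
  by apply: eq_integral => y _; rewrite vE vscale_cons vsub_cons.
transitivity (\int[lam]_a ((`|c| ^- n)%:E * F (c * a - b)%R)) => //.
rewrite -[X in _ = _ * X]/(\int[lam]_a F a).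
move: F mF F0 => F mF F0.
pose phi (a : measurableTypeR R) : measurableTypeR R := (c * a - b)%R.
have mphi : measurable_fun setT phi.
  by apply: measurable_funB => //; apply: measurable_funM.
have mFa : measurable_fun setT (F \o phi) by exact: measurableT_comp mF mphi.
have k0 : (0 <= `|c| ^- n)%R by rewrite invr_ge0 exprn_ge0.
transitivity ((`|c| ^- n)%:E * \int[lam]_a F (c * a - b)%R).
  exact: (ge0_integralZl_EFin lam measurableT (fun x _ => F0 (phi x)) mFa k0).
rewrite (integral_affine b c0 mF F0) muleA -EFinM.
by rewrite exprSr invfM mulrC.
Qed.

Lemma integral_Rn_translate n (v : Rn R n) (f : Rn R n -> \bar R) :
  measurable_fun setT f -> (forall x, 0 <= f x) ->
  \int[lebesgue_Rn R n]_x f (vsub x v) = \int[lebesgue_Rn R n]_x f x.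
Proof.
move=> mf f0; have := integral_Rn_affine v (oner_neq0 R) mf f0.
by rewrite normr1 expr1n invr1 mul1e; under eq_integral do rewrite vscale1.
Qed.

Lemma integral_Rn_reflect n (v : Rn R n) (f : Rn R n -> \bar R) :
  measurable_fun setT f -> (forall x, 0 <= f x) ->
  \int[lebesgue_Rn R n]_x f (vsub v x) = \int[lebesgue_Rn R n]_x f x.
Proof.
move=> mf f0; have N10 : (-1 != 0 :> R)%R by rewrite oppr_eq0 oner_neq0.
have := integral_Rn_affine (vopp v) N10 mf f0.
rewrite normrN1 expr1n invr1 mul1e => <-; apply: eq_integral => x _.
by congr f; apply: Rn_ext => i; rewrite !coordE; ring.
Qed.

Lemma integral_Rn_scale n (c : R) (f : Rn R n -> \bar R) : (c != 0)%R ->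
  measurable_fun setT f -> (forall x, 0 <= f x) ->
  \int[lebesgue_Rn R n]_x f (vscale c x) =
  (`|c| ^- n)%:E * \int[lebesgue_Rn R n]_x f x.
Proof.
move=> c0 mf f0; pose o : Rn R n := [tuple 0%R | i < n].
rewrite -(integral_Rn_affine o c0)//; apply: eq_integral => x _.
by congr f; apply: Rn_ext => i; rewrite !coordE coord_mktuple subr0.
Qed.

Lemma lebesgue_Rn_affine n (c : R) (v : Rn R n) (A : set (Rn R n)) :
  (c != 0)%R -> measurable A ->
  lebesgue_Rn R n [set x | A (vsub (vscale c x) v)] =
  (`|c| ^- n)%:E * lebesgue_Rn R n A.
Proof.
move=> c0 mA; have mphi : measurable_fun setT (fun x : Rn R n => vsub (vscale c x) v).
  by apply: measurable_vsub => //; exact: measurable_vscale.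
have := integral_Rn_affine v c0 (measurable_EFin_indic mA) (@indic_ge0 _ _ R A).
rewrite (integral_indicT (lebesgue_Rn R n) mA) => <-.
by rewrite -integral_indicT//; exact: measurable_preimageT mA.
Qed.

End lebesgue_Rn_integral.

Section balls.
Context {R : realType}.
Local Open Scope ereal_scope.
Notation lam := (@lebesgue_measure R).

Definition cball {n} (c : Rn R n) (r : R) : set (Rn R n) :=
  [set x | (enorm (vsub x c) <= r)%R].

Lemma measurable_cball n (c : Rn R n) r : measurable (cball c r).
Proof.
apply: measurable_set_le => //; apply: measurableT_comp measurable_enorm _.
exact: measurable_vsub.
Qed.

Lemma measurable_unit_ball n : measurable (@unit_ball R n).
Proof. by apply: measurable_set_le => //; exact: measurable_enorm. Qed.

(** Cubes have an explicit volume; one around the unit ball and one inside it show that the volume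
    of the ball is finite and positive. *)
Definition cube n (c : R) : set (Rn R n) :=
  [set x | forall i, (`|coord x i| <= c)%R].

Lemma cubeS n (c : R) : @cons_Rn R n @^-1` (@cube n.+1 c) =
  `[(- c)%R, c] `*` @cube n c.
Proof.
apply/seteqP; split=> [[a x] h|[a x] [/= ha hx] i].
  split=> [|i] /=.
    by have := h ord0; rewrite coord_cons0 ler_norml in_itv.
  by have := h (lift ord0 i); rewrite coord_consS.
have [j ->|->] := unliftP ord0 i; rewrite ?coord_consS ?coord_cons0 //.
by move: ha; rewrite in_itv/= ler_norml.
Qed.

Lemma measurable_cube n c : measurable (@cube n c).
Proof.
rewrite (_ : cube c = \bigcap_(i in [set: 'I_n])
    [set x | (`|coord x i| <= c)%R]); last first.
  by apply/seteqP; split => x /= h i => [_|]; exact: h.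
apply: fin_bigcap_measurable => [|i _]; first exact: finite_finset.
apply: measurable_set_le => //.
by apply: measurableT_comp => //; exact: measurable_coord.
Qed.

Lemma lebesgue_Rn_cube n (c : R) : (0 <= c)%R ->
  lebesgue_Rn R n (@cube n c) = ((2 * c) ^+ n)%:E.
Proof.
move=> c0; elim: n => [|n IH].
  by rewrite [LHS]diracE expr0 mem_set// => -[].
rewrite lebesgue_RnSE cubeS product_measure1E//; last exact: measurable_cube.
rewrite [X in _ * X]IH /= lebesgue_measure_itv/= lte_fin exprS EFinM.
case: ifPn => [_|].
  by rewrite -EFinD opprK; congr (_%:E * _); ring.
rewrite -leNgt => cN; have -> : c = 0%R by apply/eqP; rewrite eq_le; lra.
by rewrite mulr0 mul0e.
Qed.

Lemma unit_ball_sub_cube n : @unit_ball R n `<=` cube 1.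
Proof. by move=> x x1 i; apply: le_trans x1; exact: ler_coord_enorm. Qed.

(** The half side $1/(n+1)$, rather than $1/n$, also serves $n=0$. *)
Lemma cube_sub_unit_ball n : cube n.+1%:R^-1 `<=` @unit_ball R n.
Proof.
move=> x xc; rewrite /unit_ball /=.
apply: (@le_trans _ _ (n%:R * n.+1%:R^-1)%R).
  by apply: enorm_le_coord => //; exact: xc.
by rewrite ler_pdivrMr ?mul1r ?ler_nat.
Qed.

Lemma lebesgue_Rn_unit_ball_lty n : lebesgue_Rn R n unit_ball < +oo.
Proof.
apply: (@le_lt_trans _ _ (lebesgue_Rn R n (cube 1))).
  by apply: le_measure; rewrite ?inE;
    [exact: measurable_unit_ball|exact: measurable_cube|
     exact: unit_ball_sub_cube].
by rewrite lebesgue_Rn_cube// ltry.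
Qed.

Lemma lebesgue_Rn_unit_ball_gt0 n : 0 < lebesgue_Rn R n unit_ball.
Proof.
apply: (@lt_le_trans _ _ (lebesgue_Rn R n (cube n.+1%:R^-1))).
  by rewrite lebesgue_Rn_cube// lte_fin exprn_gt0// mulr_gt0// invr_gt0.
apply: le_measure; rewrite ?inE;
    [exact: measurable_cube|exact: measurable_unit_ball|
     exact: cube_sub_unit_ball].
Qed.

Definition ball_volume n : R := fine (lebesgue_Rn R n unit_ball).

Lemma ball_volumeE n : lebesgue_Rn R n unit_ball = (ball_volume n)%:E.
Proof.
by rewrite fineK// ge0_fin_numE ?lebesgue_Rn_unit_ball_lty.
Qed.

Lemma ball_volume_gt0 n : (0 < ball_volume n)%R.
Proof. by rewrite -lte_fin -ball_volumeE lebesgue_Rn_unit_ball_gt0. Qed.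

Lemma lebesgue_Rn_cball n (c : Rn R n) (r : R) : (0 < r)%R ->
  lebesgue_Rn R n (cball c r) = (ball_volume n * r ^+ n)%:E.
Proof.
move=> r0; have ri0 : (r^-1 != 0)%R by rewrite invr_neq0// gt_eqF.
have -> : cball c r =
    [set x | unit_ball (vsub (vscale r^-1 x) (vscale r^-1 c))].
  apply/seteqP; split => x; rewrite /cball /unit_ball /=;
    rewrite -vscale_vsub enorm_vscale ger0_norm ?invr_ge0 ?(ltW r0)//;
    by rewrite mulrC ler_pdivrMr// mul1r.
rewrite lebesgue_Rn_affine//; last exact: measurable_unit_ball.
rewrite ball_volumeE -EFinM normfV exprVn invrK gtr0_norm//.
by rewrite mulrC.
Qed.

End balls.

(** * Invariance of Lebesgue measure under linear isometries *)

Section isometry.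
Context {R : realType} {n : nat}.
Local Open Scope ereal_scope.
Notation L := (lebesgue_Rn R n).
Variables Q Q' : Rn R n -> Rn R n.
Hypothesis mQ : measurable_fun setT Q.
Hypothesis Q'K : cancel Q' Q.
Hypothesis QB : forall x y, Q (vsub x y) = vsub (Q x) (Q y).
Hypothesis Qnorm : forall x, enorm (Q x) = enorm x.

(** Since $Qx-v=Q(x-Q'v)$, translation invariance passes through [Q]. *)
Let integral_shift (f : Rn R n -> \bar R) (v : Rn R n) :
  measurable_fun setT f -> (forall x, 0 <= f x) ->
  \int[L]_x f (vsub (Q x) v) = \int[L]_x f (Q x).
Proof.
move=> mf f0.
have mfQ : measurable_fun setT (f \o Q) by exact: measurableT_comp mf mQ.
rewrite -[RHS](integral_Rn_translate (Q' v) mfQ (fun x => f0 (Q x))).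
by apply: eq_integral => x _ /=; rewrite QB Q'K.
Qed.

(* Uniqueness of the translation-invariant measure: both sides times the
   volume of the ball [B] equal the integral of [f(z) 1_B(Q x - z)]. *)
Lemma integral_isometry (f : Rn R n -> \bar R) :
  measurable_fun setT f -> (forall x, 0 <= f x) ->
  \int[L]_x f (Q x) = \int[L]_x f x.
Proof.
move=> mf f0.
pose g : Rn R n -> \bar R := EFin \o \1_(@unit_ball R n).
have mg : measurable_fun setT g.
  by apply/measurable_EFinP/measurable_indic; exact: measurable_unit_ball.
have g0 x : 0 <= g x by rewrite lee_fin.
have intg : \int[L]_x g x = (ball_volume n)%:E.
  rewrite integral_indicT; last exact: measurable_unit_ball.
  exact: ball_volumeE.
have intgQ : \int[L]_x g (Q x) = (ball_volume n)%:E.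
  rewrite -intg; apply: eq_integral => x _.
  rewrite /g /= !indicE; congr ((nat_of_bool _)%:R%:E).
  by apply/idP/idP; rewrite !inE /unit_ball /= Qnorm.
have mfQ : measurable_fun setT (f \o Q) by exact: measurableT_comp mf mQ.
have mQv (h : Rn R n -> \bar R) (y : Rn R n) : measurable_fun setT h ->
    measurable_fun setT (fun x => h (vsub (Q x) y)).
  move=> mh; exact: (measurableT_comp mh (measurable_vsub mQ (measurable_cst y))).
have e1 : (\int[L]_x f (Q x)) * (ball_volume n)%:E =
    \int[L]_y \int[L]_x (g y * f (vsub (Q x) y)).
  rewrite -intg -ge0_integralZl//; last exact: integral_ge0.
  apply: eq_integral => y _; rewrite ge0_integralZl//; last first.
    exact: mQv.
  by rewrite integral_shift// muleC.
have e2 : (\int[L]_x f x) * (ball_volume n)%:E =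
    \int[L]_z \int[L]_x (f z * g (vsub (Q x) z)).
  have k0 : 0 <= \int[L]_x g (Q x) by exact: integral_ge0.
  rewrite -intgQ muleC -(ge0_integralZl L measurableT mf (fun x _ => f0 x) k0).
  apply: eq_integral => z _; rewrite muleC -(integral_shift z mg g0).
  by rewrite -(ge0_integralZl L measurableT (mQv _ z mg) (fun x _ => g0 _) (f0 z)).
have e12 : (\int[L]_x f (Q x)) * (ball_volume n)%:E =
    (\int[L]_x f x) * (ball_volume n)%:E.
  have mQ1 : measurable_fun setT (fun z : Rn R n * Rn R n => vsub (Q z.2) z.1).
    apply: measurable_vsub => //.
    exact: (measurableT_comp mQ).
  have m1 : measurable_fun setT
      (fun z : Rn R n * Rn R n => g z.1 * f (vsub (Q z.2) z.1)).
    apply: emeasurable_funM; first exact: (measurableT_comp mg).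
    exact: (measurableT_comp mf mQ1).
  have m2 : measurable_fun setT
      (fun z : Rn R n * Rn R n => f z.1 * g (vsub (Q z.2) z.1)).
    apply: emeasurable_funM; first exact: (measurableT_comp mf).
    exact: (measurableT_comp mg mQ1).
  rewrite e1 e2.
  rewrite (fubini_tonelli _ m1) => [|z]; last by rewrite mule_ge0.
  rewrite (fubini_tonelli _ m2) => [|z]; last by rewrite mule_ge0.
  apply: eq_integral => x _ /=.
  (* For fixed $x$ the substitution $y\mapsto Qx-y$ exchanges the arguments of [f] and [g]. *)
  rewrite -(@integral_Rn_reflect _ _ (Q x)) => [|//|y]; last by rewrite mule_ge0.
    by apply: eq_integral => y _; rewrite vsubKC muleC.
  apply: emeasurable_funM => //.
  exact: (measurableT_comp mf (measurable_vsub (measurable_cst (Q x)) (@measurable_id _ _ _))).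
have := congr1 (fun t => t * (ball_volume n)^-1%:E) e12.
rewrite -!muleA -EFinM mulfV ?mule1//.
by rewrite gt_eqF// ball_volume_gt0.
Qed.

Lemma lebesgue_Rn_isometry (A : set (Rn R n)) : measurable A ->
  L (Q @^-1` A) = L A.
Proof.
move=> mA; rewrite -(integral_indicT L mA).
rewrite -(integral_isometry (measurable_EFin_indic mA) (@indic_ge0 _ _ R A)).
by rewrite -integral_indicT//; exact: measurable_preimageT mA.
Qed.

End isometry.

(** * The isodiametric inequality *)

Section steiner_symmetrization.
Context {R : realType} {n : nat}.
Local Open Scope ereal_scope.
Notation lam := (@lebesgue_measure R).
Implicit Types (A : set (Rn R n.+1)) (x y : Rn R n).

Definition line_section A x : set (measurableTypeR R) :=
  [set a | A (cons_Rn (a, x))].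

(** Each line parallel to the first axis meets the new set in the open centred interval whose length
    is that of the old section. The strict inequality leaves lines with null sections empty, so a
    point of the new set always has points of [A] on its line. *)
Definition steiner A : set (Rn R n.+1) :=
  [set z | (2 * `|thead z|)%:E < lam (line_section A [tuple of behead z])].

Lemma steiner_cons A a x :
  steiner A (cons_Rn (a, x)) <-> (2 * `|a|)%:E < lam (line_section A x).
Proof.
rewrite /steiner /=; have -> : thead (cons_Rn (a, x)) = a by [].
by have -> : [tuple of behead (cons_Rn (a, x))] = x by exact: val_inj.
Qed.

Lemma line_sectionE A x :
  line_section A x = ysection (@cons_Rn R n @^-1` A) x.
Proof. by apply/seteqP; split => a; rewrite /ysection /= inE. Qed.

Lemma measurable_line_section A x : measurable A ->
  measurable (line_section A x).
Proof.
move=> mA; rewrite line_sectionE; apply: measurable_ysection.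
by apply: measurable_preimageT mA; exact: measurable_cons_Rn.
Qed.

Lemma measurable_lebesgue_line_section A : measurable A ->
  measurable_fun setT (fun x => lam (line_section A x)).
Proof.
move=> mA; under eq_fun do rewrite line_sectionE.
apply: measurable_fun_ysection.
by apply: measurable_preimageT mA; exact: measurable_cons_Rn.
Qed.

Lemma lebesgue_RnS_sections A : measurable A ->
  lebesgue_Rn R n.+1 A = \int[lebesgue_Rn R n]_x lam (line_section A x).
Proof.
move=> mA; rewrite -(integral_indicT (lebesgue_Rn R n.+1) mA).
rewrite (integral_RnS_sym (measurable_EFin_indic mA) (@indic_ge0 _ _ R A)).
apply: eq_integral => x _.
by rewrite -[RHS]integral_indicT//; exact: measurable_line_section.
Qed.

Lemma measurable_steiner A : measurable A -> measurable (steiner A).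
Proof.
move=> mA; rewrite -[X in measurable X]setTI.
apply: emeasurable_fun_lt => //.
  apply/measurable_EFinP; apply: measurable_funM => //.
  by apply: measurableT_comp => //; exact: (@measurable_tnth _ _ n.+1 ord0).
apply: (measurableT_comp (measurable_lebesgue_line_section mA)).
exact: measurable_behead.
Qed.

Lemma lebesgue_centered_interval (c : \bar R) : 0 <= c ->
  lam [set a | (2 * `|a|)%:E < c] = c.
Proof.
case: c => [r| |]//.
- rewrite lee_fin => r0.
  rewrite (_ : [set a | _] = `](- (r / 2))%R, (r / 2)%R[%classic); last first.
    apply/seteqP; split => a /=; rewrite lte_fin in_itv/= -ltr_norml; lra.
  rewrite lebesgue_measure_itv/= lte_fin; case: ifPn => h.
    by rewrite -EFinD; congr EFin; field.
  by congr EFin; move: h; rewrite -leNgt => h; apply/eqP; rewrite eq_le; lra.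
- move=> _; rewrite (_ : [set a | _] = setT).
    by rewrite -set_itvNyy lebesgue_measure_itv.
  by apply/seteqP; split => a //= _; exact: ltry.
Qed.

Lemma lebesgue_steiner A : measurable A ->
  lebesgue_Rn R n.+1 (steiner A) = lebesgue_Rn R n.+1 A.
Proof.
move=> mA; rewrite !lebesgue_RnS_sections//; last exact: measurable_steiner.
apply: eq_integral => x _.
rewrite -[RHS]lebesgue_centered_interval//.
by congr (lam _); apply/seteqP; split => a /=; rewrite -steiner_cons.
Qed.

(** Otherwise all $s\in E$ and $t\in F$ are closer than $|a-b|$, so $\sup E-\inf F$ and $\sup F-\inf
    E$ are at most $|a-b|$. Added up, the widths of [E] and [F] are together at most
    $2|a-b|\le2|a|+2|b|$, which is less than their total measure. *)
Lemma steiner_spread (E F : set (measurableTypeR R)) (a b : R) :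
  measurable E -> measurable F ->
  (2 * `|a|)%:E < lam E -> (2 * `|b|)%:E < lam F ->
  exists s t : R, [/\ E s, F t & (`|a - b| <= `|s - t|)%R].
Proof.
move=> mE mF aE bF; apply: contrapT => /forallNP ex.
have st s t : E s -> F t -> (`|s - t| < `|a - b|)%R.
  move=> Es Ft; rewrite ltNge; apply/negP => h.
  by have /forallNP/(_ t) := ex s; apply; split.
have E0 : E !=set0.
  apply/set0P/eqP => E0; move: aE; rewrite E0 measure0 lte_fin ltNge.
  by rewrite mulr_ge0.
have F0 : F !=set0.
  apply/set0P/eqP => F0; move: bF; rewrite F0 measure0 lte_fin ltNge.
  by rewrite mulr_ge0.
have [s0 Es0] := E0; have [t0 Ft0] := F0.
have Eu t : F t -> ubound E (t + `|a - b|)%R.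
  by move=> Ft s Es; have := st s t Es Ft; rewrite ltr_norml => /andP[]; lra.
have El t : F t -> lbound E (t - `|a - b|)%R.
  by move=> Ft s Es; have := st s t Es Ft; rewrite ltr_norml => /andP[]; lra.
have Fu s : E s -> ubound F (s + `|a - b|)%R.
  by move=> Es t Ft; have := st s t Es Ft; rewrite ltr_norml => /andP[]; lra.
have Fl s : E s -> lbound F (s - `|a - b|)%R.
  by move=> Es t Ft; have := st s t Es Ft; rewrite ltr_norml => /andP[]; lra.
have supE : has_sup E by split => //; exists (t0 + `|a - b|)%R; exact: Eu.
have infE : has_inf E by split => //; exists (t0 - `|a - b|)%R; exact: El.
have supF : has_sup F by split => //; exists (s0 + `|a - b|)%R; exact: Fu.
have infF : has_inf F by split => //; exists (s0 - `|a - b|)%R; exact: Fl.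
have width (G : set (measurableTypeR R)) (c : R) : measurable G -> has_sup G ->
    has_inf G -> (c%:E < lam G) -> (c < sup G - inf G)%R.
  move=> mG sG iG cG; rewrite -lte_fin; apply: lt_le_trans cG _.
  have Gb t : G t -> (inf G <= t <= sup G)%R.
    move=> Gt; apply/andP; split; first by apply: ge_inf => //; case: iG.
    by apply: ub_le_sup => //; case: sG.
  apply: (@le_trans _ _ (lam `[inf G, sup G]%classic)).
    by apply: le_measure; rewrite ?inE// => t Gt /=; rewrite in_itv/= Gb.
  rewrite lebesgue_measure_itv/= lte_fin; case: ifPn => // _.
  have [[s Gs] _] := sG; rewrite lee_fin subr_ge0.
  by have /andP[] := Gb s Gs; exact: le_trans.
have h1 : (sup E <= inf F + `|a - b|)%R.
  apply: sup_le_ub => // s Es; rewrite -lerBlDr; apply: lb_le_inf => //.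
  exact: Fl.
have h2 : (sup F <= inf E + `|a - b|)%R.
  apply: sup_le_ub => // s Es; rewrite -lerBlDr; apply: lb_le_inf => //.
  exact: El.
have h3 := width _ _ mE supE infE aE.
have h4 := width _ _ mF supF infF bF.
by have := ler_normB a b; lra.
Qed.

(** Two points of the symmetrization are at most as far apart as the points of [A] that
    [steiner_spread] provides on the same two lines. *)
Lemma steiner_diam A (D : R) : (0 <= D)%R -> measurable A ->
  (forall z w, A z -> A w -> enorm (vsub z w) <= D)%R ->
  (forall z w, steiner A z -> steiner A w -> enorm (vsub z w) <= D)%R.
Proof.
move=> D0 mA AD z w.
have [a [x ->]] := cons_Rn_surj z; have [b [y ->]] := cons_Rn_surj w.
rewrite !steiner_cons => ax bY.
have [s [t [Es Ft st]]] := steiner_spread (measurable_line_section x mA)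
  (measurable_line_section y mA) ax bY.
have := AD _ _ Es Ft; rewrite !vsub_cons !enorm_le// !dot_cons.
apply: le_trans; rewrite lerD2r -!expr2 -(real_normK (num_real (a - b))).
by rewrite -(real_normK (num_real (s - t))) ler_pXn2r// nnegrE.
Qed.

End steiner_symmetrization.

Section reflections.
Context {R : realType} {n : nat}.
Implicit Types (A : set (Rn R n)) (x : Rn R n).

Definition flip (i : 'I_n) x : Rn R n :=
  [tuple (if j == i then - coord x j else coord x j)%R | j < n].

Lemma coord_flip i x j :
  coord (flip i x) j = if j == i then - coord x j else coord x j.
Proof. exact: coord_mktuple. Qed.

Lemma flipK i : involutive (flip i).
Proof.
move=> x; apply: Rn_ext => j; rewrite !coord_flip.
by case: eqP => //; rewrite opprK.
Qed.

Definition flip_inv A i := forall x, A x -> A (flip i x).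

(** The point $-x$ arises from $x$ by flipping the coordinates one after another. *)
Lemma flip_inv_vopp A : (forall i, flip_inv A i) -> forall x, A x -> A (vopp x).
Proof.
move=> Af x Ax; pose y s := foldr flip x s.
have Ay s : A (y s) by elim: s => //= i s IH; exact: Af.
have -> : vopp x = y (enum 'I_n); last exact: Ay.
have yE s : uniq s -> forall j,
    coord (y s) j = if j \in s then - coord x j else coord x j.
  elim: s => //= i s IH /andP[si us] j; rewrite coord_flip IH// in_cons.
  by case: eqP => //= ->; rewrite (negbTE si).
by apply: Rn_ext => j; rewrite yE ?enum_uniq// mem_enum coord_vopp.
Qed.

End reflections.

Section isodiametric.
Context {R : realType} {n : nat}.
Local Open Scope ereal_scope.
Implicit Types (A : set (Rn R n.+1)).

Definition rot_coord (x : Rn R n.+1) : Rn R n.+1 :=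
  [tuple coord x (ordS i) | i < n.+1].

Definition rotr_coord (x : Rn R n.+1) : Rn R n.+1 :=
  [tuple coord x (ord_pred i) | i < n.+1].

Lemma coord_rot x i : coord (rot_coord x) i = coord x (ordS i).
Proof. exact: coord_mktuple. Qed.

Lemma coord_rotr x i : coord (rotr_coord x) i = coord x (ord_pred i).
Proof. exact: coord_mktuple. Qed.

Lemma rotr_coordK : cancel rotr_coord rot_coord.
Proof.
by move=> x; apply: Rn_ext => i; rewrite coord_rot coord_rotr ordSK.
Qed.

Lemma rot_coordB x y : rot_coord (vsub x y) = vsub (rot_coord x) (rot_coord y).
Proof. by apply: Rn_ext => i; rewrite coord_rot !coord_vsub !coord_rot. Qed.

Lemma enorm_rot_coord x : enorm (rot_coord x) = enorm x.
Proof.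
apply: enorm_eq; rewrite /dot [RHS](reindex (@ordS n.+1))/=.
  by apply: eq_bigr => i _; rewrite coord_rot.
by apply: onW_bij; exact: ordS_bij.
Qed.

Lemma measurable_rot_coord : measurable_fun setT rot_coord.
Proof.
apply: measurable_Rn => i; under eq_fun do rewrite coord_rot.
exact: measurable_coord.
Qed.

(** [steiner] treats the first coordinate only; the cyclic relabelling brings each coordinate there
    in turn, so that $n+1$ rounds treat them all. *)
Definition steiner_rot A := rot_coord @^-1` steiner A.

Lemma measurable_steiner_rot A : measurable A -> measurable (steiner_rot A).
Proof.
move=> mA; apply: measurable_preimageT; first exact: measurable_rot_coord.
exact: measurable_steiner.
Qed.

Lemma lebesgue_steiner_rot A : measurable A ->
  lebesgue_Rn R n.+1 (steiner_rot A) = lebesgue_Rn R n.+1 A.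
Proof.
move=> mA; rewrite -(lebesgue_steiner mA).
apply: (lebesgue_Rn_isometry measurable_rot_coord rotr_coordK rot_coordB
  enorm_rot_coord).
exact: measurable_steiner.
Qed.

Lemma steiner_rot_diam A (D : R) : (0 <= D)%R -> measurable A ->
  (forall z w, A z -> A w -> enorm (vsub z w) <= D)%R ->
  (forall z w, steiner_rot A z -> steiner_rot A w -> enorm (vsub z w) <= D)%R.
Proof.
move=> D0 mA AD z w Az Aw.
rewrite -enorm_rot_coord rot_coordB; exact: (steiner_diam D0 mA AD).
Qed.

Lemma flip_inv_steiner0 A : flip_inv (steiner A) ord0.
Proof.
move=> z; have [a [x ->]] := cons_Rn_surj z.
have -> : flip ord0 (cons_Rn (a, x)) = cons_Rn ((- a)%R, x).
  by apply: Rn_extS => [|i]; rewrite coord_flip !coord_consE//= eqxx.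
by rewrite !steiner_cons normrN.
Qed.

(** If [A] is invariant under the flip of another coordinate, its sections over $x$ and over the
    flipped $x$ coincide. Hence later symmetrizations keep the symmetries already gained. *)
Lemma flip_inv_steinerS A i : flip_inv A (lift ord0 i) ->
  flip_inv (steiner A) (lift ord0 i).
Proof.
move=> Ai z; have [a [x ->]] := cons_Rn_surj z.
have fE b y : flip (lift ord0 i) (cons_Rn (b, y)) = cons_Rn (b, flip i y).
  apply: Rn_extS => [|j]; rewrite coord_flip !coord_consE//= coord_flip.
  by rewrite (inj_eq (@lift_inj _ _)).
rewrite fE !steiner_cons; suff -> : line_section A (flip i x) = line_section A x by [].
apply/seteqP; split => b /= Ab.
  by have := Ai _ Ab; rewrite fE flipK.
by rewrite /line_section /= -fE; exact: Ai.
Qed.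

Lemma flip_inv_steiner A i : flip_inv A i -> flip_inv (steiner A) i.
Proof.
have [j ->|->] := unliftP ord0 i; first exact: flip_inv_steinerS.
by move=> _; exact: flip_inv_steiner0.
Qed.

Lemma flip_inv_steiner_rot A i : flip_inv (steiner A) i ->
  flip_inv (steiner_rot A) (ordS i).
Proof.
move=> Ai x Ax; rewrite /steiner_rot /=.
have -> : rot_coord (flip (ordS i) x) = flip i (rot_coord x).
  apply: Rn_ext => j; rewrite coord_rot !coord_flip coord_rot.
  by rewrite (inj_eq (@ordS_inj _)).
exact: Ai.
Qed.

Lemma flip_inv_iter_steiner_rot A m j : (j < m)%N ->
  flip_inv (iter m steiner_rot A) (iter j.+1 (@ordS n.+1) ord0).
Proof.
elim: m j => // m IH [|j] jm /=; apply: flip_inv_steiner_rot.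
  exact: flip_inv_steiner0.
by apply: flip_inv_steiner; exact: IH.
Qed.

Lemma iter_ordS_surj (i : 'I_n.+1) :
  exists2 j, (j < n.+1)%N & i = iter j.+1 (@ordS n.+1) ord0.
Proof.
have it j : iter j (@ordS n.+1) ord0 = (j %% n.+1)%N :> nat.
  by elim: j => [|j IH] /=; rewrite ?mod0n// IH -addn1 modnDml addn1.
have [i0|i0] := posnP i.
  (* At least one shift always takes place, so coordinate 0 is reached by a full turn of $n+1$
     shifts. *)
  by exists n => //; apply: val_inj; rewrite [RHS](it n.+1) modnn.
exists i.-1; first by rewrite prednK// ltnW.
by apply: val_inj; rewrite [RHS](it i.-1.+1) prednK// modn_small.
Qed.

(** The iterated symmetrization has the volume of [A] and is invariant under $x\mapsto-x$, so
    $2|x|=|x-(-x)|\le D$ puts it inside the ball of radius $D/2$. *)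
Lemma isodiametric_pos A (D : R) : (0 < D)%R -> measurable A ->
  (forall z w, A z -> A w -> enorm (vsub z w) <= D)%R ->
  lebesgue_Rn R n.+1 A <= (ball_volume n.+1 * (D / 2) ^+ n.+1)%:E.
Proof.
move=> D0 mA AD; pose B m := iter m steiner_rot A.
have /(_ n.+1)[mB [LB BD]] m : measurable (B m) /\
    (lebesgue_Rn R n.+1 (B m) = lebesgue_Rn R n.+1 A /\
     forall z w, B m z -> B m w -> (enorm (vsub z w) <= D)%R).
  elim: m => [//|m [mB [LB BD]]]; split; [|split].
  - exact: measurable_steiner_rot.
  - by rewrite [LHS]lebesgue_steiner_rot.
  - exact: steiner_rot_diam (ltW D0) mB BD.
pose o : Rn R n.+1 := [tuple 0%R | i < n.+1].
rewrite -LB -(lebesgue_Rn_cball o) ?divr_gt0//.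
apply: le_measure; rewrite ?inE//; first exact: measurable_cball.
move=> x Bx; have Bf i : flip_inv (B n.+1) i.
  by have [j jn ->] := iter_ordS_surj i; exact: flip_inv_iter_steiner_rot.
have := BD _ _ Bx (flip_inv_vopp Bf Bx).
have -> : vsub x (vopp x) = vscale 2 (vsub x o).
  by apply: Rn_ext => i; rewrite !coordE coord_mktuple; ring.
rewrite enorm_vscale ger0_norm// /cball /=; lra.
Qed.

End isodiametric.

Theorem isodiametric (R : realType) n (A : set (Rn R n)) (D : R) : (0 <= D)%R ->
  measurable A -> (forall z w, A z -> A w -> enorm (vsub z w) <= D)%R ->
  (lebesgue_Rn R n A <= (ball_volume n * (D / 2) ^+ n)%:E)%E.
Proof.
move=> D0; case: n A => [|n] A mA AD.
  rewrite expr0 mulr1 -ball_volumeE.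
  apply: le_measure; rewrite ?inE//; first exact: measurable_unit_ball.
  by move=> x _; rewrite /unit_ball /enorm /= big_ord0 sqrtr0.
have [D0'|] := ltP 0 D; first exact: isodiametric_pos.
move=> D0'; have {D0 D0'} DE : D = 0 by apply/eqP; rewrite eq_le D0'.
rewrite {}DE in AD *.
rewrite mul0r expr0n/= mulr0; apply/lee_addgt0Pr => e e0; rewrite add0e.
have v0 := @ball_volume_gt0 R n.+1.
have ev0 : 0 < e / @ball_volume R n.+1 by rewrite divr_gt0.
(* Diameter 0 is approached by positive diameters. As $D'\le1$, one has $(D'/2)^{n+1}\le D'/2$, so
   the bound for [D'] is at most [e]. *)
pose D' : R := Num.min 1 (e / @ball_volume R n.+1).
have D'0 : 0 < D' by rewrite lt_min ltr01.
have D'1 : D' <= 1 by rewrite ge_min lexx.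
have D'e : D' <= e / @ball_volume R n.+1 by rewrite ge_min lexx orbT.
apply: le_trans (isodiametric_pos D'0 mA _) _.
  by move=> z w Az Aw; apply: le_trans (AD _ _ Az Aw) _; exact: ltW.
rewrite lee_fin -ler_pdivlMl// [leRHS]mulrC; apply: le_trans D'e.
rewrite exprS; apply: (@le_trans _ _ (D' / 2)); last by lra.
rewrite ler_piMr ?divr_ge0 ?(ltW D'0)// exprn_ile1//; first lra.
lra.
Qed.

(** * Polar coordinates *)

Section power_tail.
Context {R : realType}.
Notation lam := (@lebesgue_measure R).

Lemma cvg_powRN (q : R) : 0 < q -> (r : R) `^ (- q) @[r --> +oo] --> 0.
Proof.
move=> q0; under eq_fun do rewrite powRN.
apply/gtr0_cvgV0.
  by near=> r; apply: powR_gt0; near: r; exact: nbhs_pinfty_gt.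
apply/cvgryPge => A; near=> r.
have Mr : (Num.max A 1) `^ q^-1 <= r.
  by near: r; apply: nbhs_pinfty_ge; exact: num_real.
apply: (@le_trans _ _ (Num.max A 1)); first by rewrite le_max lexx.
have M0 : 0 <= Num.max A 1 by rewrite le_max ler01 orbT.
rewrite [leLHS](_ : _ = (Num.max A 1 `^ q^-1) `^ q); last first.
  by rewrite -powRrM mulVf ?powRr1// gt_eqF.
have r0 : 0 <= r by apply: le_trans Mr; exact: powR_ge0.
apply: (ge0_ler_powR (ltW q0)) Mr; rewrite nnegrE// powR_ge0.
Unshelve. all: by end_near. Qed.

Lemma integral_power_tail (a q : R) : 0 < a -> 0 < q ->
  (\int[lam]_(r in `]a, +oo[) ((r `^ (q + 1))^-1)%:E = (a `^ (- q) / q)%:E)%E.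
Proof.
move=> a0 q0; have q_neq0 : q != 0 by rewrite gt_eqF.
have dpow (c x : R) : a <= x -> derivable (@powR R ^~ c) x 1.
  by move=> ax; apply: derivable_powR; rewrite in_itv/= andbT (lt_le_trans a0).
pose F (x : R) := - q^-1 * x `^ (- q).
rewrite integral_itv_obnd_cbnd; last first.
  apply/measurable_EFinP; apply: measurable_funTS.
  under eq_fun do rewrite -powRN; exact: measurable_powR.
under eq_integral do rewrite -powRN.
rewrite (@ge0_continuous_FTC2y _ (fun x => x `^ (- (q + 1))) F a 0).
- by rewrite /F -EFinB sub0r mulNr opprK mulrC.
- by move=> x _; exact: powR_ge0.
- apply: continuous_in_subspaceT => x; rewrite inE/= in_itv/= andbT => ax.
  apply/differentiable_continuous/derivable1_diffP.
  exact: dpow.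
- rewrite -(mulr0 (- q^-1)); apply: cvgMr; exact: cvg_powRN.
- move=> x ax; apply: derivableM; [exact: derivable_cst|exact/dpow/ltW].
- apply: cvg_at_right_filter; apply: cvgMr.
  have /derivable1_diffP/differentiable_continuous := dpow (- q) a (lexx _).
  exact.
- move=> x; rewrite in_itv/= andbT => ax.
  have x0 : 0 < x by exact: lt_trans ax.
  rewrite derive1E deriveZ/=; last exact/dpow/ltW.
  rewrite -derive1E powR_derive1 ?in_itv/= ?x0//.
  rewrite -[LHS]/(- q^-1 * (- q * x `^ (- q - 1))).
  by rewrite mulrA mulrNN mulVf// mul1r opprD.
Qed.

End power_tail.

Section indicator_integrals.
Context d (T : measurableType d) {R : realType}.
Variable mu : {measure set T -> \bar R}.
Local Open Scope ereal_scope.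

Lemma integral_indicM (D : set T) (f : T -> \bar R) :
  \int[mu]_(x in D) f x = \int[mu]_x ((\1_D x)%:E * f x).
Proof.
rewrite integral_mkcond; apply: eq_integral => x _.
by rewrite patchE indicE; case: ifPn; rewrite ?mul1e ?mul0e.
Qed.

Lemma ge0_integral_mrestr (D : set T) (mD : measurable D) (f : T -> \bar R) :
  measurable_fun setT f -> (forall x, 0 <= f x) ->
  \int[mrestr mu mD]_x f x = \int[mu]_(x in D) f x.
Proof.
move=> mf f0; rewrite [LHS](ge0_negligible_integral (measurableC mD))//; last first.
  by rewrite /= /mrestr setICl measure0.
rewrite setTD setCK; apply: eq_measure_integral => A mA AD /=.
by rewrite /= /mrestr setIidl.
Qed.

End indicator_integrals.

Section polar_coordinates.
Context {R : realType} {n : nat}.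
Local Open Scope ereal_scope.
Notation lam := (@lebesgue_measure R).
Notation L := (lebesgue_Rn R n).
Implicit Types (h y w : Rn R n) (r : R).

Definition normalize h : Rn R n := vscale (enorm h)^-1 h.

Definition punctured_ball : set (Rn R n) :=
  [set h | (0 < enorm h)%R] `&` unit_ball.

Lemma measurable_normalize : measurable_fun setT normalize.
Proof.
apply: measurable_vscale => //.
rewrite (_ : (fun h => _) = fun h => (enorm h `^ (- 1))%R); last first.
  by apply/funext => h; rewrite powR_inv1// enorm_ge0.
exact: (measurableT_comp (@measurable_powR R (-1)%R) measurable_enorm).
Qed.

Lemma measurable_punctured_ball : measurable punctured_ball.
Proof.
apply: measurableI; last exact: measurable_unit_ball.
by apply: measurable_set_lt => //; exact: measurable_enorm.
Qed.

Lemma enorm_normalize h : (0 < enorm h)%R -> enorm (normalize h) = 1%R.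
Proof.
move=> h0; rewrite enorm_vscale ger0_norm ?invr_ge0 ?enorm_ge0//.
by rewrite mulVf// gt_eqF.
Qed.

Lemma vscale_normalize h : (0 < enorm h)%R ->
  vscale (enorm h) (normalize h) = h.
Proof. by move=> h0; rewrite vscaleA mulfV ?gt_eqF// vscale1. Qed.

(* The cone measure: [n] times the volume of the cone from 0 over a set. *)
Definition sphere_measure : set (Rn R n) -> \bar R :=
  pushforward (mscale (NngNum (ler0n R n))
    (mrestr L measurable_punctured_ball)) normalize.

Let sphere_measure_pushforward : {measure set (Rn R n) -> \bar R} :=
  measure_function_pushforward__canonical__measure_function_Measure
    (mscale (NngNum (ler0n R n)) (mrestr L measurable_punctured_ball))
    measurable_normalize.

HB.instance Definition _ := isMeasure.Build _ _ _ sphere_measure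
  (measure0 sphere_measure_pushforward) (measure_ge0 sphere_measure_pushforward)
  (@measure_semi_sigma_additive _ _ _ sphere_measure_pushforward).

Lemma sphere_measureE (A : set (Rn R n)) :
  sphere_measure A =
  (n%:R)%:E * L ([set h | A (normalize h)] `&` punctured_ball).
Proof. by []. Qed.

Lemma integral_sphere_measure (g : Rn R n -> \bar R) :
  measurable_fun setT g -> (forall w, 0 <= g w) ->
  \int[sphere_measure]_w g w =
  (n%:R)%:E * \int[L]_h ((\1_punctured_ball h)%:E * g (normalize h)).
Proof.
move=> mg g0; have mgn : measurable_fun setT (g \o normalize).
  exact: measurableT_comp mg measurable_normalize.
rewrite -integral_indicM.
rewrite [LHS](ge0_integral_pushforward measurable_normalize)//.
rewrite preimage_setT ge0_integral_mscale//=; congr (_ * _).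
by rewrite ge0_integral_mrestr.
Qed.

(** A set of diameter 0 is null by the isodiametric inequality, because $0^n=0$ for $n>0$. *)
Lemma lebesgue_Rn_origin : (0 < n)%N -> L [set h | enorm h = 0%R] = 0.
Proof.
move=> n0; have m0 : measurable [set h : Rn R n | enorm h = 0%R].
  rewrite (_ : [set h | _] = [set h | (enorm h <= 0)%R]).
    by apply: measurable_set_le => //; exact: measurable_enorm.
  apply/seteqP; split => h /=; first by move->.
  by move=> h0; apply/eqP; rewrite eq_le h0 enorm_ge0.
apply/eqP; rewrite eq_le measure_ge0 andbT.
have := @isodiametric R _ _ 0 (lexx _) m0.
rewrite mul0r expr0n gtn_eqF// mulr0; apply => z w z0 w0.
by apply: le_trans (ler_enormB _ _) _; rewrite z0 w0 addr0.
Qed.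

Section polar_formula.
Hypothesis n_gt0 : (0 < n)%N.
Variable f : Rn R n -> \bar R.
Hypotheses (mf : measurable_fun setT f) (f0 : forall x, 0 <= f x).

Let I (r : measurableTypeR R) : R := \1_(`]0%R, +oo[%classic) r.

Let mI : measurable_fun setT I.
Proof. exact: measurable_indic. Qed.

Let mabs m : measurable_fun setT (fun r : measurableTypeR R => (`|r| ^+ m)%R).
Proof. apply: measurable_funX; exact: normr_measurable. Qed.

Let I_scale c r : (0 < c)%R -> I (c * r)%R = I r.
Proof.
by move=> c0; rewrite /I !indicE !mem_setE !in_itv/= !andbT pmulr_rgt0.
Qed.

Let mnorm_snd (m : nat) :
  measurable_fun setT (fun z : Rn R n * measurableTypeR R => (`|z.2| ^+ m)%R).
Proof.
by apply: measurable_funX; apply: measurableT_comp.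
Qed.

Let menorm_fst (m : nat) :
  measurable_fun setT (fun z : Rn R n * measurableTypeR R => (enorm z.1 ^+ m)%R).
Proof.
apply: measurable_funX.
exact: (measurableT_comp measurable_enorm measurable_fst).
Qed.

Let mf_scale : measurable_fun setT
  (fun z : Rn R n * measurableTypeR R => f (vscale z.2 z.1)).
Proof.
apply: (measurableT_comp mf); apply: measurable_vscale.
  exact: measurable_snd.
exact: measurable_fst.
Qed.

Let phi w (r : measurableTypeR R) : \bar R :=
  (I r * `|r| ^+ n.-1)%:E * f (vscale r w).

Let phi0 w r : 0 <= phi w r.
Proof. by rewrite mule_ge0// lee_fin mulr_ge0// exprn_ge0. Qed.

Let mphi : measurable_fun setT (fun z : Rn R n * measurableTypeR R => phi z.1 z.2).
Proof.
apply: emeasurable_funM => //; apply/measurable_EFinP; apply: measurable_funM => //.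
exact: (measurableT_comp mI measurable_snd).
Qed.

Let J w := \int[lam]_r phi w r.

Let mJ : measurable_fun setT J.
Proof. exact: (measurable_fun_fubini_tonelli_F _ mphi (fun z => phi0 _ _)). Qed.

Let J0 w : 0 <= J w.
Proof. exact: integral_ge0. Qed.

Let mphir w : measurable_fun setT (phi w).
Proof. exact: (measurableT_comp mphi (measurable_pair1 w)). Qed.

(** [J] is homogeneous of degree $-n$: substitute $r\mapsto|h|r$. *)
Let J_normalize h : (0 < enorm h)%R ->
  J (normalize h) = (enorm h ^+ n)%:E * J h.
Proof.
move=> h0; set c := enorm h; have c0 : c != 0%R by rewrite gt_eqF.
have := integral_affine 0 c0 (mphir (normalize h)) (phi0 (normalize h)).
rewrite (_ : \int[lam]_a phi (normalize h) (c * a - 0)%R =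
    (c ^+ n.-1)%:E * J h); last first.
  rewrite -(ge0_integralZl_EFin lam measurableT (fun r _ => phi0 h r) (mphir h));
    last by rewrite exprn_ge0// enorm_ge0.
  apply: eq_integral => r _; rewrite /phi subr0 I_scale// normrM gtr0_norm//.
  rewrite muleA -EFinM; congr (_%:E * f _); first by rewrite exprMn mulrCA.
  by rewrite [X in vscale X _]mulrC -vscaleA vscale_normalize.
rewrite gtr0_norm// => /(congr1 (fun t => c%:E * t)).
by rewrite !muleA -!EFinM mulfV// mul1e -exprS prednK// => ->.
Qed.

Let K h (r : measurableTypeR R) : \bar R :=
  (\1_punctured_ball h * enorm h ^+ n * (I r * `|r| ^+ n.-1))%:E *
  f (vscale r h).

(** This is [K] after the substitution $y=rh$ at fixed $r>0$, Jacobian $r^{-n}$ included; the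
    condition $|h|\le1$ has become $|y|\le r$. *)
Let K2 y (r : measurableTypeR R) : \bar R :=
  (\1_[set y : Rn R n | (0 < enorm y)%R] y * enorm y ^+ n *
   (\1_[set z : Rn R n * measurableTypeR R | (enorm z.1 <= z.2)%R] (y, r) *
   `|r| ^- n.+1))%:E * f y.

Let K0 h r : 0 <= K h r.
Proof. by rewrite mule_ge0// lee_fin !mulr_ge0// exprn_ge0// enorm_ge0. Qed.

Let K20 h r : 0 <= K2 h r.
Proof.
by rewrite mule_ge0// lee_fin !mulr_ge0// ?invr_ge0 exprn_ge0// enorm_ge0.
Qed.

Let mK : measurable_fun setT (fun z : Rn R n * measurableTypeR R => K z.1 z.2).
Proof.
apply: emeasurable_funM => //; apply/measurable_EFinP; apply: measurable_funM.
  apply: measurable_funM => //.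
  apply: (measurableT_comp _ measurable_fst).
  by apply: measurable_indic; exact: measurable_punctured_ball.
apply: measurable_funM => //.
exact: (measurableT_comp mI measurable_snd).
Qed.

Let mK2 : measurable_fun setT (fun z : Rn R n * measurableTypeR R => K2 z.1 z.2).
Proof.
apply: emeasurable_funM; last exact: (measurableT_comp mf measurable_fst).
apply/measurable_EFinP; apply: measurable_funM.
  apply: measurable_funM => //.
  apply: (measurableT_comp _ measurable_fst).
  by apply: measurable_indic; apply: measurable_set_lt => //;
    exact: measurable_enorm.
apply: measurable_funM.
  rewrite (_ : (fun _ => _) = \1_[set z : Rn R n * measurableTypeR R | (enorm z.1 <= z.2)%R]).
    apply: measurable_indic; apply: measurable_set_le.
      exact: (measurableT_comp measurable_enorm measurable_fst).
    exact: measurable_snd.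
  by apply/funext => -[].
rewrite (_ : (fun _ => _) = fun z : Rn R n * measurableTypeR R =>
    ((`|z.2| ^+ n.+1) `^ (- 1))%R); last first.
  by apply/funext => z; rewrite powR_inv1// exprn_ge0.
exact: (measurableT_comp (@measurable_powR R (-1)%R) (mnorm_snd n.+1)).
Qed.

Let integral_K_K2 r : \int[L]_h K h r = \int[L]_y K2 y r.
Proof.
have [r0|r0] := ltP 0%R r; last first.
  rewrite integral0_eq => [|h _]; last first.
    have -> : K h r = 0; last by [].
    rewrite /K [I r](_ : _ = 0%R) ?mul0r ?mulr0 ?mul0e//.
    rewrite /I indicE memNset//= in_itv/= andbT; apply/negP.
    by rewrite -leNgt.
  rewrite integral0_eq// => y _; rewrite /K2 !indicE.
  have [y0|y0] := ltP 0%R (enorm y); last first.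
    by rewrite memNset ?mul0r ?mul0e//=; apply/negP; rewrite -leNgt.
  rewrite [X in (_ * (X * _))%R](_ : _ = 0%R) ?mul0r ?mulr0 ?mul0e//.
  rewrite memNset//=; apply/negP; rewrite -ltNge.
  exact: le_lt_trans r0 _.
have rn0 : (r != 0)%R by rewrite gt_eqF.
have mK2r : measurable_fun setT (fun y => K2 y r).
  exact: (measurableT_comp mK2 (measurable_pair2 r)).
have rn1 : (0 <= r ^+ n)%R by rewrite exprn_ge0// ltW.
have := integral_Rn_scale rn0 mK2r (fun y => K20 y r).
move=> /(congr1 (fun t => (r ^+ n)%:E * t)).
rewrite gtr0_norm// muleA -EFinM mulfV ?expf_neq0// mul1e => <-.
have mK2rs : measurable_fun setT (fun y => K2 (vscale r y) r).
  exact: (measurableT_comp mK2r (measurable_vscalel r)).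
rewrite -(ge0_integralZl_EFin L measurableT (fun y _ => K20 (vscale r y) r) mK2rs)//.
apply: eq_integral => h _; rewrite /K /K2 muleA -EFinM; congr (_%:E * _).
have I1 : I r = 1%R by rewrite /I indicE mem_set//= in_itv/= r0.
rewrite enorm_vscale gtr0_norm// I1 !indicE.
have -> : (vscale r h \in [set y : Rn R n | (0 < enorm y)%R]) =
          (h \in [set y : Rn R n | (0 < enorm y)%R]).
  by apply/idP/idP; rewrite !inE /= enorm_vscale gtr0_norm// pmulr_rgt0.
have -> : ((vscale r h, r) \in
    [set z : Rn R n * measurableTypeR R | (enorm z.1 <= z.2)%R]) =
    (h \in @unit_ball R n).
  have e : (r * enorm h <= r)%R = (enorm h <= 1)%R.
    by rewrite -{2}(mulr1 r) ler_pM2l.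
  by apply/idP/idP; rewrite !inE /unit_ball /= enorm_vscale gtr0_norm// e.
have -> : (h \in punctured_ball) =
    (h \in [set y : Rn R n | (0 < enorm y)%R]) && (h \in @unit_ball R n).
  by rewrite /punctured_ball in_setI.
have -> : (r ^+ n.+1 = r * (r * r ^+ n.-1))%R by rewrite -exprS prednK// exprS.
have -> : (r ^+ n = r * r ^+ n.-1)%R by rewrite -exprS prednK.
rewrite exprMn; have -> : (r ^+ n = r * r ^+ n.-1)%R by rewrite -exprS prednK.
have rp : (r ^+ n.-1 != 0)%R by rewrite expf_neq0.
case: (_ \in _); case: (_ \in _) => /=; rewrite ?(mul0r,mulr0,mul1r)//.
by field; rewrite rp rn0.
Qed.

Let integral_K2 y : \int[lam]_r K2 y r =
  (n%:R^-1)%:E * ((\1_[set y : Rn R n | (0 < enorm y)%R] y)%:E * f y).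
Proof.
rewrite /K2 indicE; have [y0|y0] := ltP 0%R (enorm y); last first.
  rewrite memNset/=; last by apply/negP; rewrite -leNgt.
  by rewrite mul0e mule0 integral0_eq// => r _; rewrite !mul0r mul0e.
rewrite mem_set//= !mul1r mul1e; set c := enorm y.
have nn : (n%:R != 0 :> R)%R by rewrite pnatr_eq0 gtn_eqF.
have m1 : measurable_fun setT (fun r : measurableTypeR R =>
   ((\1_(`[c, +oo[%classic) r * `|r| ^- n.+1) : R)%:E).
  apply/measurable_EFinP; apply: measurable_funM; first exact: measurable_indic.
  under eq_fun do rewrite -powR_inv1 ?exprn_ge0//.
  apply: (measurableT_comp (@measurable_powR R (-1)%R)).
  exact: mabs.
have c_ge0 : (0 <= c ^+ n)%R by rewrite exprn_ge0// ltW.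
have tail : \int[lam]_r ((\1_(`[c, +oo[%classic) r * `|r| ^- n.+1) : R)%:E =
    (c ^- n / n%:R)%:E.
  under eq_integral do rewrite EFinM.
  rewrite -integral_indicM -integral_itv_obnd_cbnd; last first.
    apply: measurable_funTS; apply/measurable_EFinP.
    under eq_fun do rewrite -powR_inv1 ?exprn_ge0//.
    apply: (measurableT_comp (@measurable_powR R (-1)%R)).
    exact: mabs.
  have := @integral_power_tail R c n%:R y0; rewrite ltr0n => /(_ n_gt0).
  rewrite powR_invn ?(ltW y0)// => <-; apply: eq_integral => r.
  rewrite inE/= in_itv/= andbT => cr; have r0 : (0 < r)%R by exact: lt_trans cr.
  by rewrite natr1 powR_mulrn ?(ltW r0)// gtr0_norm.
transitivity (\int[lam]_r (((c ^+ n)%:E * f y) *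
    ((\1_(`[c, +oo[%classic) r * `|r| ^- n.+1) : R)%:E)).
  apply: eq_integral => r _; rewrite EFinM -!muleA; congr (_ * _).
  rewrite muleC; congr (_ * (_ * _)%:E); rewrite !indicE.
  by congr ((nat_of_bool _)%:R); apply/idP/idP; rewrite !inE /= in_itv/= andbT.
rewrite (ge0_integralZl lam measurableT m1); last 2 first.
- by move=> r _; rewrite lee_fin mulr_ge0// invr_ge0 exprn_ge0.
- by rewrite mule_ge0.
rewrite tail muleAC -EFinM; congr (_%:E * _).
by field; rewrite nn expf_neq0// gt_eqF.
Qed.

Let integral_radial w : \int[lam]_(r in `]0%R, +oo[)
    ((r ^+ n.-1)%:E * f (vscale r w)) = J w.
Proof.
rewrite integral_indicM; apply: eq_integral => r _.
rewrite /phi /I muleA EFinM; congr (_ * _).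
rewrite indicE; have [|_] := boolP (r \in _); last by rewrite !mul0e.
by rewrite inE/= in_itv/= andbT => r0; rewrite gtr0_norm.
Qed.

Lemma measurable_integral_radial : measurable_fun setT
  (fun w => \int[lam]_(r in `]0%R, +oo[) ((r ^+ n.-1)%:E * f (vscale r w))).
Proof. by under eq_fun do rewrite integral_radial. Qed.

(** Only dilations and Fubini enter. By construction of the cone measure the right side is $n$ times
    the integral of $|h|^nJ(h)$ over the punctured ball, a double integral in $(h,r)$. Exchanging
    the order, putting $y=rh$ and exchanging again leaves the factor $|y|^n\int_{|y|}^\infty
    r^{-n-1}\,dr=1/n$ in front of $f(y)$. *)
Theorem integral_polar : \int[L]_h f h =
  \int[sphere_measure]_w \int[lam]_(r in `]0%R, +oo[)
    ((r ^+ n.-1)%:E * f (vscale r w)).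
Proof.
have mpos : measurable [set y : Rn R n | (0 < enorm y)%R].
  by apply: measurable_set_lt => //; exact: measurable_enorm.
have nn : (n%:R != 0 :> R)%R by rewrite pnatr_eq0 gtn_eqF.
transitivity (\int[sphere_measure]_w J w); last first.
  by apply: eq_integral => w _; rewrite integral_radial.
rewrite (integral_sphere_measure mJ J0).
have -> : \int[L]_h ((\1_punctured_ball h)%:E * J (normalize h)) =
    \int[L]_h \int[lam]_r K h r.
  apply: eq_integral => h _; rewrite /K.
  under [RHS]eq_integral do rewrite EFinM -muleA -/(phi h _).
  rewrite (ge0_integralZl_EFin lam measurableT (fun r _ => phi0 h r) (mphir h));
    last by rewrite mulr_ge0// exprn_ge0// enorm_ge0.
  rewrite -/(J h) indicE; have [|_] := boolP (h \in _); last first.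
    by rewrite !mul0r !mul0e.
  by rewrite inE => -[/= h0 _]; rewrite J_normalize// mul1e mul1r.
have mposf : measurable_fun setT
    (fun y => (\1_[set y : Rn R n | (0 < enorm y)%R] y)%:E * f y).
  by apply: emeasurable_funM => //; exact: measurable_EFin_indic.
have posf0 y : 0 <= (\1_[set y : Rn R n | (0 < enorm y)%R] y)%:E * f y.
  exact: mule_ge0.
have -> : \int[L]_h \int[lam]_r K h r = (n%:R^-1)%:E *
    \int[L]_y ((\1_[set y : Rn R n | (0 < enorm y)%R] y)%:E * f y).
  rewrite [LHS](fubini_tonelli _ mK (fun z => K0 _ _)).
  transitivity (\int[lam]_r \int[L]_y K2 y r).
    by apply: eq_integral => r _; exact: integral_K_K2.
  rewrite -[LHS](fubini_tonelli _ mK2 (fun z => K20 _ _)).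
  rewrite -(ge0_integralZl_EFin L measurableT (fun y _ => posf0 y) mposf)//.
  by apply: eq_integral => y _; exact: integral_K2.
rewrite muleA -EFinM mulfV// mul1e -integral_indicM.
rewrite (ge0_negligible_integral _ measurableT mf _ (lebesgue_Rn_origin n_gt0))//.
  congr (integral _ _ _); apply/seteqP; split => h /=.
    by move=> [_ /eqP h0]; rewrite lt0r h0 enorm_ge0.
  by move=> h0; split => //; apply/eqP; rewrite gt_eqF.
rewrite (_ : [set h | _] = [set h | (enorm h <= 0)%R]).
  by apply: measurable_set_le => //; exact: measurable_enorm.
apply/seteqP; split => h /=; first by move->.
by move=> h0; apply/eqP; rewrite eq_le h0 enorm_ge0.
Qed.

End polar_formula.

End polar_coordinates.

(** * The cone measure of small subsets of the sphere *)

Section sphere_estimates.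
Context {R : realType}.
Local Open Scope ereal_scope.
Notation lam := (@lebesgue_measure R).

Lemma integral_itv_exprn (k : nat) (t : R) : (0 < t)%R ->
  \int[lam]_(a in `]0%R, t]) (a ^+ k)%:E = (t ^+ k.+1 / k.+1%:R)%:E.
Proof.
move=> t0; pose F (a : R) : R := (a ^+ k.+1 / k.+1%:R)%R.
have dX (a : R) : derivable (fun x : R => x ^+ k.+1)%R a 1%R.
  exact: exprn_derivable.
have dF (a : R) : derivable F a 1%R.
  by apply: derivableM; [exact: dX|exact: derivable_cst].
have F'E (a : R) : F^`()%classic a = (a ^+ k)%R.
  rewrite /F derive1Mr// exp_derive1 /=.
  rewrite -[X in (X / _)%R]/(k.+1%:R * a ^+ k)%R mulrAC mulfV ?mul1r//.
have cF (a : R) : F x @[x --> a] --> F a.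
  by have /derivable1_diffP/differentiable_continuous := dF a; exact.
rewrite integral_itv_obnd_cbnd; last first.
  by apply/measurable_EFinP; exact: measurable_funX.
rewrite (@continuous_FTC2 _ _ F)//.
- by rewrite /F expr0n/= mul0r sube0.
- by apply: continuous_subspaceT => a; exact: exprn_continuous.
- split; first by move=> a _; exact: dF.
  + by apply: cvg_at_right_filter; exact: cF.
  + by apply: cvg_at_left_filter; exact: cF.
Qed.

Lemma measurable_cons_Rnr k (a : R) :
  measurable_fun setT (fun y : Rn R k => cons_Rn (a, y)).
Proof.
exact: (measurableT_comp (@measurable_cons_Rn R k)
  (measurable_pair1 (a : measurableTypeR R))).
Qed.

Lemma lebesgue_RnS_slices k (A : set (Rn R k.+1)) : measurable A ->
  lebesgue_Rn R k.+1 A =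
  \int[lam]_a lebesgue_Rn R k [set y | A (cons_Rn (a, y))].
Proof.
move=> mA; rewrite -(integral_indicT (lebesgue_Rn R k.+1) mA).
rewrite (integral_RnS (measurable_EFin_indic mA) (@indic_ge0 _ _ R A)).
apply: eq_integral => a _; rewrite -[RHS]integral_indicT//.
exact: (measurable_preimageT (measurable_cons_Rnr a) mA).
Qed.

Lemma measurable_slice k (A : set (Rn R k.+1)) a : measurable A ->
  measurable [set y | A (cons_Rn (a, y))].
Proof.
exact: (measurable_preimageT (measurable_cons_Rnr a)).
Qed.

Lemma measurable_lebesgue_slice k (A : set (Rn R k.+1)) : measurable A ->
  measurable_fun setT
    (fun a => lebesgue_Rn R k [set y | A (cons_Rn (a, y))]).
Proof.
move=> mA; have mB : measurable (@cons_Rn R k @^-1` A).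
  by apply: measurable_preimageT mA; exact: measurable_cons_Rn.
have := measurable_fun_xsection (lebesgue_Rn R k) mB.
rewrite (_ : lebesgue_Rn R k \o xsection _ =
  fun a => lebesgue_Rn R k [set y | A (cons_Rn (a, y))])//.
apply/funext => a /=; congr (lebesgue_Rn R k _).
by apply/seteqP; split => y; rewrite /xsection /= inE.
Qed.

Lemma lebesgue_Rn_scale n (c : R) (A : set (Rn R n)) : (c != 0)%R ->
  measurable A ->
  lebesgue_Rn R n [set x | A (vscale c x)] = (`|c| ^- n)%:E * lebesgue_Rn R n A.
Proof.
move=> c0 mA.
have := integral_Rn_scale c0 (measurable_EFin_indic mA) (@indic_ge0 _ _ R A).
rewrite (integral_indicT (lebesgue_Rn R n) mA) => <-.
rewrite -integral_indicT//.
exact: (measurable_preimageT (measurable_vscalel c) mA).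
Qed.

End sphere_estimates.

(** * Cones over spherical sets and the gnomonic projection *)

Section gnomonic.
Context {R : realType} {k : nat}.
Local Open Scope ereal_scope.
Notation lam := (@lebesgue_measure R).
Notation Lk := (lebesgue_Rn R k).

(** The inverse of the gnomonic projection: it maps the tangent hyperplane at the first basis
    vector, identified with $\mathbb{R}^k$, onto the open hemisphere. *)
Definition gnomonic (z : Rn R k) : Rn R k.+1 := normalize (cons_Rn (1%R, z)).

Lemma measurable_gnomonic : measurable_fun setT gnomonic.
Proof.
apply: (measurableT_comp measurable_normalize).
exact: measurable_cons_Rnr.
Qed.

Lemma enorm_cons_gt0 a (y : Rn R k) : (0 < a)%R -> (0 < enorm (cons_Rn (a, y)))%R.
Proof.
move=> a0; rewrite enormE sqrtr_gt0 dot_cons ltr_pwDl ?dot_ge0//.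
by rewrite mulr_gt0.
Qed.

Lemma normalize_scale n (c : R) (x : Rn R n) : (0 < c)%R ->
  normalize (vscale c x) = normalize x.
Proof.
move=> c0; rewrite /normalize vscaleA enorm_vscale gtr0_norm// invfM.
by rewrite mulrAC mulVf ?mul1r// gt_eqF.
Qed.

Lemma normalize_cons a (y : Rn R k) : (0 < a)%R ->
  normalize (cons_Rn (a, y)) = gnomonic (vscale a^-1 y).
Proof.
move=> a0; rewrite /gnomonic.
have -> : cons_Rn (a, y) = vscale a (cons_Rn (1%R, vscale a^-1 y)).
  by rewrite vscale_cons mulr1 vscaleA mulfV ?gt_eqF// vscale1.
exact: normalize_scale.
Qed.

Lemma lebesgue_slice_scale (a : R) (G : set (Rn R k)) : (0 < a)%R ->
  measurable G -> Lk [set y | G (vscale a^-1 y)] = (a ^+ k)%:E * Lk G.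
Proof.
move=> a0 mG; rewrite lebesgue_Rn_scale ?invr_neq0 ?gt_eqF//.
by rewrite gtr0_norm ?invr_gt0// exprVn invrK.
Qed.

Lemma integral_slices (t : R) (G : set (Rn R k)) : (0 < t)%R ->
  \int[lam]_(a in `]0%R, t]) ((a ^+ k)%:E * Lk G) =
  (t ^+ k.+1 / k.+1%:R)%:E * Lk G.
Proof.
move=> t0; rewrite -(integral_itv_exprn k t0).
rewrite -ge0_integralZr//.
- by apply/measurable_EFinP; exact: measurable_funX.
- by move=> a /=; rewrite in_itv/= => /andP[a0 _]; rewrite lee_fin exprn_ge0// ltW.
Qed.

Let cone (A : set (Rn R k.+1)) := [set h | A (normalize h)] `&` punctured_ball.

Let measurable_cone A : measurable A -> measurable (cone A).
Proof.
move=> mA; apply: measurableI; last exact: measurable_punctured_ball.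
exact: (measurable_preimageT measurable_normalize mA).
Qed.

(** The cone over [A] inside the unit ball has heights in $]0,1]$, and its slice at height $a$ lies
    in $a$ times the projected set. Integrating $a^k$ gives $1/(k+1)$, which cancels the factor in
    the cone measure. *)
Lemma sphere_measure_le_gnomonic (A : set (Rn R k.+1)) : measurable A ->
  (forall w, A w -> (0 < coord w ord0)%R) ->
  sphere_measure A <= Lk (gnomonic @^-1` A).
Proof.
move=> mA A0; have mC := measurable_cone mA.
have mG := measurable_preimageT measurable_gnomonic mA.
rewrite sphere_measureE -/(cone A) (lebesgue_RnS_slices mC).
have ms := measurable_lebesgue_slice mC.
have msc a := measurable_slice a mC.
have -> : \int[lam]_a Lk [set y | cone A (cons_Rn (a, y))] =
    \int[lam]_(a in `]0%R, 1%R]) Lk [set y | cone A (cons_Rn (a, y))].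
  rewrite [RHS]integral_mkcond; apply: eq_integral => a _.
  rewrite patchE; case: ifPn => //; rewrite notin_setE/= in_itv/= => aN.
  rewrite (_ : [set y | _] = set0) ?measure0//.
  apply/seteqP; split => // y [/= yA [/= y0 y1]]; apply: aN; apply/andP; split.
    have := A0 _ yA; rewrite /normalize coord_vscale coord_cons0.
    by rewrite pmulr_rgt0// invr_gt0.
  apply: le_trans y1; apply: le_trans (ler_coord_enorm _ ord0).
  by rewrite coord_cons0 ler_norm.
apply: (@le_trans _ _ ((k.+1%:R)%:E *
    \int[lam]_(a in `]0%R, 1%R]) ((a ^+ k)%:E * Lk (gnomonic @^-1` A)))).
  apply: lee_pmul => //; first exact: integral_ge0.
  apply: ge0_le_integral => //.
  - exact: measurable_funTS.
  - apply: emeasurable_funM => //.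
    by apply/measurable_EFinP; exact: measurable_funX.
  - move=> a /=; rewrite in_itv/= => /andP[a0 a1].
    rewrite -(lebesgue_slice_scale a0 mG).
    apply: le_measure; rewrite ?inE//.
      exact: (measurable_preimageT (measurable_vscalel a^-1) mG).
    by move=> y [/= yA _]; rewrite /= -normalize_cons.
rewrite integral_slices// muleA -EFinM expr1n div1r mulfV ?mul1e//.
Qed.

(** Truncated at height $1/\rho$, the cone over [G] stays in the unit ball: its point over $z$ at
    height $a$ has norm $a|(1,z)|\le a\rho$. *)
Lemma sphere_measure_ge_gnomonic (A : set (Rn R k.+1)) (G : set (Rn R k)) (rho : R) :
  measurable A -> measurable G -> (0 < rho)%R ->
  (forall z, G z -> A (gnomonic z)) ->
  (forall z, G z -> (enorm (cons_Rn (1, z)) <= rho)%R) ->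
  (rho ^- k.+1)%:E * Lk G <= sphere_measure A.
Proof.
move=> mA mG rho0 GA Grho; have mC := measurable_cone mA.
rewrite sphere_measureE -/(cone A) (lebesgue_RnS_slices mC).
have ms := measurable_lebesgue_slice mC.
have msc a := measurable_slice a mC.
have ri0 : (0 < rho^-1)%R by rewrite invr_gt0.
apply: (@le_trans _ _ ((k.+1%:R)%:E *
    \int[lam]_(a in `]0%R, rho^-1%R]) ((a ^+ k)%:E * Lk G))).
  rewrite integral_slices// muleA -EFinM mulrCA mulfV ?mulr1//.
  by rewrite exprVn.
apply: lee_pmul => //.
  apply: integral_ge0 => a /=; rewrite in_itv/= => /andP[a0 _].
  by rewrite mule_ge0// lee_fin exprn_ge0// ltW.
apply: (@le_trans _ _ (\int[lam]_(a in `]0%R, rho^-1%R])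
    Lk [set y | cone A (cons_Rn (a, y))])); last first.
  by apply: ge0_subset_integral.
apply: ge0_le_integral => //.
- by move=> a /=; rewrite in_itv/= => /andP[a0 _];
    rewrite mule_ge0// lee_fin exprn_ge0// ltW.
- apply: emeasurable_funM => //.
  by apply/measurable_EFinP; exact: measurable_funX.
- exact: measurable_funTS.
- move=> a /=; rewrite in_itv/= => /andP[a0 arho].
  rewrite -(lebesgue_slice_scale a0 mG).
  apply: le_measure; rewrite ?inE//.
    exact: (measurable_preimageT (measurable_vscalel a^-1) mG).
  move=> y /= yG; split => /=; first by rewrite normalize_cons//; exact: GA.
  split; first exact: enorm_cons_gt0.
  have -> : cons_Rn (a, y) = vscale a (cons_Rn (1%R, vscale a^-1 y)).
    by rewrite vscale_cons mulr1 vscaleA mulfV ?gt_eqF// vscale1.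
  rewrite /unit_ball /= enorm_vscale gtr0_norm//.
  apply: (@le_trans _ _ (a * rho)%R); first by rewrite ler_pM2l//; exact: Grho.
  by rewrite -ler_pdivlMr// div1r.
Qed.

End gnomonic.

(** * Reflections acting on the sphere *)

Section householder.
Context {R : realType} {n : nat}.
Implicit Types (u v x y : Rn R n).

(* The reflection exchanging the unit vectors [u] and [v]; when [u = v] the
   division by 0 makes it the identity. *)
Definition householder u v x : Rn R n :=
  vsub x (vscale (2 * dot (vsub u v) x / dot (vsub u v) (vsub u v)) (vsub u v)).

Lemma householderB u v x y :
  householder u v (vsub x y) = vsub (householder u v x) (householder u v y).
Proof.
rewrite /householder; move: (vsub u v) => w; apply: Rn_ext => i.
rewrite !coordE dot_vsubr; ring.
Qed.

Lemma householderZ u v r x :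
  householder u v (vscale r x) = vscale r (householder u v x).
Proof.
rewrite /householder; move: (vsub u v) => w; apply: Rn_ext => i.
rewrite !coordE dot_vscaler; ring.
Qed.

Lemma householderK u v : involutive (householder u v).
Proof.
move=> x; rewrite /householder; move: (vsub u v) => w.
have [w0|w0] := eqVneq (dot w w) 0.
  by apply: Rn_ext => i; rewrite !coordE w0 invr0; ring.
apply: Rn_ext => i; rewrite !coordE !dotE; field; exact: w0.
Qed.

Lemma enorm_householder u v x : enorm (householder u v x) = enorm x.
Proof.
apply: enorm_eq; rewrite /householder; move: (vsub u v) => w.
rewrite !dotE (dotC x w); have [w0|w0] := eqVneq (dot w w) 0.
  by rewrite w0 invr0; ring.
by field.
Qed.

Lemma householder_swap u v : enorm u = 1 -> enorm v = 1 -> householder u v v = u.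
Proof.
move=> u1 v1; have uu : dot u u = 1 by rewrite -sqr_enorm u1 expr1n.
have vv : dot v v = 1 by rewrite -sqr_enorm v1 expr1n.
rewrite /householder; have [w0|w0] := eqVneq (dot (vsub u v) (vsub u v)) 0.
  have uv : u = v.
    by apply: enorm_vsub_eq0; rewrite enormE w0 sqrtr0.
  by rewrite w0 invr0 uv; apply: Rn_ext => i; rewrite !coordE; ring.
(* For unit vectors $\langle u-v,v\rangle=\langle u,v\rangle-1=-|u-v|^2/2$. *)
have -> : 2 * dot (vsub u v) v / dot (vsub u v) (vsub u v) = -1.
  apply: (canLR (mulfK w0)); rewrite !dotE uu vv (dotC v u); ring.
by apply: Rn_ext => i; rewrite !coordE; ring.
Qed.

Lemma measurable_householder u v : measurable_fun setT (householder u v).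
Proof.
apply: measurable_vsub => //; apply: measurable_vscale => //.
apply: measurable_funM => //; apply: measurable_funM => //.
exact: measurable_dot.
Qed.

Lemma normalize_householder u v x :
  normalize (householder u v x) = householder u v (normalize x).
Proof. by rewrite /normalize enorm_householder householderZ. Qed.

(** Lets any point of the sphere be moved to the pole of the gnomonic chart without changing the
    cone measure. *)
Lemma sphere_measure_householder u v (A : set (Rn R n)) : measurable A ->
  sphere_measure (householder u v @^-1` A) = sphere_measure A.
Proof.
move=> mA; rewrite !sphere_measureE; congr (_ * _)%E.
rewrite -[RHS](lebesgue_Rn_isometry (measurable_householder u v) (@householderK u v)
  (householderB u v) (enorm_householder u v)).
- congr (lebesgue_Rn R n _); apply/seteqP; split => x;
    rewrite /punctured_ball /unit_ball /= normalize_householder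
      enorm_householder; by [].
- apply: measurableI; last exact: measurable_punctured_ball.
  exact: (measurable_preimageT measurable_normalize mA).
Qed.

Lemma sphere_measure_lty : (sphere_measure [set: Rn R n] < +oo)%E.
Proof.
rewrite sphere_measureE; apply: lte_mul_pinfty => //.
apply: (@le_lt_trans _ _ (lebesgue_Rn R n unit_ball)).
  apply: le_measure; rewrite ?inE.
  - apply: measurableI; last exact: measurable_punctured_ball.
    exact: (measurable_preimageT measurable_normalize measurableT).
  - exact: measurable_unit_ball.
  - by move=> x [_ []].
exact: lebesgue_Rn_unit_ball_lty.
Qed.

Lemma measurable_unit_sphere : measurable (@unit_sphere R n).
Proof.
rewrite (_ : unit_sphere =
  [set x | enorm x <= 1] `&` [set x : Rn R n | 1 <= enorm x]).
  by apply: measurableI; apply: measurable_set_le => //; exact: measurable_enorm.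
apply/seteqP; split => x; first by rewrite /unit_sphere /= => ->.
by move=> [/= x1 x2]; apply/eqP; rewrite eq_le x1.
Qed.

Lemma sphere_measure_sphere (A : set (Rn R n)) : measurable A ->
  sphere_measure (A `&` unit_sphere) = sphere_measure A.
Proof.
move=> mA; rewrite !sphere_measureE; congr (_ * lebesgue_Rn R n _)%E.
apply/seteqP; split => x /=; first by move=> [[]].
by move=> [Ax xB]; split => //; split => //; apply: enorm_normalize; case: xB.
Qed.

End householder.

Section caps.
Context {R : realType} {k : nat}.
Local Open Scope ereal_scope.

Let o : Rn R k := [tuple 0%R | i < k].
Let e1 : Rn R k.+1 := cons_Rn (1%R, o).

Let coord_o i : coord o i = 0%R.
Proof. exact: coord_mktuple. Qed.

Let dot_o (z : Rn R k) : dot z o = 0%R.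
Proof. by rewrite /dot big1// => i _; rewrite coord_mktuple mulr0. Qed.

Let enorm_e1 : enorm e1 = 1%R.
Proof. by rewrite enormE dot_cons dot_o mulr1 addr0 sqrtr1. Qed.

(** With [w0] moved to the pole [e1], [gnomonic] maps the flat ball of radius $r$ about the origin
    into the cap, because it does not increase the distance to the pole; and $|(1,z)|\le1+r$ on that
    ball. *)
Lemma sphere_measure_cball_ge (w0 : Rn R k.+1) (r : R) :
  enorm w0 = 1%R -> (0 < r)%R ->
  (ball_volume k * r ^+ k / (1 + r) ^+ k.+1)%:E <= sphere_measure (cball w0 r).
Proof.
move=> w01 r0; have rho0 : (0 < 1 + r)%R by rewrite ltr_wpDl.
have mc := measurable_cball w0 r.
rewrite -(sphere_measure_householder w0 e1)//.
have mp := measurable_preimageT (measurable_householder w0 e1) mc.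
have := sphere_measure_ge_gnomonic mp (measurable_cball o r) rho0.
rewrite lebesgue_Rn_cball// -EFinM mulrC; apply => z.
- rewrite /cball /= => zr.
  have {zr} zr : (dot z z <= r ^+ 2)%R.
    rewrite -sqr_enorm ler_pXn2r ?nnegrE ?enorm_ge0 ?(ltW r0)//.
    suff <- : vsub z o = z by [].
    by apply: Rn_ext => i; rewrite coord_vsub coord_o subr0.
  have -> : vsub (householder w0 e1 (gnomonic z)) w0 =
      householder w0 e1 (vsub (gnomonic z) e1).
    by rewrite householderB householder_swap.
  rewrite enorm_householder.
  rewrite enorm_le ?(ltW r0)//; apply: le_trans zr.
  rewrite /gnomonic /normalize; set c := enorm (cons_Rn (1%R, z)).
  have c0 : (0 < c)%R by exact: enorm_cons_gt0.
  have c2 : (c ^+ 2 = 1 + dot z z)%R by rewrite sqr_enorm dot_cons mulr1.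
  rewrite !dotE !dot_cons (dotC o z) !dot_o.
  set q := dot z z in c2 *; set t := c^-1%R.
  have t0 : (0 < t)%R by rewrite invr_gt0.
  have ct : (c * t = 1)%R by rewrite mulfV// gt_eqF.
  have ctt : (c ^+ 2 * t = c)%R by rewrite expr2 -mulrA ct mulr1.
  have tt : (t * t * (1 + q) = 1)%R.
    by rewrite -c2 expr2 mulrACA (mulrC t) ct mulr1.
  (* The squared distance of [gnomonic z] to the pole is $2-2t$ with $t=1/c$, and $|z|^2=c^2-1$. The
     difference $c^2-3+2t$ factors as $(c-1)^2(1+2t)$. *)
  have : (0 <= (c - 1) ^+ 2 * (1 + 2 * t))%R.
    by rewrite mulr_ge0 ?sqr_ge0// addr_ge0// mulr_ge0// ltW.
  rewrite (_ : _ * _ = c ^+ 2 - 2 * c + 1 + 2 * (c ^+ 2 * t) - 4 * (c * t) + 2 * t)%R; last by ring.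
  by rewrite ctt ct c2 => key; lra.
- rewrite /cball /= => zr.
  have {}zr : (enorm z <= r)%R.
    suff <- : vsub z o = z by [].
    by apply: Rn_ext => i; rewrite coord_vsub coord_o subr0.
  rewrite enorm_le ?(ltW rho0)// dot_cons.
  have : (dot z z <= r ^+ 2)%R by rewrite -enorm_le// ltW.
  by have := r0; nra.
Qed.

(** With a point of [C] moved to the pole, [C] lies where the first coordinate is at least $1-d$.
    There the gnomonic projection turns the diameter bound $d$ into $d/(1-d)^2$, and the
    isodiametric inequality applies to the projected set. *)
Lemma sphere_measure_diam_le (C : set (Rn R k.+1)) (d : R) :
  measurable C -> C `<=` unit_sphere -> (0 <= d < 1)%R ->
  (forall x y, C x -> C y -> enorm (vsub x y) <= d)%R ->
  sphere_measure C <= (ball_volume k * (d / 2 / (1 - d) ^+ 2) ^+ k)%:E.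
Proof.
move=> mC CS /andP[d0 d1] Cd; have d1' : (0 < 1 - d)%R by rewrite subr_gt0.
have [C0|C0] := eqVneq C set0.
  rewrite C0 measure0 lee_fin mulr_ge0 ?(ltW (ball_volume_gt0 _))// exprn_ge0//.
  by rewrite divr_ge0 ?sqr_ge0// divr_ge0.
have /set0P[w0 Cw0] := C0.
have w01 : enorm w0 = 1%R by exact: CS.
pose Q := householder w0 e1.
have Qe1 : Q e1 = w0 by exact: householder_swap.
rewrite -(sphere_measure_householder w0 e1)// -/Q.
have mC' := measurable_preimageT (measurable_householder w0 e1) mC.
have Qd x y : C (Q x) -> C (Q y) -> (enorm (vsub x y) <= d)%R.
  by move=> Cx Cy; rewrite -(enorm_householder w0 e1) householderB; exact: Cd.
have Ce1 : C (Q e1) by rewrite Qe1.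
have Qc w : C (Q w) -> (1 - d <= coord w ord0)%R.
  move=> Cw; have := le_trans (ler_coord_enorm _ ord0) (Qd _ _ Cw Ce1).
  by rewrite coord_vsub coord_cons0 ler_norml => /andP[]; lra.
apply: (le_trans (sphere_measure_le_gnomonic mC' _)).
  by move=> w /= /Qc; exact: lt_le_trans.
rewrite [X in (ball_volume k * X ^+ k)%R](_ : _ = d / (1 - d) ^+ 2 / 2)%R; last first.
  by rewrite mulrAC.
have D0 : (0 <= d / (1 - d) ^+ 2)%R by rewrite divr_ge0// sqr_ge0.
apply: (isodiametric D0).
  exact: (measurable_preimageT measurable_gnomonic mC').
have enorm_cons (a : R) (y : Rn R k) : (enorm y <= enorm (cons_Rn (a, y)))%R.
  by rewrite !enormE ler_wsqrtr// dot_cons lerDr -expr2 sqr_ge0.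
have gE (z : Rn R k) : C (Q (gnomonic z)) -> exists t : R,
    [/\ gnomonic z = cons_Rn (t, vscale t z), (1 - d <= t)%R &
        (enorm (vscale t z) <= d)%R].
  move=> Cz; pose t := (enorm (cons_Rn (1%R, z)))^-1%R.
  have ge : gnomonic z = cons_Rn (t, vscale t z).
    by rewrite /gnomonic /normalize vscale_cons mulr1.
  exists t; split => //; first by have := Qc _ Cz; rewrite ge coord_cons0.
  apply: le_trans (Qd _ _ Cz Ce1); rewrite ge vsub_cons.
  have -> : vsub (vscale t z) o = vscale t z.
    by apply: Rn_ext => i; rewrite coord_vsub coord_o subr0.
  exact: enorm_cons.
move=> z z' /= Cz Cz'.
have [t [zE t1 tz]] := gE _ Cz; have [t' [zE' t1' tz']] := gE _ Cz'.
have := Qd _ _ Cz Cz'; rewrite zE zE' vsub_cons => dd.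
have h1 : (enorm (vsub (vscale t z) (vscale t' z')) <= d)%R.
  by apply: le_trans dd; exact: enorm_cons.
have h2 : (`|t - t'| <= d)%R.
  by have := le_trans (ler_coord_enorm _ ord0) dd; rewrite coord_cons0.
have t0 : (0 < t)%R by exact: lt_le_trans t1.
have t0' : (0 < t')%R by exact: lt_le_trans t1'.
rewrite enorm_vscale gtr0_norm// in tz'.
(* From $t(z-z')=(tz-t'z')+(t'-t)z'$. Together with $|z'|\le d/(1-d)$ this gives $(1-d)|z-z'|\le
   d+d^2/(1-d)=d/(1-d)$. *)
have h3 : (t * enorm (vsub z z') <= d + d * enorm z')%R.
  rewrite -[X in (X * _)%R]gtr0_norm// -enorm_vscale vscale_vsub.
  apply: le_trans (edist_triangle (vscale t' z') _ _) _.
  apply: lerD h1 _.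
  rewrite (_ : vsub _ _ = vscale (t' - t)%R z'); last first.
    by apply: Rn_ext => i; rewrite !coordE; ring.
  by rewrite enorm_vscale distrC ler_wpM2r// enorm_ge0.
have n0 := enorm_ge0 (vsub z z'); have n0' := enorm_ge0 z'.
rewrite ler_pdivlMr ?exprn_gt0//.
have h4 : ((1 - d) * enorm z' <= d)%R.
  by apply: le_trans tz'; rewrite ler_wpM2r.
have h5 : ((1 - d) * enorm (vsub z z') <= d + d * enorm z')%R.
  by apply: le_trans h3; rewrite ler_wpM2r.
have h6 : ((1 - d) * ((1 - d) * enorm (vsub z z')) <= (1 - d) * (d + d * enorm z'))%R.
  by rewrite ler_pM2l.
have h7 : (d * ((1 - d) * enorm z') <= d * d)%R by rewrite ler_wpM2l.
lra.
Qed.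

End caps.

(** * Hausdorff measure of Borel subsets of the sphere *)

Section enorm_topology.
Context {R : realType} {n : nat}.
Implicit Types (U A : set (Rn R n)) (x y : Rn R n).

Definition eopen U := forall x, U x -> exists2 r : R, 0 < r & cball x r `<=` U.

Lemma rat_tuple_dense x (e : R) : 0 < e -> exists q : n.-tuple rat,
  enorm (vsub x [tuple ratr (tnth q i) | i < n]) <= e.
Proof.
move=> e0; have d0 : 0 < e / n.+1%:R by rewrite divr_gt0.
have /choice[q qP] (i : 'I_n) : exists q : rat, `|coord x i - ratr q| <= e / n.+1%:R.
  have [|q] := @rat_in_itvoo R (coord x i - e / n.+1%:R) (coord x i + e / n.+1%:R).
    by rewrite ltrD2l gtrN.
  rewrite in_itv/= => /andP[q1 q2]; exists q.
  by move: q1 q2; move: (e / _) => d q1 q2; rewrite ler_norml; apply/andP; split; lra.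
exists [tuple q i | i < n]; apply: (@le_trans _ _ (n%:R * (e / n.+1%:R))).
  apply: enorm_le_coord => [|i]; first exact: ltW.
  by rewrite coord_vsub coord_mktuple tnth_mktuple.
by rewrite mulrCA ger_pMr// ler_pdivrMr// mul1r ler_nat.
Qed.

(** [U] is the union of the countably many balls with rational centre and radius $1/(j+1)$ that it
    contains, enumerated through [unpickle]. *)
Lemma measurable_eopen U : eopen U -> measurable U.
Proof.
move=> oU; pose B (c : n.-tuple rat * nat) : set (Rn R n) :=
  cball [tuple ratr (tnth c.1 i) | i < n] c.2.+1%:R^-1.
pose F j := if unpickle j is Some c then
  (if `[< B c `<=` U >] then B c else set0) else set0.
rewrite (_ : U = \bigcup_j F j); last first.
  apply/seteqP; split=> [x Ux|x [j _]]; last first.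
    rewrite /F; case: (unpickle j) => // c.
    by case: asboolP => // BU; exact: BU.
  have [r r0 rU] := oU x Ux.
  have [m rm] : exists m : nat, (m.+1%:R^-1 : R) < r / 2.
    have [m _ mr] := near_infty_natSinv_lt (PosNum (divr_gt0 r0 (ltr0n R 2))).
    by exists m; apply: mr => /=.
  have [q qx] := @rat_tuple_dense x m.+1%:R^-1 ltac:(by rewrite invr_gt0).
  exists (pickle (q, m)) => //; rewrite /F pickleK.
  case: asboolP => [_|]; first by [].
  move=> BU; exfalso; apply: BU => y yB; apply: rU; rewrite /cball /=.
  apply: le_trans (edist_triangle [tuple ratr (tnth q i) | i < n] _ _) _.
  rewrite (enorm_vsubC _ x); move: rm qx yB; rewrite /B /cball /=.
  by move: (m.+1%:R^-1) => d rm qx yB; lra.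
apply: bigcupT_measurable => j; rewrite /F; case: (unpickle j) => // c.
by case: asboolP => // _; exact: measurable_cball.
Qed.

Lemma eopen_bigcup (F : nat -> set (Rn R n)) : (forall i, eopen (F i)) ->
  eopen (\bigcup_i F i).
Proof.
move=> oF x [i _ Fx]; have [r r0 rF] := oF i x Fx.
by exists r => // y yr; exists i => //; exact: rF.
Qed.

Lemma eopen_setI U A : eopen U -> eopen A -> eopen (U `&` A).
Proof.
move=> oU oA x [Ux Ax]; have [r r0 rU] := oU x Ux; have [s s0 sA] := oA x Ax.
exists (Num.min r s); first by rewrite lt_min r0.
by move=> y; rewrite /cball /= le_min => /andP[yr ys]; split; [exact: rU|exact: sA].
Qed.

Lemma eopen_cballC x (r : R) : eopen (~` cball x r).
Proof.
move=> y; rewrite /cball /= => /negP; rewrite -ltNge => yr.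
exists ((enorm (vsub y x) - r) / 2); first by rewrite divr_gt0// subr_gt0.
move=> z; rewrite /cball /= => zy; apply/negP; rewrite -ltNge.
have := edist_triangle z y x; rewrite (enorm_vsubC y z); lra.
Qed.

Lemma eopen_bigcap_lt (F : nat -> set (Rn R n)) N : (forall i, eopen (F i)) ->
  eopen (\bigcap_(i < N) F i).
Proof.
move=> oF; elim: N => [|N IH]; first by rewrite II0 bigcap_set0 => x _; exists 1.
by rewrite IIS bigcap_setU bigcap_set1; exact: eopen_setI.
Qed.

End enorm_topology.

(** * Regularity of finite Borel measures *)

Section regularity.
Context {R : realType} {n : nat}.
Local Open Scope ereal_scope.
Variable mu : {measure set (Rn R n) -> \bar R}.
Hypothesis mu_fin : mu setT < +oo.

(** Approximating from both sides makes the property stable under complements. The sets that have it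
    form a sigma-algebra containing the open sets, hence the generators. *)
Let regular (A : set (Rn R n)) := forall e : R, (0 < e)%R ->
  exists U F : set (Rn R n),
    [/\ eopen U, eopen (~` F), F `<=` A, A `<=` U & mu (U `\` F) <= e%:E].

Let regularC A : regular A -> regular (~` A).
Proof.
move=> rA e e0; have [U [F [oU oF FA AU UF]]] := rA e e0.
exists (~` F), (~` U); split => //; [by rewrite setCK|exact: subsetC|exact: subsetC|].
by rewrite setDE setCK setIC -setDE.
Qed.

Let fin_mu (A : set (Rn R n)) : measurable A -> mu A < +oo.
Proof.
by move=> mA; apply: le_lt_trans mu_fin; apply: le_measure; rewrite ?inE.
Qed.

(** Continuity from above, where finiteness of [mu] enters. It allows a countable union of closed
    sets to be replaced by a finite one, which is closed again. *)
Let small_diff (F : nat -> set (Rn R n)) (e : R) : (0 < e)%R ->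
  (forall i, measurable (F i)) ->
  exists N : nat, mu (\bigcup_i F i `\` \bigcup_(i < N) F i) <= e%:E.
Proof.
move=> e0 mF; pose G N := \bigcup_i F i `\` \bigcup_(i < N) F i.
have mU : measurable (\bigcup_i F i) by exact: bigcupT_measurable.
have mG N : measurable (G N).
  by apply: measurableD => //; apply: bigcup_measurable.
have G0 : \bigcap_N G N = set0.
  apply/seteqP; split => // x xG; have [[i _ Fx] _] := xG 0%N I.
  by have [_] := xG i.+1 I; apply; exists i => /=.
have : mu \o G @ \oo --> mu (\bigcap_N G N).
  apply: nonincreasing_cvg_mu => //; first exact: fin_mu.
    by rewrite G0.
  move=> i j ij; apply/subsetPset => x [Ux nx]; split => // -[l /= li Fl].
  by apply: nx; exists l => //=; exact: leq_trans ij.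
rewrite G0 measure0 => /fine_cvgP[_] /cvgrPdist_le/(_ e e0)[N _ NP].
exists N; have := NP N (leqnn N); rewrite /= sub0r normrN.
rewrite ger0_norm ?fine_ge0// -lee_fin fineK// ge0_fin_numE//.
exact: fin_mu.
Qed.

Let regular_bigcup (A : nat -> set (Rn R n)) : (forall i, regular (A i)) ->
  regular (\bigcup_i A i).
Proof.
move=> rA e e0; have e2 : (0 < e / 2)%R by rewrite divr_gt0.
have /choice[U UP] i : exists U, exists F : set (Rn R n),
    [/\ eopen U, eopen (~` F), F `<=` A i, A i `<=` U &
        mu (U `\` F) <= (e / 2 / (2 ^ i.+1)%:R)%:E].
  by apply: rA; rewrite divr_gt0// ltr0n expn_gt0.
have /choice[F FP] := UP.
have mU i : measurable (U i) by have [oU _ _ _ _] := FP i; exact: measurable_eopen.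
have mF i : measurable (F i).
  have [_ oF _ _ _] := FP i; rewrite -(setCK (F i)); apply: measurableC.
  exact: measurable_eopen.
have [N NP] := small_diff e2 mF.
exists (\bigcup_i U i), (\bigcup_(i < N) F i); split.
- by apply: eopen_bigcup => i; have [] := FP i.
- rewrite setC_bigcup; apply: (@eopen_bigcap_lt _ _ (fun i => ~` F i)) => i.
  by have [] := FP i.
- by move=> x [i _ Fx]; exists i => //; have [_ _ FA _ _] := FP i; exact: FA.
- by move=> x [i _ Ax]; exists i => //; have [_ _ _ AU _] := FP i; exact: AU.
have mUF : measurable (\bigcup_i (U i `\` F i)).
  by apply: bigcupT_measurable => i; exact: measurableD.
have mFF : measurable (\bigcup_i F i `\` \bigcup_(i < N) F i).
  apply: measurableD; first exact: bigcupT_measurable.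
  exact: bigcup_measurable.
apply: (@le_trans _ _ (mu ((\bigcup_i (U i `\` F i)) `|`
    (\bigcup_i F i `\` \bigcup_(i < N) F i)))).
  apply: le_measure; rewrite ?inE.
  - apply: measurableD; first exact: bigcupT_measurable.
    exact: bigcup_measurable.
  - exact: measurableU.
  - move=> x [[i _ Ux] nx]; have [Fx|Fx] := pselect (F i x).
      by right; split => //; exists i.
    by left; exists i.
apply: le_trans (measureU2 _ _ _) _ => //.
rewrite (splitr e) EFinD; apply: leeD => //.
apply: (@le_trans _ _ (\sum_(i <oo) mu (U i `\` F i))).
  apply: measure_sigma_subadditive => //.
  by move=> i; exact: measurableD.
apply: (@le_trans _ _ (\sum_(i <oo) (0 + (e / 2 / (2 ^ i.+1)%:R)%:E))).
  by apply: lee_nneseries => // i _; rewrite add0e; have [] := FP i.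
apply: le_trans (epsilon_trick _ _ _) _ => //; first exact: ltW.
by rewrite eseries0// add0e.
Qed.

Let regular_eopen U : eopen U -> regular U.
Proof.
move=> oU e e0.
(* The points at distance at least $1/(i+1)$ from the complement: closed sets that exhaust [U]. *)
pose F (i : nat) := [set x | forall y, (~` U) y -> (i.+1%:R^-1 <= enorm (vsub y x))%R].
have oF i : eopen (~` F i).
  move=> x /existsNP[y /not_implyP[nUy /negP]]; rewrite -ltNge => yx.
  exists ((i.+1%:R^-1 - enorm (vsub y x)) / 2)%R; first by rewrite divr_gt0// subr_gt0.
  move=> z; rewrite /cball /= => zx /(_ y nUy).
  apply/negP; rewrite -ltNge.
  move: zx; have := edist_triangle x y z; rewrite (enorm_vsubC x z).
  by move: (i.+1%:R^-1)%R yx => d; lra.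
have mF i : measurable (F i).
  by rewrite -(setCK (F i)); apply: measurableC; exact: measurable_eopen.
have [N NP] := small_diff e0 mF.
have UF : \bigcup_i F i = U.
  apply/seteqP; split => [x [i _ Fx]|x Ux].
    apply: contrapT => nUx; have := Fx x nUx.
    by rewrite vsubxx leNgt invr_gt0 ltr0n.
  have [r r0 rU] := oU x Ux.
  have [m _ mr] := near_infty_natSinv_lt (PosNum r0).
  exists m => // y nUy; rewrite leNgt; apply/negP => yx; apply: nUy; apply: rU.
  by apply/ltW/(lt_trans yx); exact: (mr m (leqnn m)).
exists U, (\bigcup_(i < N) F i); split => //.
- rewrite setC_bigcup; exact: (@eopen_bigcap_lt _ _ (fun i => ~` F i)).
- by move=> x [i _ Fx]; rewrite -UF; exists i.
- by rewrite -{1}UF.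
Qed.

Let regular_measurable (A : set (Rn R n)) : measurable A -> regular A.
Proof.
have sigR : sigma_algebra setT regular.
  split.
  - move=> e e0; exists set0, set0; split=> //.
    + by rewrite setC0 => x _; exists 1%R.
    + by rewrite set0D measure0 lee_fin ltW.
  - by move=> B rB; rewrite setTD; exact: regularC.
  - exact: regular_bigcup.
apply: smallest_sub => // B.
rewrite -bigcup_seq => -[i _ [C mC <-]]; rewrite setTI.
have {}mC : <<s @RGenOInfty.G R >> C by move: mC; rewrite RGenOInfty.measurableE.
pose c (x : Rn R n) := coord x i; rewrite -[_ @^-1` _]/(c @^-1` C).
have [s0 sC sU] := sigR.
suff /(_ _ mC) : <<s @RGenOInfty.G R >> `<=` [set C | regular (c @^-1` C)] by [].
apply: smallest_sub => [|_ [t ->]].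
  split => [|D rD|D rD] /=.
  - by rewrite preimage_set0.
  - by rewrite setTD preimage_setC -setTD; exact: sC.
  - by rewrite preimage_bigcup; exact: sU.
(* The Borel sets of the line are generated by the rays $]t,\infty[$, whose preimages under a
   coordinate are open half-spaces. *)
apply: regular_eopen => x /=; rewrite in_itv/= andbT => tx.
exists ((c x - t) / 2)%R; first by rewrite divr_gt0// subr_gt0.
move=> y; rewrite /cball /= in_itv/= andbT => yx.
have := le_trans (ler_coord_enorm _ i) yx; rewrite coord_vsub ler_norml.
by rewrite -/(c y) -/(c x) => /andP[]; lra.
Qed.

Lemma outer_regularity (A : set (Rn R n)) (e : R) : measurable A -> (0 < e)%R ->
  exists U, [/\ eopen U, A `<=` U & mu U <= mu A + e%:E].
Proof.
move=> mA e0; have [U [F [oU oF FA AU UF]]] := regular_measurable mA e0.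
exists U; split => //.
have mU := measurable_eopen oU.
have mF : measurable F by rewrite -(setCK F); apply: measurableC; exact: measurable_eopen.
rewrite -(setDUK (subset_trans FA AU)).
apply: (le_trans (measureU2 _ _ _)) => //; first exact: measurableD.
by apply: leeD => //; apply: le_measure; rewrite ?inE.
Qed.

End regularity.

(** * Diameters and the Hausdorff gauge *)

Section diameter.
Context {R : realType} {n : nat}.
Local Open Scope ereal_scope.
Implicit Types (C : set (Rn R n)) (x y z : Rn R n).

Lemma diam_le C (d : R) :
  (forall x y, C x -> C y -> (enorm (vsub x y) <= d)%R) -> diam C <= d%:E.
Proof.
move=> Cd; apply: ge_ereal_sup => _ [[x y] [/= Cx Cy] <-].
by rewrite lee_fin; exact: Cd.
Qed.

Lemma edist_le_diam C x y : C x -> C y -> (enorm (vsub x y))%:E <= diam C.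
Proof. by move=> Cx Cy; apply: ereal_sup_ubound; exists (x, y). Qed.

Lemma diam_ge0 C : C !=set0 -> 0 <= diam C.
Proof.
by move=> [x Cx]; apply: le_trans (edist_le_diam Cx Cx); rewrite lee_fin enorm_ge0.
Qed.

Lemma diam_fin C (d : R) : C !=set0 -> diam C <= d%:E ->
  exists2 t : R, diam C = t%:E & (0 <= t <= d)%R.
Proof.
move=> C0 Cd; have := diam_ge0 C0; move: Cd; case: (diam C) => //= t.
by rewrite !lee_fin => td t0; exists t => //; rewrite t0.
Qed.

Lemma diam_cball x (r : R) : diam (cball x r) <= (2 * r)%:E.
Proof.
apply: diam_le => y z yr zr; apply: le_trans (edist_triangle x _ _) _.
move: yr zr; rewrite /cball /= (enorm_vsubC x z); lra.
Qed.

Lemma hausdorff_gaugeE k C (d : R) : C !=set0 -> diam C = d%:E ->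
  hausdorff_gauge k C = (ball_volume k * (d / 2) ^+ k)%:E.
Proof.
move=> /set0P C0 Cd; rewrite /hausdorff_gauge (negbTE C0) Cd ball_volumeE.
by rewrite -EFinM -EFin_expe -EFinM.
Qed.

Lemma hausdorff_gauge_ge0 k C : 0 <= hausdorff_gauge k C.
Proof.
rewrite /hausdorff_gauge; case: ifPn => // /set0P C0.
by rewrite mule_ge0// expe_ge0// mule_ge0// ?diam_ge0// lee_fin.
Qed.

Lemma hausdorff_gauge_le k C (r : R) : (0 <= r)%R -> diam C <= (2 * r)%:E ->
  hausdorff_gauge k C <= (ball_volume k * r ^+ k)%:E.
Proof.
move=> r0 Cr; have [->|C0] := eqVneq C set0.
  rewrite /hausdorff_gauge eqxx lee_fin mulr_ge0 ?exprn_ge0//.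
  exact/ltW/ball_volume_gt0.
have /set0P C0' := C0; have [d dE /andP[d0 dr]] := diam_fin C0' Cr.
rewrite (hausdorff_gaugeE _ C0' dE) lee_fin.
rewrite ler_pM2l ?ball_volume_gt0// lerXn2r ?nnegrE ?divr_ge0//; lra.
Qed.

(* Measurable even when [C] is not, with the same bound on the diameter. *)
Definition diam_hull C (d : R) : set (Rn R n) :=
  [set y | forall w, (forall x, C x -> (enorm (vsub x w) <= d)%R) ->
    (enorm (vsub y w) <= d)%R].

Lemma sub_diam_hull C d : C `<=` diam_hull C d.
Proof. by move=> x Cx w; exact. Qed.

(** Each point of [C] is an admissible centre [w]; so a point of the hull is within [d] of all of
    [C], hence is itself an admissible centre. *)
Lemma diam_hull_diam C d : diam C <= d%:E ->
  forall x y, diam_hull C d x -> diam_hull C d y -> (enorm (vsub x y) <= d)%R.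
Proof.
move=> Cd x y hx hy; apply: hx => z Cz; rewrite enorm_vsubC; apply: hy => w Cw.
by rewrite -lee_fin; apply: le_trans (edist_le_diam Cw Cz) Cd.
Qed.

Lemma measurable_diam_hull C d : measurable (diam_hull C d).
Proof.
rewrite -(setCK (diam_hull C d)); apply: measurableC; apply: measurable_eopen.
move=> y /existsNP[w /not_implyP[wC /negP]]; rewrite -ltNge => yw.
exists ((enorm (vsub y w) - d) / 2)%R; first by rewrite divr_gt0// subr_gt0.
move=> z; rewrite /cball /= => zy /(_ w wC).
apply/negP; rewrite -ltNge; move: zy.
have := edist_triangle z y w; rewrite (enorm_vsubC y z); lra.
Qed.

End diameter.

Section hausdorff_lower.
Context {R : realType} {n : nat} (k : nat).
Local Open Scope ereal_scope.
Variable mu : {measure set (Rn R n) -> \bar R}.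
Variables (S : set (Rn R n)) (mS : measurable S).

(** Each member of a covering is traded for the measurable hull of its part in [S], cut down to [S];
    the assumed bound applies to it with the diameter of the original member. Countable
    subadditivity of [mu] does the rest. *)
Lemma le_hausdorff_measure (e delta : R) (A : set (Rn R n)) : (0 < e)%R -> (0 < delta)%R ->
  (forall (C : set (Rn R n)) (d : R), measurable C -> C `<=` S ->
    (0 <= d <= delta)%R ->
    (forall x y, C x -> C y -> (enorm (vsub x y) <= d)%R) ->
    mu C <= ((1 + e) * (ball_volume k * (d / 2) ^+ k))%:E) ->
  measurable A -> A `<=` S ->
  mu A <= (1 + e)%:E * hausdorff_measure k A.
Proof.
move=> e0 delta0 muC mA AS; have e1 : (0 < 1 + e)%R by rewrite addr_gt0.
suff h : ((1 + e)^-1)%:E * mu A <= hausdorff_content k delta A.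
  have : (1 + e)%:E * (((1 + e)^-1)%:E * mu A) <= (1 + e)%:E * hausdorff_measure k A.
    apply: lee_pmul => //; first by rewrite lee_fin ltW.
      by rewrite mule_ge0// lee_fin invr_ge0 ltW.
    by apply: le_trans h _; apply: ereal_sup_ubound; exists delta.
  by rewrite muleA -EFinM mulfV ?gt_eqF// mul1e.
apply: le_ereal_inf_tmp => _ [C [AC Cd] <-].
have /choice[D DP] i : exists D : set (Rn R n), [/\ measurable D, C i `&` S `<=` D &
    mu D <= (1 + e)%:E * hausdorff_gauge k (C i)].
  have [C0|C0] := eqVneq (C i `&` S) set0.
    exists set0; split; [exact: measurable0|by rewrite C0|].
    by rewrite measure0 mule_ge0// ?hausdorff_gauge_ge0// lee_fin ltW.
  have Ci0 : C i !=set0 by have /set0P[x [Cx _]] := C0; exists x.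
  have [d dE d0] := diam_fin Ci0 (Cd i).
  have dCS : diam (C i `&` S) <= d%:E.
    rewrite -dE; apply: ereal_sup_le => t [z [[z1 _] [z2 _]] <-].
    by exists z.
  exists (diam_hull (C i `&` S) d `&` S); split.
  - by apply: measurableI => //; exact: measurable_diam_hull.
  - by move=> x [Cx Sx]; split => //; apply: sub_diam_hull.
  - rewrite (hausdorff_gaugeE _ Ci0 dE) -EFinM; apply: muC => //.
    + by apply: measurableI => //; exact: measurable_diam_hull.
    + by move=> x y [hx _] [hy _]; exact: diam_hull_diam hx hy.
have mD i : measurable (D i) by have [] := DP i.
rewrite muleC lee_pdivrMr//.
apply: (@le_trans _ _ (\sum_(i <oo) mu (D i))).
  apply: measure_sigma_subadditive => //.
  move=> x Ax; have [i _ Cx] := AC x Ax; exists i => //.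
  by have [_ h _] := DP i; apply: h; split => //; exact: AS.
rewrite muleC -nneseriesZl//; last by move=> i _; exact: hausdorff_gauge_ge0.
by apply: lee_nneseries => // i _; have [] := DP i.
Qed.

End hausdorff_lower.

(** * Greedy selection of disjoint balls *)

Section vitali_selection.
Context {R : realType} {n : nat}.
Variables (V S : set (Rn R n)) (r : nat -> R).
Hypothesis r_decr : forall i j, (i <= j)%N -> r j <= r i.
Notation cand := (Rn R n * nat)%type.

Let B (c : cand) : set (Rn R n) := cball c.1 (r c.2).

(** A candidate is a centre together with the index of its radius. As the radii run through a
    nonincreasing sequence, a largest available ball exists: it is one of least index. *)
Definition available (s : seq cand) (c : cand) : Prop :=
  [/\ S c.1, B c `<=` V & forall c', c' \in s -> B c `&` B c' = set0].

Let pick_spec (s : seq cand) (c : cand) : Prop :=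
  (exists c', available s c') ->
  available s c /\ forall c', available s c' -> (c.2 <= c'.2)%N.

Let pick_ex s : exists c, pick_spec s c.
Proof.
have [[c' ac']|noc] := pselect (exists c', available s c'); last first.
  by exists ([tuple 0 | i < n], 0%N).
pose P j := `[< exists x, available s (x, j) >].
have exP : exists j, P j by exists c'.2; apply/asboolP; exists c'.1; case: c' ac'.
case: (ex_minnP exP) => j /asboolP[x xj] jmin; exists (x, j) => _; split => //.
by move=> [y i] yi; apply: jmin; apply/asboolP; exists y.
Qed.

Let pick s := projT1 (cid (pick_ex s)).

Let pickP s : pick_spec s (pick s).
Proof. exact: projT2 (cid (pick_ex s)). Qed.

(* At each step the selected ball has maximal radius among the balls in [V]
   that avoid the previous ones. *)
Fixpoint selected (m : nat) : seq cand :=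
  if m is m'.+1 then
    let s := selected m' in
    if `[< exists c, available s c >] then pick s :: s else s
  else [::].

Definition active m := `[< exists c, available (selected m) c >].

Definition ball_seq m : set (Rn R n) :=
  if active m then B (pick (selected m)) else set0.

Definition double_ball_seq m : set (Rn R n) :=
  if active m then cball (pick (selected m)).1 (2 * r (pick (selected m)).2)
  else set0.

Lemma active_available m : active m ->
  available (selected m) (pick (selected m)) /\
  forall c, available (selected m) c -> ((pick (selected m)).2 <= c.2)%N.
Proof. by move=> /asboolP; exact: pickP. Qed.

Let selectedS m : selected m.+1 =
  if active m then pick (selected m) :: selected m else selected m.
Proof. by []. Qed.

Let selected_sub i m : (i < m)%N -> active i ->
  pick (selected i) \in selected m.
Proof.
elim: m => // m IH; rewrite ltnS leq_eqVlt => /predU1P[->|im] ai.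
  by rewrite selectedS ai mem_head.
by rewrite selectedS; case: ifP => _; rewrite ?in_cons IH ?orbT.
Qed.

Let selectedP m c : c \in selected m ->
  exists2 i, (i < m)%N & active i /\ c = pick (selected i).
Proof.
elim: m => // m IH; rewrite selectedS; case: ifP => am.
  rewrite in_cons => /predU1P[->|/IH[i im ai]]; first by exists m.
  by exists i => //; exact: ltnW.
by move=> /IH[i im ai]; exists i => //; exact: ltnW.
Qed.

Lemma trivIset_ball_seq : trivIset setT ball_seq.
Proof.
have dis i j : (i < j)%N -> ball_seq i `&` ball_seq j = set0.
  move=> ij; rewrite /ball_seq; case: ifPn => ai; last by rewrite set0I.
  case: ifPn => aj; last by rewrite setI0.
  have [[_ _ dj] _] := active_available aj.
  by rewrite setIC; apply: dj; exact: selected_sub.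
apply/trivIsetP => i j _ _; rewrite neq_ltn => /orP[/dis//|/dis].
by rewrite setIC.
Qed.

Lemma ball_seq_sub m : ball_seq m `<=` V.
Proof.
rewrite /ball_seq; case: ifPn => [am|_]; last exact: sub0set.
by have [[_ BV _] _] := active_available am.
Qed.

Lemma ball_seqP m : active m -> exists x j, [/\ S x, ball_seq m = cball x (r j) &
  double_ball_seq m = cball x (2 * r j)].
Proof.
move=> am; exists (pick (selected m)).1, (pick (selected m)).2.
rewrite /ball_seq /double_ball_seq am; split => //.
by have [[]] := active_available am.
Qed.

(** Some small ball about [x] avoids the first [N] selected balls. A later one cannot meet it: being
    at least as large, its double would contain [x] (doubling is enough since only the centre has to
    be covered). So the small ball stays available for ever and bounds all later radii from
    below. *)
Lemma vitali_cover_or (oV : eopen V) (r_small : forall e, 0 < e -> exists j, r j <= e)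
    (N : nat) (x : Rn R n) : V x -> S x ->
  ~ (\bigcup_(m < N) ball_seq m) x -> ~ (\bigcup_(m in [set m | (N <= m)%N]) double_ball_seq m) x ->
  exists j, forall m, (N <= m)%N -> exists2 y, S y &
    exists2 i, ball_seq m = cball y (r i) & (i <= j)%N.
Proof.
move=> Vx Sx xN xN2.
have oW : eopen (V `&` \bigcap_(m < N) ~` ball_seq m).
  apply: eopen_setI => //; apply: (eopen_bigcap_lt (F := fun m => ~` ball_seq m)) => m.
  rewrite /ball_seq; case: ifPn => _; first exact: eopen_cballC.
  by rewrite setC0 => y _; exists 1.
have [|e e0 eW] := oW x.
  by split => // m mN xm; apply: xN; exists m.
have [j je] := r_small e e0; exists j.
have sub_e y : B (x, j) y -> cball x e y.
  by rewrite /B /cball /= => /le_trans; exact.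
have avN : available (selected N) (x, j).
  split => //; first by move=> y /sub_e/eW[].
  move=> c /selectedP[i iN [ai cE]]; apply/seteqP; split => // y [/sub_e/eW[_ yW] yc].
  by apply: (yW i iN); rewrite /ball_seq ai -cE.
have av m : (N <= m)%N -> available (selected m) (x, j).
  elim: m => [|m IH]; first by rewrite leqn0 => /eqP <-.
  rewrite leq_eqVlt => /predU1P[<-//|Nm].
  have avm := IH Nm; have am : active m by apply/asboolP; exists (x, j).
  have [_ mmin] := active_available am.
  rewrite selectedS am; have [h1 h2 h3] := avm; split => // c.
  rewrite in_cons => /predU1P[->|]; last exact: h3.
  apply/seteqP; split => // y [xy yc]; apply: xN2; exists m => //.
  rewrite /double_ball_seq am /cball /=; set c0 := pick _ in yc *.
  apply: le_trans (edist_triangle y _ _) _.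
  have := r_decr (mmin _ avm); rewrite -/c0.
  by move: xy yc; rewrite /B /cball /= (enorm_vsubC x y); lra.
move=> m Nm; have avm := av m Nm.
have am : active m by apply/asboolP; exists (x, j).
have [[Sy _ _] mmin] := active_available am.
exists (pick (selected m)).1 => //; exists (pick (selected m)).2.
  by rewrite /ball_seq am.
exact: mmin avm.
Qed.

End vitali_selection.

Section hausdorff_upper.
Context {R : realType} {n : nat} (k : nat).
Local Open Scope ereal_scope.
Variable mu : {measure set (Rn R n) -> \bar R}.
Hypothesis mu_fin : mu setT < +oo.
Variables (S : set (Rn R n)) (e delta : R).
Hypotheses (e0 : (0 < e)%R) (delta0 : (0 < delta)%R).
Hypothesis mu_cball : forall x (r : R), S x -> (0 < r <= delta)%R ->
  (ball_volume k * r ^+ k)%:E <= (1 + e)%:E * mu (cball x r).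

Let e1 : (0 < 1 + e)%R. Proof. by rewrite addr_gt0. Qed.

(** [A] is covered by the first [N] selected balls and the doubles of the others. Being disjoint,
    the balls have total gauge at most $(1+e)\mu(V)$; doubling costs $2^k$, but only on a small tail
    of $\sum_m\mu(D_m)$. A point left over would keep $\mu(D_m)$ away from 0, against
    summability. *)
Lemma hausdorff_content_le (delta' : R) (A : set (Rn R n)) : (0 < delta')%R ->
  measurable A -> A `<=` S ->
  hausdorff_content k delta' A <= (1 + e)%:E * mu A.
Proof.
move=> delta'0 mA AS.
(* A quarter of [delta'], because the doubled balls have diameter up to $4r_j$. *)
pose r (j : nat) : R := (Num.min delta (delta' / 4) / 2 ^+ j)%R.
have m0 : (0 < Num.min delta (delta' / 4))%R by rewrite lt_min delta0 divr_gt0.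
have r0 j : (0 < r j)%R by rewrite divr_gt0// exprn_gt0.
have r_decr i j : (i <= j)%N -> (r j <= r i)%R.
  by move=> ij; rewrite ler_pM2l// lef_pV2 ?posrE ?exprn_gt0// ler_eXn2l// ltr1n.
have r_small c : (0 < c)%R -> exists j, (r j <= c)%R.
  move=> c0; pose M : R := Num.min delta (delta' / 4)%R.
  exists (Num.truncn (M / c)).+1.
  rewrite ler_pdivrMr ?exprn_gt0// [leRHS]mulrC -ler_pdivrMr//.
  have /andP[_ /ltW h] := truncn_itv (ltW (divr_gt0 m0 c0)).
  apply: le_trans h _; rewrite -natrX ler_nat; apply: ltnW; exact: ltn_expl.
have r_le j : (r j <= Num.min delta (delta' / 4))%R.
  by rewrite /r ler_pdivrMr ?exprn_gt0// ler_peMr ?(ltW m0)// exprn_ege1// ler1n.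
have r_delta j : (r j <= delta)%R by apply: le_trans (r_le j) _; rewrite ge_min lexx.
have r_delta' j : (4 * r j <= delta')%R.
  have : (r j <= delta' / 4)%R by apply: le_trans (r_le j) _; rewrite ge_min lexx orbT.
  lra.
apply/lee_addgt0Pr => eps eps0.
pose c2 : R := (2 ^+ k)%R.
have c20 : (0 < c2)%R by rewrite exprn_gt0.
(* So that $(1+e)(\eta+2^k\eta)=\varepsilon$: one [eta] for the excess of [V] over [A], one for the
   tail. *)
pose eta : R := (eps / ((1 + e) * (1 + c2)))%R.
have eta0 : (0 < eta)%R by rewrite divr_gt0// mulr_gt0// addr_gt0.
have [V [oV AV VA]] := outer_regularity mu_fin mA eta0.
have mV := measurable_eopen oV.
pose D := ball_seq V S r; pose E := double_ball_seq V S r.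
have DP m : D m = set0 /\ E m = set0 \/ exists x j, [/\ S x, D m = cball x (r j) &
    E m = cball x (2 * r j)].
  have [am|am] := boolP (active V S r m); first by right; exact: ball_seqP.
  by left; rewrite /D /E /ball_seq /double_ball_seq (negbTE am).
have mD m : measurable (D m).
  by have [[-> _]|[x [j [_ -> _]]]] := DP m; [exact: measurable0|exact: measurable_cball].
have sumD : \sum_(m <oo) mu (D m) <= mu V.
  have mUD := bigcupT_measurable D mD.
  rewrite (cvg_lim _ (measure_semi_sigma_additive D mD (@trivIset_ball_seq _ _ V S r) mUD))//.
  apply: le_measure; rewrite ?inE// => x [m _]; exact: ball_seq_sub.
have muV : mu V < +oo.
  by apply: le_lt_trans mu_fin; apply: le_measure; rewrite ?inE.
have sumD_fin : \sum_(m <oo) mu (D m) < +oo by exact: le_lt_trans muV.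
have tail0 := nneseries_tail_cvg sumD_fin (fun m _ => measure_ge0 mu (D m)).
have tail (c : R) : (0 < c)%R -> exists M, forall N, (M <= N)%N ->
    \sum_(N <= m <oo) mu (D m) <= c%:E.
  move=> c0; move/fine_cvgP : tail0 => [[M1 _ fM1] /cvgrPdist_le/(_ c c0)[M2 _ fM2]].
  exists (maxn M1 M2) => N MN.
  have N1 : (M1 <= N)%N by apply: leq_trans MN; exact: leq_maxl.
  have N2 : (M2 <= N)%N by apply: leq_trans MN; exact: leq_maxr.
  have := fM2 N N2; rewrite /= sub0r normrN => h.
  rewrite -(fineK (fM1 N N1)) lee_fin; apply: le_trans h; exact: ler_norm.
have [N NP] := tail eta eta0.
have {NP} tailN := NP N (leqnn N).
pose C m := if (m < N)%N then D m else E m.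
have cover : A `<=` \bigcup_m C m.
  move=> x Ax; apply: contrapT => xC.
  have [||j jP] := vitali_cover_or r_decr oV r_small (AV _ Ax) (AS _ Ax) (N := N).
  - by move=> [m /= mN Dx]; apply: xC; exists m => //; rewrite /C mN.
  - by move=> [m /= Nm Ex]; apply: xC; exists m => //; rewrite /C ltnNge Nm.
  (* A lower bound of $\mu(D_m)$ for all $m\ge N$, whereas the tails of the series fall below
     $c/2$. *)
  pose c := (ball_volume k * r j ^+ k / (1 + e) : R)%R.
  have c0 : (0 < c)%R by rewrite divr_gt0// mulr_gt0 ?ball_volume_gt0// exprn_gt0.
  have [M MP] := tail (c / 2)%R (divr_gt0 c0 (ltr0n _ 2)).
  pose m := maxn M N.
  have [y Sy [i Dm ij]] := jP m (leq_maxr _ _).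
  have : mu (D m) <= (c / 2)%:E.
    apply: le_trans (MP m (leq_maxl _ _)).
    apply: le_trans (nneseries_lim_ge m.+1 _); first by rewrite big_nat1.
    by move=> l _ _; exact: measure_ge0.
  apply/negP; rewrite -ltNge; apply: (@lt_le_trans _ _ c%:E).
    by rewrite lte_fin; lra.
  rewrite /c mulrC EFinM lee_pdivrMl//.
  rewrite [D m]Dm; apply: le_trans (mu_cball Sy _); last by rewrite r0 r_delta.
  rewrite lee_fin ler_pM2l ?ball_volume_gt0// lerXn2r ?nnegrE ?(ltW (r0 _))//.
  exact: r_decr.
have gC m : hausdorff_gauge k (C m) <=
    (1 + e)%:E * (mu (D m) + if (N <= m)%N then c2%:E * mu (D m) else 0).
  have gD : hausdorff_gauge k (D m) <= (1 + e)%:E * mu (D m).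
    have [[-> _]|[x [j [Sx -> _]]]] := DP m.
      by rewrite /hausdorff_gauge eqxx mule_ge0// lee_fin ltW.
    apply: le_trans (mu_cball Sx _); last by rewrite r0 r_delta.
    by apply: hausdorff_gauge_le (diam_cball _ _); exact: ltW.
  have gE : hausdorff_gauge k (E m) <= (1 + e)%:E * (c2%:E * mu (D m)).
    have [[-> ->]|[x [j [Sx -> ->]]]] := DP m.
      by rewrite /hausdorff_gauge eqxx mule_ge0 ?mule_ge0// lee_fin ltW.
    rewrite muleCA; apply: (@le_trans _ _ (c2%:E * (ball_volume k * r j ^+ k)%:E)).
      have -> : (c2%:E * (ball_volume k * r j ^+ k)%:E =
          (ball_volume k * (2 * r j) ^+ k)%:E).
        by move: (r j) => t; rewrite -EFinM exprMn /c2 mulrCA.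
      apply: hausdorff_gauge_le (diam_cball _ _).
      by rewrite mulr_ge0// ltW.
    rewrite lee_pmul2l//; apply: mu_cball => //.
    by rewrite r0 r_delta.
  rewrite /C (leqNgt N m); case: ifPn => mN /=; first by rewrite adde0.
  apply: le_trans gE _; rewrite lee_pmul2l//; exact: leeDr.
apply: (@le_trans _ _ (\sum_(m <oo) hausdorff_gauge k (C m))).
  apply: ereal_inf_lbound; exists C => //; split => // m.
  rewrite /C; have r0' j := r0 j.
  have [[-> ->]|[x [j [Sx -> ->]]]] := DP m.
    by rewrite if_same; apply: diam_le => y z [].
  case: ifPn => _; apply: le_trans (diam_cball _ _) _; rewrite lee_fin;
    by have := r_delta' j; have := r0 j; lra.
apply: (@le_trans _ _ (\sum_(m <oo) ((1 + e)%:E *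
    (mu (D m) + if (N <= m)%N then c2%:E * mu (D m) else 0)))).
  by apply: lee_nneseries => [m _ _|m _]; [exact: hausdorff_gauge_ge0|exact: gC].
have ge0if m : 0 <= if (N <= m)%N then c2%:E * mu (D m) else 0.
  by case: ifP => // _; rewrite mule_ge0// lee_fin ltW.
rewrite nneseriesZl => [|m _]; last by rewrite adde_ge0.
rewrite nneseriesD//.
have -> : \sum_(m <oo) (if (N <= m)%N then c2%:E * mu (D m) else 0) =
    c2%:E * \sum_(N <= m <oo) mu (D m).
  rewrite -eseries_mkcond -(nneseriesZl _ _ (fun m _ => measure_ge0 mu (D m))).
  by rewrite [RHS]eseries_cond.
apply: (@le_trans _ _ ((1 + e)%:E * (mu A + eta%:E + c2%:E * eta%:E))).
  rewrite lee_pmul2l//; apply: leeD; first exact: le_trans VA.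
  by rewrite lee_pmul2l.
have h0 : 0 <= eta%:E + c2%:E * eta%:E.
  have [h1 h2] := (ltW eta0, ltW c20).
  by rewrite -EFinM -EFinD lee_fin; apply: addr_ge0 => //; exact: mulr_ge0.
rewrite -addeA (ge0_muleDr _ (measure_ge0 mu A) h0).
suff -> : (1 + e)%:E * (eta%:E + c2%:E * eta%:E) = eps%:E by [].
rewrite -(EFinM c2 eta) -EFinD -EFinM; congr EFin; rewrite /eta; field.
by rewrite !gt_eqF// addr_gt0.
Qed.

End hausdorff_upper.

(** The hypotheses bound [mu] by the gauge from above on small sets and from below on small balls.
    Either gives a comparison with a factor $1+e$, which is removed by choosing [e] small relative
    to the finite value it multiplies. *)
Theorem hausdorff_measure_unique (R : realType) (n k : nat)
    (mu : {measure set (Rn R n) -> \bar R}) (S : set (Rn R n)) :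
  (mu setT < +oo)%E -> measurable S ->
  (forall e : R, 0 < e -> exists2 delta : R, 0 < delta &
    forall (C : set (Rn R n)) (d : R), measurable C -> C `<=` S ->
      0 <= d <= delta ->
      (forall x y, C x -> C y -> enorm (vsub x y) <= d) ->
      (mu C <= ((1 + e) * (ball_volume k * (d / 2) ^+ k))%:E)%E) ->
  (forall e : R, 0 < e -> exists2 delta : R, 0 < delta &
    forall x (r : R), S x -> 0 < r <= delta ->
      ((ball_volume k * r ^+ k)%:E <= (1 + e)%:E * mu (cball x r))%E) ->
  forall A, measurable A -> A `<=` S -> hausdorff_measure k A = mu A.
Proof.
move=> mu_fin mS hU hL A mA AS.
have muA : (mu A < +oo)%E.
  by apply: le_lt_trans mu_fin; apply: le_measure; rewrite ?inE.
have muAfin : mu A \is a fin_num by rewrite ge0_fin_numE.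
have HA : (hausdorff_measure k A <= mu A)%E.
  apply: ge_ereal_sup => _ [delta' /= delta'0 <-].
  apply/lee_addgt0Pr => eps eps0.
  have a0 : 0 < 1 + fine (mu A) by rewrite ltr_wpDr// fine_ge0.
  have e0 : 0 < eps / (1 + fine (mu A)) by rewrite divr_gt0.
  have [delta delta0 dP] := hL _ e0.
  apply: le_trans (hausdorff_content_le mu_fin e0 delta0 dP delta'0 mA AS) _.
  rewrite -(fineK muAfin) -EFinM -EFinD lee_fin mulrDl mul1r lerD2l.
  rewrite -mulrA ger_pMr// mulrC ler_pdivrMr// mul1r; lra.
have AH e : 0 < e -> (mu A <= (1 + e)%:E * hausdorff_measure k A)%E.
  move=> e0; have [delta delta0 dP] := hU e e0.
  exact: (le_hausdorff_measure mS e0 delta0 dP mA AS).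
apply/eqP; rewrite eq_le HA /=.
case: (hausdorff_measure k A) HA AH => [h| |] HA AH.
- apply/lee_addgt0Pr => eps eps0.
  have a0 : 0 < 1 + `|h| by rewrite ltr_wpDr.
  have e0 : 0 < eps / (1 + `|h|) by rewrite divr_gt0.
  apply: le_trans (AH _ e0) _; rewrite -EFinM -EFinD lee_fin mulrDl mul1r lerD2l.
  apply: (@le_trans _ _ (eps / (1 + `|h|) * `|h|)).
    by rewrite ler_wpM2l ?ler_norm// ltW.
  rewrite -mulrA ger_pMr// mulrC ler_pdivrMr// mul1r; lra.
- by rewrite leey.
- by have := AH 1 ltr01; rewrite gt0_muleNy ?lte_fin ?addr_gt0.
Qed.

(** * The coefficient b_s as an integral over R^n *)

Section integral_set_function.
Context d (T : measurableType d) {R : realType}.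
Local Open Scope ereal_scope.
Import HBNNSimple.

(** The integral is built from suprema over simple functions, which make sense for any set function.
    A nonnegative simple function below a function that vanishes outside [D] has its nonzero levels
    inside [D], and the level 0 contributes 0 whatever value the set function takes there. *)
Lemma eq_set_function_integral (m1 m2 : set T -> \bar R) (D : set T)
    (f : T -> \bar R) :
  (forall A, measurable A -> A `<=` D -> m1 A = m2 A) ->
  \int[m1]_(x in D) f x = \int[m2]_(x in D) f x.
Proof.
move=> m12; rewrite /integral; set g := f \_ D.
have gD x : ~ D x -> g x = 0 by move=> Dx; rewrite /g patchE memNset.
have key (G : T -> \bar R) : (forall x, ~ D x -> G x = 0) ->
    [set sintegral m1 h | h in [set h : {nnsfun T >-> R} | forall x, (h x)%:E <= G x]] =
    [set sintegral m2 h | h in [set h : {nnsfun T >-> R} | forall x, (h x)%:E <= G x]].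
  move=> GD; apply: eq_imagel => h /= hG; rewrite /sintegral.
  apply: eq_fsbigr => r _; have [->|r0] := eqVneq r 0%R; first by rewrite !mul0e.
  congr (_ * _); apply: m12 => // x /= hx; apply: contrapT => Dx.
  move: r0; rewrite -hx => /eqP; apply; apply/eqP; rewrite eq_le fun_ge0 andbT.
  by have := hG x; rewrite GD// lee_fin.
by congr (ereal_sup _ - ereal_sup _); apply: key => x Dx;
  rewrite ?funeposE ?funenegE gD// ?oppe0 maxxx.
Qed.

Variable mu : {measure set T -> \bar R}.

(** A simple function below [F], set to 0 on the null set [N], lies below [G] and has the same
    integral. *)
Let le_nnintegral (N : set T) (F G : T -> \bar R) : measurable N -> mu N = 0 ->
  (forall x, 0 <= G x) -> (forall x, ~ N x -> F x = G x) ->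
  ereal_sup [set sintegral mu h | h in [set h : {nnsfun T >-> R} | forall x, (h x)%:E <= F x]] <=
  ereal_sup [set sintegral mu h | h in [set h : {nnsfun T >-> R} | forall x, (h x)%:E <= G x]].
Proof.
move=> mN N0 G0 FG; apply: ge_ereal_sup => _ [h /= hF <-].
apply: ereal_sup_ubound; have mNC := measurableC mN.
have pE : (proj_nnsfun h mNC : T -> R) = h \_ (~` N) by rewrite mrestrict.
exists (proj_nnsfun h mNC); last rewrite pE.
  move=> x; have -> : proj_nnsfun h mNC x = (h \_ (~` N)) x by rewrite pE.
  rewrite patchE; case: ifPn => //; rewrite inE => xN.
  by rewrite -FG.
transitivity (\int[mu]_x (h x)%:E); last first.
  by rewrite (@integral_nnsfun _ _ _ mu setT measurableT h) patch_setT.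
rewrite (ge0_negligible_integral mN)//; first by rewrite setTD integral_nnsfun.
  by apply/measurable_EFinP.
by move=> x _; rewrite lee_fin.
Qed.

(* No measurability is required of [f] and [g]. *)
Lemma ae_eq_integralT (f g : T -> \bar R) : {ae mu, forall x, f x = g x} ->
  \int[mu]_x f x = \int[mu]_x g x.
Proof.
move=> [N [mN N0 fgN]]; rewrite /integral !patch_setT.
have fg x : ~ N x -> f x = g x.
  by move=> Nx; apply: contrapT => h; apply: Nx; exact: fgN.
congr (_ - _); apply/eqP; rewrite eq_le; apply/andP; split;
  apply: (le_nnintegral mN N0) => x; rewrite ?funepos_ge0 ?funeneg_ge0//;
  by move=> /fg; rewrite ?funeposE ?funenegE => ->.
Qed.

End integral_set_function.

Section hausdorff_sphere.
Context {R : realType} {k : nat}.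
Local Open Scope ereal_scope.

(** From $(1+t)^m\le1+4^mt$ for $0\le t\le1$. *)
Let expr_near1 m (e : R) : (0 < e)%R -> exists2 delta : R, (0 < delta)%R &
  forall t, (0 <= t <= delta)%R -> ((1 + t) ^+ m <= 1 + e)%R.
Proof.
move=> e0; exists (Num.min 1%R (e / 4 ^+ m)%R).
  by rewrite lt_min ltr01 divr_gt0// exprn_gt0.
move=> t /andP[t0]; rewrite le_min => /andP[t1 te].
suff h : ((1 + t) ^+ m <= 1 + 4 ^+ m * t)%R.
  by apply: le_trans h _; rewrite lerD2l mulrC -ler_pdivlMr// exprn_gt0.
elim: m {te} => [|m IH]; first by rewrite !expr0 mul1r lerDl.
rewrite exprS; apply: (@le_trans _ _ ((1 + t) * (1 + 4 ^+ m * t))%R).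
  by rewrite ler_pM2l// ltr_wpDr.
have x1 : (1 <= 4 ^+ m :> R)%R by rewrite exprn_ege1// ler1n.
rewrite exprS; move: (4 ^+ m)%R x1 => X X1.
by have : (0 <= X * t * (1 - t))%R; [rewrite !mulr_ge0//; lra|nra].
Qed.

Lemma hausdorff_measure_sphere (A : set (Rn R k.+1)) : measurable A ->
  A `<=` unit_sphere -> hausdorff_measure k A = sphere_measure A.
Proof.
apply: (hausdorff_measure_unique sphere_measure_lty measurable_unit_sphere) => e e0.
(* The factor to absorb is $(1-d)^{-2k}$, which is at most $(1+2d)^{2k}$ for $d\le1/2$. *)
- have [delta delta0 dP] := expr_near1 (2 * k) e0.
  exists (Num.min (delta / 2)%R (1 / 2)%R); first by rewrite lt_min !divr_gt0.
  move=> C d mC CS /andP[d0]; rewrite le_min => /andP[dd d1] Cd.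
  apply: (le_trans (sphere_measure_diam_le mC CS _ Cd)); first by lra.
  rewrite lee_fin mulrCA ler_pM2l ?ball_volume_gt0// exprMn mulrC.
  have p1 : (0 < 1 - d)%R by lra.
  rewrite ler_wpM2r ?exprn_ge0 ?divr_ge0//.
  apply: le_trans (dP (2 * d)%R _); last by lra.
  rewrite exprM lerXn2r ?nnegrE ?invr_ge0 ?exprn_ge0//; [lra|lra|].
  rewrite -exprVn lerXn2r ?nnegrE ?invr_ge0//; [lra|lra|].
  by rewrite -div1r ler_pdivrMr//; nra.
- have [delta delta0 dP] := expr_near1 k.+1 e0.
  exists delta => // x r xS /andP[r0 rd].
  have r1 : (0 < (1 + r) ^+ k.+1)%R by rewrite exprn_gt0// addr_gt0.
  have := sphere_measure_cball_ge xS r0.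
  have e1 : (0 < 1 + e)%R by rewrite addr_gt0.
  rewrite -(@lee_pmul2l _ (1 + e)%:E) ?lte_fin//; apply: le_trans.
  rewrite -EFinM lee_fin mulrA ler_pdivlMr// mulrC ler_wpM2r//.
    by rewrite mulr_ge0 ?exprn_ge0 ?(ltW r0)// ltW// ball_volume_gt0.
  by apply: dP; rewrite ltW.
Qed.

End hausdorff_sphere.

Section b_coef_ball.
Context {R : realType} {n : nat}.
Local Open Scope ereal_scope.
Notation lam := (@lebesgue_measure R).
Notation L := (lebesgue_Rn R n).
Hypothesis n_gt0 : (0 < n)%N.

Lemma hausdorff_measure_sphere_pos (A : set (Rn R n)) : measurable A ->
  A `<=` unit_sphere -> hausdorff_measure n.-1 A = sphere_measure A.
Proof. by case: n n_gt0 A => // k _ A; exact: hausdorff_measure_sphere. Qed.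

Lemma ge0_integral_eq0 d (T : measurableType d)
    (mu : {measure set T -> \bar R}) (D : set T) (f : T -> \bar R) :
  measurable D -> measurable_fun D f -> (forall x, D x -> 0 <= f x) ->
  \int[mu]_(x in D) f x = 0 -> {ae mu, forall x, D x -> f x = 0}.
Proof.
move=> mD mf f0 If; apply/(ae_eq_integral_abs mu mD mf).
by rewrite -[RHS]If; apply: eq_integral => x /set_mem Dx; rewrite gee0_abs// f0.
Qed.

(** Fubini for null sets in polar coordinates. It is needed because $m(x,\cdot)$ is controlled only
    up to null sets of $\mathbb{R}^n$, while [b_coef] integrates it along rays. *)
Lemma ae_polar (N : set (Rn R n)) : L.-negligible N ->
  {ae (@sphere_measure R n), forall w,
    {ae lam, forall r, (0 < r)%R -> ~ N (vscale r w)}}.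
Proof.
move=> [M [mM M0 NM]]; have mI := measurable_EFin_indic (R := R) mM.
have I0 := @indic_ge0 _ _ R M.
have := etrans (esym (integral_polar n_gt0 mI I0)) (etrans (integral_indicT L mM) M0).
move=> /(ge0_integral_eq0 measurableT (measurable_integral_radial mI I0)).
have rad0 (r : R) w : (0 < r)%R -> 0 <= (r ^+ n.-1)%:E * (\1_M (vscale r w) : R)%:E.
  by move=> r0; rewrite mule_ge0// lee_fin exprn_ge0// ltW.
case=> [w _|Z [mZ Z0 ZP]].
  by apply: integral_ge0 => r /=; rewrite in_itv/= andbT; exact: rad0.
exists Z; split => // w /= wP; apply: ZP => /= wI; apply: wP.
have mr : measurable_fun (`]0%R, +oo[%classic : set (measurableTypeR R))
    (fun r : measurableTypeR R => (r ^+ n.-1)%:E * (\1_M (vscale r w) : R)%:E).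
  apply: measurable_funTS; apply: emeasurable_funM.
    by apply/measurable_EFinP; exact: measurable_funX.
  apply: (measurableT_comp mI).
  by apply: measurable_vscale.
have rad0' (r : measurableTypeR R) : (`]0%R, +oo[%classic : set (measurableTypeR R)) r ->
    0 <= (r ^+ n.-1)%:E * (\1_M (vscale r w) : R)%:E.
  by rewrite /= in_itv/= andbT; exact: rad0.
have [Y [mY Y0 YP]] := @ge0_integral_eq0 _ _ lam _ _ (measurable_itv _) mr rad0' (wI Logic.I).
exists Y; split => // r /= rP; apply: YP => /= rI; apply: rP => r0 Nr.
have := rI; rewrite /= in_itv/= r0 => /(_ isT) /eqP.
rewrite indicE mem_set; last exact: NM.
by rewrite mule1 eqe gt_eqF// exprn_gt0.
Qed.

Lemma ae_sphere : {ae (@sphere_measure R n), forall w, enorm w = 1%R}.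
Proof.
exists (~` unit_sphere); split => //.
  by apply: measurableC; exact: measurable_unit_sphere.
rewrite -sphere_measure_sphere ?setICl ?measure0//.
by apply: measurableC; exact: measurable_unit_sphere.
Qed.

(** Polar coordinates read backwards: $r^{n-1}/r^{n+sp}=1/r^{sp+1}$. The function [g] is a version
    of $m(x,\cdot)$; the two agree at almost all points of almost every ray. *)
Lemma b_coefE (m : Rn R n * Rn R n -> R) (g : Rn R n -> R) (p s : R) x :
  (0 < p)%R -> (0 < s)%R -> measurable_fun setT g -> (forall h, 0 <= g h)%R ->
  {ae L, forall h, m (x, h) = g h} ->
  b_coef m p s x = (2 * s)%:E * \int[L]_h
    (\1_[set h : Rn R n | (2 * enorm x < enorm h)%R] h *
     (g h / enorm h `^ (n%:R + s * p)))%:E.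
Proof.
move=> p0 s0 mg g0 mgE; rewrite /b_coef; congr (_ * _).
set rho := (2 * enorm x)%R; have rho0 : (0 <= rho)%R by rewrite mulr_ge0 ?enorm_ge0.
pose f h : \bar R := (\1_[set h : Rn R n | (rho < enorm h)%R] h *
     (g h / enorm h `^ (n%:R + s * p)))%:E.
have mf : measurable_fun setT f.
  apply/measurable_EFinP; apply: measurable_funM.
    by apply: measurable_indic; apply: measurable_set_lt => //; exact: measurable_enorm.
  apply: measurable_funM => //; under eq_fun do rewrite -powRN.
  exact: (measurableT_comp (@measurable_powR R _) measurable_enorm).
have f0 h : 0 <= f h by rewrite lee_fin mulr_ge0// divr_ge0// powR_ge0.
rewrite (integral_polar n_gt0 mf f0).
(* Here the Hausdorff measure becomes the cone measure, which is concentrated on the sphere. *)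
rewrite (eq_set_function_integral _ hausdorff_measure_sphere_pos).
rewrite integral_mkcond; apply: ae_eq_integralT.
have [Z1 [mZ1 Z10 Z1P]] := ae_polar mgE.
have [Z2 [mZ2 Z20 Z2P]] := ae_sphere.
exists (Z1 `|` Z2); split; [exact: measurableU|exact: null_set_setU|].
move=> w /= wP; apply: contrapT => /not_orP[wZ1 wZ2]; apply: wP.
have w1 : enorm w = 1%R by apply: contrapT => h; apply: wZ2; exact: Z2P.
have {wZ1} wr : {ae lam, forall r, (0 < r)%R ->
    ~ (~` [set h | m (x, h) = g h]) (vscale r w)}.
  by apply: contrapT => h; apply: wZ1; exact: Z1P.
rewrite patchE mem_set//.
transitivity (\int[lam]_(r in `](2 * enorm x)%R, +oo[)
    ((g (vscale r w) / r `^ (s * p + 1))%:E)).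
  rewrite [LHS]integral_mkcond [RHS]integral_mkcond; apply: ae_eq_integralT.
  case: wr => Y [mY Y0 YP]; exists Y; split => // r /= rP; apply: YP => /= rY.
  apply: rP; rewrite !patchE; case: ifPn => //; rewrite inE/= in_itv/= andbT => rr.
  have r0 : (0 < r)%R by exact: le_lt_trans rr.
  by have /contrapT -> := rY r0.
rewrite -/rho [LHS]integral_mkcond [RHS]integral_mkcond; apply: eq_integral => r _.
rewrite !patchE /f; have [|] := boolP (r \in `]0%R, +oo[%classic); last first.
  rewrite notin_setE/= in_itv/= andbT => r0; rewrite memNset//= in_itv/= andbT.
  by move=> rr; apply: r0; exact: le_lt_trans rr.
rewrite inE/= in_itv/= andbT => r0; rewrite -EFinM indicE.
have -> : (r \in `]rho, +oo[%classic) = (vscale r w \in [set h : Rn R n | (rho < enorm h)%R]).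
  by apply/idP/idP; rewrite !inE/= in_itv/= andbT enorm_vscale w1 mulr1 gtr0_norm.
case: ifPn => _; last by rewrite mul0r mulr0.
rewrite mul1r enorm_vscale w1 mulr1 gtr0_norm//; congr EFin.
rewrite mulrCA; congr (_ * _)%R.
have -> : (n%:R + s * p = n.-1%:R + (s * p + 1) :> R)%R.
  by rewrite -{1}(prednK n_gt0) -natr1; ring.
rewrite [in RHS]powRD; last by rewrite (gt_eqF r0) implybT.
rewrite powR_mulrn ?(ltW r0)// invfM mulrA mulfV ?mul1r//.
by rewrite expf_neq0// gt_eqF.
Qed.

End b_coef_ball.

(** * Comparison of the energy with its far-field part *)

Section real_lemmas.
Context {R : realType}.

(** Take $\delta$ with $(1+\delta)^p=1+\eta$. If $b\le\delta a$ the first term suffices; otherwise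
    $a+b\le(\delta^{-1}+1)b$. *)
Lemma powRD_le (p eta : R) : 0 < p -> 0 < eta -> exists2 c : R, 0 <= c &
  forall a b : R, 0 <= a -> 0 <= b ->
    (a + b) `^ p <= (1 + eta) * a `^ p + c * b `^ p.
Proof.
move=> p0 eta0; have e1 : 0 < 1 + eta by rewrite addr_gt0.
pose delta := (1 + eta) `^ p^-1 - 1.
have dE : (1 + delta) `^ p = 1 + eta.
  by rewrite addrC subrK -powRrM mulVf ?gt_eqF// powRr1// ltW.
have d0 : 0 < delta.
  have one : 1 = 1 `^ p^-1 :> R by rewrite powR1.
  rewrite subr_gt0 [ltLHS]one gt0_ltr_powR ?invr_gt0// ?nnegrE ?(ltW e1)//.
  by rewrite ltrDl.
exists ((delta^-1 + 1) `^ p) => [|a b a0 b0]; first exact: powR_ge0.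
have [ba|ab] := leP b (delta * a).
  rewrite -[leLHS]addr0 lerD ?mulr_ge0 ?powR_ge0// -dE -powRM//; last by lra.
  by apply: (ge0_ler_powR (ltW p0)); rewrite ?nnegrE; nra.
rewrite -[leLHS]add0r lerD ?mulr_ge0 ?powR_ge0// ?(ltW e1)// -powRM//; last first.
  by rewrite addr_ge0 ?invr_ge0 ?(ltW d0).
apply: (ge0_ler_powR (ltW p0)); rewrite ?nnegrE ?addr_ge0//.
  by rewrite mulr_ge0 ?addr_ge0 ?invr_ge0 ?(ltW d0).
rewrite mulrDl mul1r lerD2r mulrC ler_pdivlMr// mulrC; exact: ltW.
Qed.

(** Since [eta] is fixed before [n] grows, [c] may depend on it in any way: it only multiplies the
    null sequence [r]. *)
Lemma cvg_sandwich (e a r : R^nat) (l : R) :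
  (forall n, 0 <= a n) -> (forall n, 0 <= r n) ->
  (forall eta, 0 < eta -> exists2 c, 0 <= c & \forall n \near \oo,
     e n <= (1 + eta) * a n + c * r n /\ a n <= (1 + eta) * e n + c * r n) ->
  a n @[n --> \oo] --> l -> r n @[n --> \oo] --> 0 ->
  e n @[n --> \oo] --> l.
Proof.
move=> a0 r0 H al rl.
have l0 : 0 <= l.
  rewrite -(cvg_lim _ al)//; apply: limr_ge; first by apply/cvg_ex; exists l.
  exact: nearW.
suff ea : (e n - a n) @[n --> \oo] --> 0.
  have -> : e = (fun n => e n - a n + a n) by apply/funext => n; rewrite subrK.
  by rewrite -[l]add0r; exact: cvgD.
apply/cvgr0Pnorm_le => eps eps0.
have L0 : 0 < 2 * (l + 1) by lra.
(* Eventually $a_n\le l+1$, so with this [eta] the relative error $\eta a_n$ is at most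
   $\varepsilon/2$. *)
have [c c0 Hc] := H (eps / (2 * (l + 1))) (divr_gt0 eps0 L0).
set eta := eps / _ in Hc.
have eta0 : 0 < eta by exact: divr_gt0.
have etaE : eta * (l + 1) = eps / 2 by rewrite /eta; field; lra.
have d0 : 0 < eps / (2 * (c + 1)) by rewrite divr_gt0//; lra.
near=> n.
have [h1 h2] : e n <= (1 + eta) * a n + c * r n /\ a n <= (1 + eta) * e n + c * r n.
  by near: n.
have an : a n <= l + 1.
  by near: n; apply: (cvgr_le l) => //; lra.
have rn : r n <= eps / (2 * (c + 1)).
  by near: n; apply: (cvgr_le 0).
have crn : c * r n <= eps / 2.
  have : (c + 1) * r n <= eps / 2.
    apply: le_trans (ler_wpM2l _ rn) _; first by lra.
    rewrite (_ : (c + 1) * _ = eps / 2)//; by field; lra.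
  by have := r0 n; nra.
have ean : eta * a n <= eps / 2 by rewrite -etaE ler_pM2l.
(* Multiplied by $1+\eta$, the left side is at most $a_n-cr_n$, and the second comparison
   applies. *)
have h3 : (1 - eta) * a n - c * r n <= e n.
  rewrite -(ler_pM2l (_ : 0 < 1 + eta)); last by lra.
  have := a0 n; have := mulr_ge0 c0 (r0 n) => X Y.
  by have := mulr_ge0 (mulr_ge0 (ltW eta0) (ltW eta0)) Y; have := mulr_ge0 (ltW eta0) X; nra.
by rewrite ler_norml; apply/andP; split; lra.
Unshelve. all: by end_near. Qed.

End real_lemmas.

Section product_lemmas.
Context {R : realType} {n : nat}.
Local Open Scope ereal_scope.
Notation L := (lebesgue_Rn R n).
Notation V := (Rn R n).

Definition swap_Rn (z : V * V) : V * V := (vsub z.1 z.2, vopp z.2).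

Lemma swap_RnK z : swap_Rn (swap_Rn z) = z.
Proof. by case: z => x h; rewrite /swap_Rn/= vsubK voppK. Qed.

Lemma measurable_swap_Rn : measurable_fun setT swap_Rn.
Proof.
apply/measurable_fun_pairP; split => /=.
  by apply: measurable_vsub; [exact: measurable_fst|exact: measurable_snd].
by apply: measurable_vopp; exact: measurable_snd.
Qed.

(** At fixed $h$ a translation in $x$, then a reflection in $h$. *)
Lemma integral_swap_Rn (F : V * V -> \bar R) : measurable_fun setT F ->
  (forall z, 0 <= F z) ->
  \int[L \x L]_z F (swap_Rn z) = \int[L \x L]_z F z.
Proof.
move=> mF F0; have mFs := measurableT_comp mF measurable_swap_Rn.
rewrite (fubini_tonelli2 _ mFs (fun z => F0 _)) /fubini_G/=.
transitivity (\int[L]_h \int[L]_x F (x, vopp h)).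
  apply: eq_integral => h _; rewrite /swap_Rn/=.
  apply: (integral_Rn_translate h (f := fun x => F (x, vopp h))) => // .
  by apply: measurableT_comp mF _; exact: pair2_measurable.
rewrite (fubini_tonelli2 _ mF F0) /fubini_G/=.
pose o : V := [tuple 0%R | i < n].
have oE h : vopp h = vsub o h.
  by apply: Rn_ext => i; rewrite coord_vopp coord_vsub coord_mktuple sub0r.
under eq_integral do rewrite oE.
apply: (integral_Rn_reflect o (f := fun h => \int[L]_x F (x, h))).
  exact: measurable_fun_fubini_tonelli_G.
by move=> h; exact: integral_ge0.
Qed.

Lemma ae_section (P : V * V -> Prop) : {ae L \x L, forall z, P z} ->
  {ae L, forall x, {ae L, forall h, P (x, h)}}.
Proof.
move=> [N [mN N0 PN]]; have mI := measurable_EFin_indic (R := R) mN.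
have I0 := @indic_ge0 _ _ R N.
have := etrans (esym (fubini_tonelli1 _ mI I0)) (etrans (integral_indicT _ mN) N0).
move=> /(ge0_integral_eq0 measurableT (measurable_fun_fubini_tonelli_F _ mI I0)).
case=> [x _|Z [mZ Z0 ZP]]; first exact: integral_ge0.
exists Z; split => // x /= xP; apply: ZP => /= xI; apply: xP.
have mx : measurable (xsection N x) by exact: measurable_xsection.
exists (xsection N x); split => //.
  rewrite -(xI Logic.I) /fubini_F -(integral_indicT L mx); apply: eq_integral => h _.
  by rewrite !indicE; congr ((nat_of_bool _)%:R%:E); apply/idP/idP; rewrite !inE /xsection/= ?inE.
by move=> h hP; rewrite /xsection/= inE; exact: PN.
Qed.

End product_lemmas.

Section kernel_integral.
Context {R : realType} {n : nat}.
Local Open Scope ereal_scope.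
Notation L := (lebesgue_Rn R n).

Lemma measurable_enorm_powRV (q : R) :
  measurable_fun setT (fun h : Rn R n => (enorm h `^ q)^-1)%R.
Proof.
under eq_fun do rewrite -powRN.
exact: (measurableT_comp (@measurable_powR R _) measurable_enorm).
Qed.

Lemma measurable_gt_enorm (r : R) : measurable [set h : Rn R n | (r < enorm h)%R].
Proof. by apply: measurable_set_lt => //; exact: measurable_enorm. Qed.

(** With $q=sp$ this mass is of order $1/s$, which the factor $s$ in front of the energy compensates
    exactly. *)
Lemma integral_kernel_tail (q : R) : (0 < n)%N -> (0 < q)%R ->
  \int[L]_h (\1_[set h : Rn R n | (1 < enorm h)%R] h *
     (enorm h `^ (n%:R + q))^-1)%:E = sphere_measure [set: Rn R n] * (q^-1)%:E.
Proof.
move=> n_gt0 q0.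
have mf : measurable_fun setT (fun h : Rn R n =>
   (\1_[set h : Rn R n | (1 < enorm h)%R] h * (enorm h `^ (n%:R + q))^-1)%:E).
  apply/measurable_EFinP; apply: measurable_funM (measurable_enorm_powRV _).
  by apply: measurable_indic; exact: measurable_gt_enorm.
have f0 h : 0 <= (\1_[set h : Rn R n | (1 < enorm h)%R] h * (enorm h `^ (n%:R + q))^-1)%:E.
  by rewrite lee_fin mulr_ge0// invr_ge0 powR_ge0.
rewrite (integral_polar n_gt0 mf f0) muleC.
rewrite -(@integral_cst _ _ _ (@sphere_measure R n) setT measurableT (q^-1)%:E).
apply: ae_eq_integralT.
have [Z [mZ Z0 ZP]] := @ae_sphere R n; exists Z; split => // w /= wP; apply: ZP => w1.
have one : (q^-1 = 1 `^ (- q) / q)%R by rewrite powR1 mul1r.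
apply: wP; rewrite one -(integral_power_tail ltr01 q0).
rewrite [LHS]integral_mkcond [RHS]integral_mkcond; apply: eq_integral => r _.
rewrite !patchE; have [|] := boolP (r \in `]0%R, +oo[%classic); last first.
  rewrite notin_setE/= in_itv/= andbT => r0; rewrite memNset//= in_itv/= andbT.
  by move=> rr; apply: r0; exact: lt_trans rr.
rewrite inE/= in_itv/= andbT => r0; rewrite -EFinM indicE.
have -> : (r \in `]1%R, +oo[%classic) = (vscale r w \in [set h : Rn R n | (1 < enorm h)%R]).
  by apply/idP/idP; rewrite !inE/= in_itv/= andbT enorm_vscale w1 mulr1 gtr0_norm.
case: ifPn => _; last by rewrite mul0r mulr0.
rewrite mul1r enorm_vscale w1 mulr1 gtr0_norm//; congr EFin.
have -> : (n%:R + q = n.-1%:R + (q + 1) :> R)%R.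
  by rewrite -{1}(prednK n_gt0) -natr1; ring.
rewrite [in LHS]powRD; last by rewrite (gt_eqF r0) implybT.
rewrite powR_mulrn ?(ltW r0)// invfM mulrA mulfV ?mul1r//.
by rewrite expf_neq0// gt_eqF.
Qed.

End kernel_integral.

Section cvg_weighted.
Context d (T : measurableType d) {R : realType}.
Variable mu : {measure set T -> \bar R}.
Local Open Scope ereal_scope.

(** Almost everywhere [b] equals the upper limit of the [F k], which is measurable; dominated
    convergence applies to it with the bound $C\,U$. *)
Lemma cvg_integral_weighted (U : T -> R) (C : R) (F : (T -> \bar R)^nat)
    (b : T -> \bar R) :
  mu.-integrable setT (fun x => (U x)%:E) -> (forall x, 0 <= U x)%R ->
  (forall k, measurable_fun setT (F k)) -> (forall k x, 0 <= F k x <= C%:E) ->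
  {ae mu, forall x, F k x @[k --> \oo] --> b x} ->
  \int[mu]_x ((U x)%:E * F k x) @[k --> \oo] --> \int[mu]_x ((U x)%:E * b x).
Proof.
move=> iU U0 mF FC Fb; have mU := measurable_int _ iU.
pose g x := limn_esup (F ^~ x).
have gb : {ae mu, forall x, (U x)%:E * g x = (U x)%:E * b x}.
  apply: filterS Fb => x Fxb; congr (_ * _).
  by rewrite /g (is_cvg_limn_esupE _) ?(cvg_lim _ Fxb)//; apply/cvg_ex; exists (b x).
rewrite -(ae_eq_integralT gb).
have mg : measurable_fun setT g by exact: measurable_fun_limn_esup.
have := @dominated_convergence _ _ _ mu setT measurableT
  (fun k x => (U x)%:E * F k x) (fun x => (U x)%:E * g x) (fun x => C%:E * (U x)%:E).
case=> //.
- by move=> k; apply: emeasurable_funM.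
- exact: emeasurable_funM.
- apply: filterS Fb => x Fxb _; rewrite /g (is_cvg_limn_esupE _); last first.
    by apply/cvg_ex; exists (b x).
  by rewrite (cvg_lim _ Fxb)//; apply: cvgeZl.
- exact: integrableZl.
- apply: aeW => x k _; have /andP[F0 F1] := FC k x.
  rewrite gee0_abs; last by rewrite mule_ge0// lee_fin.
  by rewrite muleC lee_wpmul2r// lee_fin.
Qed.

Lemma ge0_le_integral_lin (F1 F2 F3 : T -> R) (c2 c3 : R) :
  measurable_fun setT F1 -> measurable_fun setT F2 -> measurable_fun setT F3 ->
  (forall z, 0 <= F1 z)%R -> (forall z, 0 <= F2 z)%R -> (forall z, 0 <= F3 z)%R ->
  (0 <= c2)%R -> (0 <= c3)%R -> (forall z, F1 z <= c2 * F2 z + c3 * F3 z)%R ->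
  \int[mu]_z (F1 z)%:E <=
    c2%:E * \int[mu]_z (F2 z)%:E + c3%:E * \int[mu]_z (F3 z)%:E.
Proof.
move=> m1 m2 m3 p1 p2 p3 c20 c30 F12.
have mE (F : T -> R) : measurable_fun setT F -> measurable_fun setT (fun z : T => (F z)%:E).
  by move=> ?; exact/measurable_EFinP.
have pE (F : T -> R) : (forall z, 0 <= F z)%R -> forall z : T, [set: T] z -> 0 <= (F z)%:E.
  by move=> F0 z _; rewrite lee_fin.
have cp (c : R) (F : T -> R) : (0 <= c)%R -> (forall z, 0 <= F z)%R ->
    forall z : T, (0 <= c * F z)%R.
  by move=> c0 F0 z; rewrite mulr_ge0.
have cm (c : R) (F : T -> R) : measurable_fun setT F ->
    measurable_fun setT (fun z : T => c * F z)%R.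
  by move=> ?; exact: measurable_funM.
have Z (c : R) (F : T -> R) : (0 <= c)%R -> (forall z, 0 <= F z)%R -> measurable_fun setT F ->
    \int[mu]_z (c * F z)%:E = c%:E * \int[mu]_z (F z)%:E.
  move=> c0 F0 mF; under eq_integral do rewrite EFinM.
  exact: (ge0_integralZl_EFin _ measurableT (pE _ F0) (mE _ mF) c0).
rewrite -(Z _ _ c20 p2 m2) -(Z _ _ c30 p3 m3).
rewrite -(ge0_integralD _ measurableT (pE _ (cp _ _ c20 p2)) (mE _ (cm _ _ m2))
  (pE _ (cp _ _ c30 p3)) (mE _ (cm _ _ m3))).
apply: ge0_le_integral => //.
- by move=> z _; rewrite lee_fin.
- exact: mE.
- by apply: emeasurable_funD; apply: mE; exact: cm.
- by move=> z _; rewrite -EFinD lee_fin.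
Qed.

End cvg_weighted.

Section far_field.
Context {R : realType} {n : nat}.
Notation L := (lebesgue_Rn R n).
Notation V := (Rn R n).

(* By the triangle inequality [farA] is disjoint from its image under
   [swap_Rn], hence contained in the image of [farD]. *)
Definition farA : set (V * V) :=
  [set z | 1 < enorm z.2 /\ 2 * enorm z.1 < enorm z.2].
Definition farD : set (V * V) := [set z | 1 < enorm z.2 <= 2 * enorm z.1].

Lemma measurable_enorm1 : measurable_fun setT (fun z : V * V => enorm z.1).
Proof. exact: (measurableT_comp measurable_enorm measurable_fst). Qed.

Lemma measurable_enorm2 : measurable_fun setT (fun z : V * V => enorm z.2).
Proof. exact: (measurableT_comp measurable_enorm measurable_snd). Qed.

Lemma measurable_farA : measurable farA.
Proof.
have m1 := measurable_enorm1; have m2 := measurable_enorm2.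
apply: measurableI; apply: measurable_set_lt => //.
exact: measurable_funM.
Qed.

Lemma measurable_farD : measurable farD.
Proof.
have m1 := measurable_enorm1; have m2 := measurable_enorm2.
rewrite (_ : farD = [set z | 1 < enorm z.2] `&` [set z | enorm z.2 <= 2 * enorm z.1]).
  apply: measurableI; first exact: measurable_set_lt.
  by apply: measurable_set_le => //; exact: measurable_funM.
by apply/seteqP; split => z /= /andP.
Qed.

Lemma indic_farA z : \1_farA z = ((1 < enorm z.2) && (2 * enorm z.1 < enorm z.2))%:R :> R.
Proof. by rewrite indicE; congr (nat_of_bool _)%:R; apply/idP/andP; rewrite inE. Qed.

Lemma indic_farD z : \1_farD z = ((1 < enorm z.2) && (enorm z.2 <= 2 * enorm z.1))%:R :> R.
Proof. by rewrite indicE; congr (nat_of_bool _)%:R; apply/idP/idP; rewrite inE. Qed.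

Section weights.
Variables (p : R) (M : V * V -> R) (mhi : R).
Hypotheses (p0 : 0 < p) (M0 : forall z, 0 <= M z <= mhi) (mM : measurable_fun setT M).
Hypothesis MS : forall z, M (swap_Rn z) = M z.

Definition kernel (s : R) (h : V) : R := (enorm h `^ (n%:R + s * p))^-1.
Definition farA_kernel (s : R) (z : V * V) : R := \1_farA z * (M z * kernel s z.2).
Definition farD_kernel (s : R) (z : V * V) : R := \1_farD z * kernel s z.2.

Lemma kernel_ge0 s h : 0 <= kernel s h.
Proof. by rewrite invr_ge0 powR_ge0. Qed.

Lemma measurable_kernel s : measurable_fun setT (kernel s).
Proof. exact: measurable_enorm_powRV. Qed.

Lemma farA_kernel_ge0 s z : 0 <= farA_kernel s z.
Proof. by rewrite !mulr_ge0 ?kernel_ge0//; have /andP[] := M0 z. Qed.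

Lemma farD_kernel_ge0 s z : 0 <= farD_kernel s z.
Proof. by rewrite mulr_ge0 ?kernel_ge0. Qed.

Lemma measurable_kernel2 s : measurable_fun setT (fun z : V * V => kernel s z.2).
Proof. exact: (measurableT_comp (measurable_kernel s) measurable_snd). Qed.

Lemma measurable_farA_kernel s : measurable_fun setT (farA_kernel s).
Proof.
apply: measurable_funM; first by apply: measurable_indic; exact: measurable_farA.
by apply: measurable_funM => //; exact: measurable_kernel2.
Qed.

Lemma measurable_farD_kernel s : measurable_fun setT (farD_kernel s).
Proof.
apply: measurable_funM; last exact: measurable_kernel2.
by apply: measurable_indic; exact: measurable_farD.
Qed.

Lemma kernel_le1 s h : 0 < s -> 1 < enorm h -> kernel s h <= 1.
Proof.
move=> s0 h1; rewrite invf_le1 ?powR_gt0// ?(lt_trans ltr01)//.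
have q0 : 0 <= n%:R + s * p by rewrite addr_ge0// mulr_ge0// ltW.
by have := ler_powR (ltW h1) q0; rewrite powRr0.
Qed.

Lemma le_kernel s t h : 0 < s -> s <= t -> enorm h <= 1 -> kernel s h <= kernel t h.
Proof.
move=> s0 st h1; have q0 r : 0 < r -> (n%:R + r * p == 0) = false.
  by move=> r0; rewrite gt_eqF// ltr_wpDl// mulr_gt0.
rewrite /kernel; have := enorm_ge0 h; rewrite le_eqVlt => /orP[/eqP<-|h0].
  (* At $h=0$ both exponents are positive, so both kernels are the inverse of 0, that is 0. *)
  by rewrite !powR0 ?q0// (lt_le_trans s0 st).
rewrite lef_pV2 ?posrE ?powR_gt0//; apply: ger_powR; first by rewrite h0.
by rewrite lerD2l ler_pM2r.
Qed.

Section comparison.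
Variables (u : V -> R) (mfu : measurable_fun setT u).
Let U x := `|u x| `^ p.
Let G s z := M z * diff_quotient s p u z.
Let H s z := U z.1 * farA_kernel s z.
Let K s z := U z.1 * farD_kernel s z.

(** For $|h|\le1$ the density is controlled by the one with the fixed exponent [t]. For $|h|>1$ put
    $y=x-h$: if $2|x|<|h|$ or $2|y|<|h|$, the density is compared with $|u|^p$ at that point, and
    the value at the other point is charged to [K]; if neither holds, both values are. *)
Lemma energy_comparison (c eta s t : R) : 0 < s -> s <= t -> 0 <= c -> 0 < eta ->
  (forall a b : R, 0 <= a -> 0 <= b -> (a + b) `^ p <= (1 + eta) * a `^ p + c * b `^ p) ->
  forall z,
  G s z <= mhi * diff_quotient t p u z + (1 + eta) * (H s z + H s (swap_Rn z)) +
    mhi * (1 + eta + c) * (K s z + K s (swap_Rn z)) /\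
  H s z + H s (swap_Rn z) <= (1 + eta) * G s z +
    mhi * (1 + eta + c) * (K s z + K s (swap_Rn z)).
Proof.
move=> s0 st c0 eta0 cP z; have /andP[Mz0 Mz1] := M0 z.
have sqE : (swap_Rn z).1 = vsub z.1 z.2 by [].
have hE : enorm (swap_Rn z).2 = enorm z.2 by rewrite enorm_vopp.
rewrite /G /H /K /farA_kernel /farD_kernel /kernel !MS !indic_farA !indic_farD.
rewrite !hE sqE /diff_quotient.
case: z Mz0 Mz1 {sqE hE} => x h /=; set y := vsub x h => Mz0 Mz1.
set W := (_ `^ (n%:R + s * p)).
have W0 : 0 <= W^-1 by rewrite invr_ge0 powR_ge0.
have T1 : `|u x - u y| `^ p <= (1 + eta) * U x + c * U y.
  apply: le_trans (cP _ _ (normr_ge0 _) (normr_ge0 _)).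
  by apply: (ge0_ler_powR (ltW p0)); rewrite ?nnegrE ?addr_ge0// ler_normB.
have T2 : `|u x - u y| `^ p <= (1 + eta) * U y + c * U x.
  apply: le_trans (cP _ _ (normr_ge0 _) (normr_ge0 _)).
  by apply: (ge0_ler_powR (ltW p0)); rewrite ?nnegrE ?addr_ge0// distrC ler_normB.
have T3 : U x <= (1 + eta) * `|u x - u y| `^ p + c * U y.
  apply: le_trans (cP _ _ (normr_ge0 _) (normr_ge0 _)).
  apply: (ge0_ler_powR (ltW p0)); rewrite ?nnegrE ?addr_ge0//.
  by rewrite -{1}[u x](subrK (u y)) ler_normD.
have T4 : U y <= (1 + eta) * `|u x - u y| `^ p + c * U x.
  apply: le_trans (cP _ _ (normr_ge0 _) (normr_ge0 _)).
  apply: (ge0_ler_powR (ltW p0)); rewrite ?nnegrE ?addr_ge0//.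
  by rewrite distrC -{1}[u y](subrK (u x)) ler_normD.
have X0 : 0 <= U x by exact: powR_ge0.
have Y0 : 0 <= U y by exact: powR_ge0.
have T0 : 0 <= `|u x - u y| `^ p by exact: powR_ge0.
have D0 : 0 <= mhi * (`|u x - u y| `^ p / enorm h `^ (n%:R + t * p)).
  by rewrite !mulr_ge0 ?invr_ge0 ?powR_ge0// (le_trans Mz0).
have mhi0 : 0 <= mhi by exact: le_trans Mz1.
move: (U x) (U y) (`|u x - u y| `^ p) X0 Y0 T0 T1 T2 T3 T4 D0 => X Y T X0 Y0 T0 T1 T2 T3 T4 D0.
have [h1|h1] := ltP 1 (enorm h); last first.
  rewrite /= !mul0r !mulr0 !addr0 !mulr0 !addr0; split; last first.
    by rewrite !mulr_ge0// addr_ge0// ltW.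
  apply: ler_pM => //; first exact: mulr_ge0.
  rewrite ler_wpM2l//.
  exact: le_kernel.
rewrite /=.
have MX : M (x, h) * (W^-1 * X) <= mhi * (W^-1 * X) by rewrite ler_wpM2r// mulr_ge0.
have MY : M (x, h) * (W^-1 * Y) <= mhi * (W^-1 * Y) by rewrite ler_wpM2r// mulr_ge0.
have MW : 0 <= M (x, h) * W^-1 by rewrite mulr_ge0.
have mX : 0 <= mhi * (W^-1 * X) by rewrite !mulr_ge0.
have mY : 0 <= mhi * (W^-1 * Y) by rewrite !mulr_ge0.
have {}T1 := ler_wpM2l MW T1; have {}T2 := ler_wpM2l MW T2.
have {}T3 := ler_wpM2l MW T3; have {}T4 := ler_wpM2l MW T4.
have ce Z : 0 <= mhi * (W^-1 * Z) -> 0 <= eta * (mhi * (W^-1 * Z)) /\ 0 <= c * (mhi * (W^-1 * Z)).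
  by move=> Z0; split; apply: mulr_ge0 => //; exact: ltW.
have [eX cX] := ce _ mX; have [eY cY] := ce _ mY.
have MT := mulr_ge0 MW T0; have eMT := mulr_ge0 (ltW eta0) MT.
have cMX := ler_wpM2l c0 MX; have cMY := ler_wpM2l c0 MY.
have eMX := ler_wpM2l (ltW eta0) MX; have eMY := ler_wpM2l (ltW eta0) MY.
have [xh|xh] := ltP (2 * enorm x) (enorm h); have [yh|yh] := ltP (2 * enorm y) (enorm h).
(* The two inequalities together would give $|h|\le|x|+|y|<|h|$. *)
- have := ler_enormD h x; rewrite enorm_vsubC -/y => ?; lra.
- rewrite /= !mul0r !mul1r !mulr0 !addr0 !add0r; split; lra.
- rewrite /= !mul0r !mul1r !mulr0 !addr0 !add0r; split; lra.
- rewrite /= !mul0r !mul1r !mulr0 ?addr0 ?add0r; split; lra.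
Qed.

Local Open Scope ereal_scope.

Let mU : measurable_fun setT U.
Proof.
have mn : measurable_fun setT (fun x => `|u x|%R) by exact: measurableT_comp.
exact: (measurableT_comp (@measurable_powR R p) mn).
Qed.

Lemma measurable_diff_quotient s : measurable_fun setT (diff_quotient s p u).
Proof.
apply: measurable_funM (measurable_kernel2 s).
have mv : measurable_fun setT (fun z : V * V => vsub z.1 z.2).
  by apply: measurable_vsub; [exact: measurable_fst|exact: measurable_snd].
have mB : measurable_fun setT (fun z : V * V => u z.1 - u (vsub z.1 z.2))%R.
  apply: measurable_funB (measurableT_comp mfu mv).
  exact: (measurableT_comp mfu measurable_fst).
have mn : measurable_fun setT (fun z : V * V => `|u z.1 - u (vsub z.1 z.2)|%R).
  exact: measurableT_comp.
exact: (measurableT_comp (@measurable_powR R p) mn).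
Qed.

Lemma diff_quotient_ge0 s z : (0 <= diff_quotient s p u z)%R.
Proof. by rewrite mulr_ge0 ?invr_ge0 ?powR_ge0. Qed.

Lemma integral_weighted (f : V * V -> R) : measurable_fun setT f ->
  (forall z, 0 <= f z)%R ->
  \int[L \x L]_z (U z.1 * f z)%:E = \int[L]_x ((U x)%:E * \int[L]_h (f (x, h))%:E).
Proof.
move=> mf f0; have mUf : measurable_fun setT (fun z : V * V => (U z.1 * f z)%:E).
  apply/measurable_EFinP; apply: measurable_funM => //.
  exact: (measurableT_comp mU measurable_fst).
rewrite (fubini_tonelli1 _ mUf); last by move=> z; rewrite lee_fin mulr_ge0// powR_ge0.
apply: eq_integral => x _; rewrite /fubini_F/=; under eq_integral do rewrite EFinM.
apply: (ge0_integralZl_EFin L measurableT) => //.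
- by move=> h _; rewrite lee_fin.
- apply/measurable_EFinP; apply: (measurableT_comp mf); exact: pair1_measurable.
- exact: powR_ge0.
Qed.

Let integral_add_swap (F : V * V -> R) : measurable_fun setT F ->
  (forall z, 0 <= F z)%R ->
  \int[L \x L]_z (F z + F (swap_Rn z))%:E = 2%:E * \int[L \x L]_z (F z)%:E.
Proof.
move=> mF F0; have mE : measurable_fun setT (fun z => (F z)%:E) by exact/measurable_EFinP.
have mS : measurable_fun setT (fun z => (F (swap_Rn z))%:E).
  exact: (measurableT_comp mE measurable_swap_Rn).
under eq_integral do rewrite EFinD.
rewrite (ge0_integralD _ measurableT _ mE _ mS).
- rewrite (_ : 2%:E = 1 + 1); last by rewrite -EFinD.
  rewrite ge0_muleDl// mul1e; congr (_ + _).
  by apply: (integral_swap_Rn mE) => z; rewrite lee_fin.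
- by move=> z _; rewrite lee_fin.
- by move=> z _; rewrite lee_fin.
Qed.

(** Integrated form of [energy_comparison]. The two summands related by [swap_Rn] have equal
    integrals, whence the factors 2. The constant [c] depends on [eta] but not on [s]. *)
Lemma energy_estimate (eta t : R) : (0 < eta)%R -> exists2 c : R, (0 <= c)%R &
  forall s, (0 < s)%R -> (s <= t)%R ->
  let E := \int[L \x L]_z (M z * diff_quotient s p u z)%:E in
  let A := 2%:E * \int[L]_x ((`|u x| `^ p)%:E * \int[L]_h (farA_kernel s (x, h))%:E) in
  let B := 2%:E * \int[L]_x ((`|u x| `^ p)%:E * \int[L]_h (farD_kernel s (x, h))%:E) in
  E <= mhi%:E * \int[L \x L]_z (diff_quotient t p u z)%:E + (1 + eta)%:E * A + c%:E * B /\
  A <= (1 + eta)%:E * E + c%:E * B.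
Proof.
move=> eta0; have [c c0 cP] := powRD_le p0 eta0.
have mhi0 : (0 <= mhi)%R.
  by have /andP[+ +] := M0 ([tuple 0%R | i < n], [tuple 0%R | i < n]); exact: le_trans.
have C0 : (0 <= mhi * (1 + eta + c))%R by rewrite mulr_ge0// !addr_ge0// ltW.
exists (mhi * (1 + eta + c))%R => // s s0 st E A B.
have mU1 : measurable_fun setT (fun z : V * V => U z.1).
  exact: (measurableT_comp mU measurable_fst).
have mH : measurable_fun setT (H s) by exact: measurable_funM mU1 (measurable_farA_kernel s).
have mK : measurable_fun setT (K s) by exact: measurable_funM mU1 (measurable_farD_kernel s).
have mG : measurable_fun setT (G s) by exact: measurable_funM mM (measurable_diff_quotient s).
have mQ := measurable_diff_quotient t.
have G0 z : (0 <= G s z)%R.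
  by rewrite mulr_ge0 ?diff_quotient_ge0//; have /andP[] := M0 z.
have H0 z : (0 <= H s z)%R by rewrite mulr_ge0 ?powR_ge0// farA_kernel_ge0.
have K0 z : (0 <= K s z)%R by rewrite mulr_ge0 ?powR_ge0// farD_kernel_ge0.
have AE : A = \int[L \x L]_z (H s z + H s (swap_Rn z))%:E.
  rewrite (integral_add_swap mH H0) /A -(integral_weighted (measurable_farA_kernel s))//.
  exact: farA_kernel_ge0.
have BE : B = \int[L \x L]_z (K s z + K s (swap_Rn z))%:E.
  rewrite (integral_add_swap mK K0) /B -(integral_weighted (measurable_farD_kernel s))//.
  exact: farD_kernel_ge0.
have mS (F : V * V -> R) : measurable_fun setT F ->
    measurable_fun setT (fun z => F z + F (swap_Rn z))%R.
  move=> mF; apply: measurable_funD => //.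
  exact: (measurableT_comp mF measurable_swap_Rn).
have S0 (F : V * V -> R) : (forall z, 0 <= F z)%R -> forall z, (0 <= F z + F (swap_Rn z))%R.
  by move=> F0 z; rewrite addr_ge0.
have cmp := energy_comparison s0 st c0 eta0 cP.
have e1 : (0 <= 1 + eta)%R by rewrite addr_ge0// ltW.
rewrite AE BE; split; last first.
  exact: (ge0_le_integral_lin _ (mS _ mH) mG (mS _ mK) (S0 _ H0) G0 (S0 _ K0) e1 C0
    (fun z => (cmp z).2)).
pose F z := (mhi * diff_quotient t p u z + (1 + eta) * (H s z + H s (swap_Rn z)))%R.
have mF : measurable_fun setT F.
  by apply: measurable_funD; apply: measurable_funM => //; exact: mS.
have F0 z : (0 <= F z)%R.
  by apply: addr_ge0; apply: mulr_ge0 => //; [exact: diff_quotient_ge0|exact: (S0 _ H0)].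
apply: (le_trans (ge0_le_integral_lin _ mG mF (mS _ mK) G0 F0 (S0 _ K0) ler01 C0 _)).
  by move=> z; rewrite mul1r; exact: (cmp z).1.
rewrite mul1e leeD2r//.
exact: (ge0_le_integral_lin _ mF mQ (mS _ mH) F0 (@diff_quotient_ge0 _) (S0 _ H0) mhi0 e1
  (fun z => lexx _)).
Qed.

End comparison.
End weights.
End far_field.

(** * Passage to the limit *)

Section limits.
Context {R : realType} {n : nat}.
Notation L := (lebesgue_Rn R n).
Notation V := (Rn R n).
Variables (p : R) (M : V * V -> R) (mhi : R).
Hypotheses (n_gt0 : (0 < n)%N) (p0 : 0 < p).
Hypotheses (M0 : forall z, 0 <= M z <= mhi) (mM : measurable_fun setT M).
Local Open Scope ereal_scope.

Let sigma : R := fine (sphere_measure [set: V]).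

Let sigmaE : sphere_measure [set: V] = sigma%:E.
Proof. by rewrite fineK// ge0_fin_numE// sphere_measure_lty. Qed.

Let mhi0 : (0 <= mhi)%R.
Proof. by have /andP[+ +] := M0 ([tuple 0%R | i < n], [tuple 0%R | i < n]); exact: le_trans. Qed.

Let tail (s : R) (h : V) : R := (\1_[set h : V | (1 < enorm h)%R] h * kernel p s h)%R.

Let mtail s : measurable_fun setT (tail s).
Proof.
apply: measurable_funM (measurable_kernel _ _).
by apply: measurable_indic; exact: measurable_gt_enorm.
Qed.

Let tail0 s h : (0 <= tail s h)%R.
Proof. by rewrite mulr_ge0 ?kernel_ge0. Qed.

Let integral_tail s : (0 < s)%R -> \int[L]_h (tail s h)%:E = (sigma / (s * p))%:E.
Proof.
by move=> s0; rewrite (integral_kernel_tail n_gt0 (mulr_gt0 s0 p0)) sigmaE.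
Qed.

Let section_measurable (f : V * V -> R) x : measurable_fun setT f ->
  measurable_fun setT (fun h => (f (x, h))%:E).
Proof.
by move=> mf; apply/measurable_EFinP; apply: (measurableT_comp mf); exact: pair1_measurable.
Qed.

(** The tail mass is $\sigma/(sp)$, and $2s$ times it does not depend on $s$: this supplies the
    constants for dominated convergence, uniform in $x$ as well. *)
Lemma integral_section_tail_le (f : V * V -> R) (C s : R) x :
  measurable_fun setT f -> (forall z, 0 <= f z)%R -> (0 <= C)%R -> (0 < s)%R ->
  (forall h, f (x, h) <= C * tail s h)%R ->
  0 <= (2 * s)%:E * \int[L]_h (f (x, h))%:E <= (2 * C * sigma / p)%:E.
Proof.
move=> mf f0 C0 s0 fC.
have s20 : 0 <= (2 * s)%:E by rewrite lee_fin mulr_ge0// ltW.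
rewrite mule_ge0//=; last by apply: integral_ge0 => h _; rewrite lee_fin.
have -> : (2 * C * sigma / p = 2 * s * (C * (sigma / (s * p))))%R by field; rewrite !gt_eqF.
rewrite [leRHS]EFinM lee_wpmul2l// EFinM -integral_tail//.
have te (h : V) : [set: V] h -> 0 <= (tail s h)%:E by rewrite lee_fin.
have mt : measurable_fun setT (fun h : V => (tail s h)%:E) by exact/measurable_EFinP.
rewrite -(ge0_integralZl_EFin L measurableT te mt C0).
apply: ge0_le_integral => //.
- by move=> h _; rewrite lee_fin.
- exact: section_measurable.
- by apply: emeasurable_funM.
- by move=> h _; rewrite -EFinM lee_fin.
Qed.

Lemma farA_kernel_tail_le s x h : (farA_kernel p M s (x, h) <= mhi * tail s h)%R.
Proof.
rewrite /farA_kernel /tail indic_farA indicE/= mulrCA; have /andP[Mz0 Mz1] := M0 (x, h).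
have k0 := kernel_ge0 p s h.
have -> : (h \in [set h0 : V | (1 < enorm h0)%R]) = (1 < enorm h)%R.
  by apply/idP/idP; rewrite inE.
case: (1 < enorm h)%R => /=; last by rewrite !mul0r !mulr0.
rewrite mul1r; apply: ler_pM => //; first by rewrite mulr_ge0.
by rewrite ler_piMl// lern1 leq_b1.
Qed.

Lemma farD_kernel_tail_le s x h : (farD_kernel p s (x, h) <= 1 * tail s h)%R.
Proof.
rewrite /farD_kernel /tail indic_farD indicE/= mul1r.
have -> : (h \in [set h0 : V | (1 < enorm h0)%R]) = (1 < enorm h)%R.
  by apply/idP/idP; rewrite inE.
by rewrite ler_wpM2r ?kernel_ge0// ler_nat; case: (1 < enorm h)%R => //=; rewrite leq_b1.
Qed.

(** Here $|h|\le2|x|$, so $|h-x|\le3|x|$, and the kernel is at most 1. The bound does not depend on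
    [s]; the summand 1 keeps the radius positive at $x=0$. *)
Lemma integral_farD_kernel_le s x : (0 < s)%R ->
  \int[L]_h (farD_kernel p s (x, h))%:E <= L (cball x (3 * enorm x + 1)).
Proof.
move=> s0; rewrite -(integral_indicT L (measurable_cball _ _)).
apply: ge0_le_integral => //.
- by move=> h _; rewrite lee_fin farD_kernel_ge0.
- exact: section_measurable (measurable_farD_kernel _ _).
- exact: measurable_EFin_indic (measurable_cball _ _).
move=> h _; rewrite lee_fin /farD_kernel indic_farD indicE/=.
have [h1|h1] := ltP 1%R (enorm h); last by rewrite mul0r.
have [hx|hx] := leP (enorm h) (2 * enorm x)%R; last by rewrite mul0r.
rewrite mem_set; last by rewrite /cball/=; apply: le_trans (ler_enormB _ _) _; lra.
by rewrite mul1r kernel_le1.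
Qed.

Variables (u : V -> R) (m : V * V -> R) (b : V -> \bar R) (s_ : R^nat).
Hypothesis iU : L.-integrable setT (fun x => (`|u x| `^ p)%:E).
Hypothesis mME : {ae L \x L, forall z, m z = M z}.
Hypothesis b_lim : {ae L, forall x, b_coef m p s x @[s --> 0^'+] --> b x}.
Hypotheses (s_gt0 : forall k, (0 < s_ k)%R) (s_cvg : s_ k @[k --> \oo] --> 0%R).

Let s_cvgE (C : R) : (s_ k * C)%:E @[k --> \oo] --> 0.
Proof.
apply: cvg_EFin; first exact: nearW.
by rewrite -(mul0r C); apply: cvgMl.
Qed.

Lemma cvg_farD_kernel_integral :
  \int[L]_x ((`|u x| `^ p)%:E * ((2 * s_ k)%:E * \int[L]_h (farD_kernel p (s_ k) (x, h))%:E))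
    @[k --> \oo] --> 0.
Proof.
have -> : 0 = \int[L]_x ((`|u x| `^ p)%:E * cst 0 x) :> \bar R.
  by under eq_integral do rewrite mule0; rewrite integral0.
apply: (cvg_integral_weighted (C := (2 * 1 * sigma / p)%R) iU).
- by move=> x; exact: powR_ge0.
- move=> k; apply: emeasurable_funM => //.
  have mpsi : measurable_fun setT (fun z : V * V => (farD_kernel p (s_ k) z)%:E).
    by apply/measurable_EFinP; exact: measurable_farD_kernel.
  by apply: (measurable_fun_fubini_tonelli_F _ mpsi) => z; rewrite lee_fin farD_kernel_ge0.
- move=> k x; apply: integral_section_tail_le => //.
  + exact: measurable_farD_kernel.
  + by move=> z; exact: farD_kernel_ge0.
  + by move=> h; exact: farD_kernel_tail_le.
- apply: aeW => x /=.
  have r0 : (0 < 3 * enorm x + 1)%R by have := enorm_ge0 x; lra.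
  apply: (@squeeze_cvge _ _ _ _ (cst 0) _
    (fun k => (s_ k * (2 * (ball_volume n * (3 * enorm x + 1) ^+ n)))%:E)).
  + apply: nearW => k; apply/andP; split.
      apply: mule_ge0; first by rewrite lee_fin mulr_ge0// ltW.
      by apply: integral_ge0 => h _; rewrite lee_fin farD_kernel_ge0.
    rewrite mulrCA mulrA [leRHS]EFinM; apply: lee_wpmul2l.
      by rewrite lee_fin mulr_ge0// ltW.
    by rewrite -(lebesgue_Rn_cball x r0); exact: integral_farD_kernel_le.
  + exact: cvg_cst.
  + exact: s_cvgE.
Qed.

(** Bounds the integral of the kernel over $2|x|<|h|\le1$ for all $s\le1$: raise the exponent to
    $n+p$, then lower $|h|$ to $2|x|$. In this region alone the domains behind [b_coef] and [farA]
    differ. *)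
Let near_bound (x : V) : R := ((2 * enorm x) `^ (n%:R + p))^-1 * ball_volume n.

Lemma b_coef_farA_kernel s x : (0 < s)%R -> (s <= 1)%R -> (0 < enorm x)%R ->
  {ae L, forall h, m (x, h) = M (x, h)} ->
  (2 * s)%:E * \int[L]_h (farA_kernel p M s (x, h))%:E <= b_coef m p s x <=
  (2 * s)%:E * \int[L]_h (farA_kernel p M s (x, h))%:E + (s * (2 * (mhi * near_bound x)))%:E.
Proof.
move=> s0 s1 x0 mMx.
have mMx' : measurable_fun setT (fun h => M (x, h)).
  by apply: (measurableT_comp mM); exact: pair1_measurable.
have M00 h : (0 <= M (x, h))%R by have /andP[] := M0 (x, h).
rewrite (b_coefE n_gt0 p0 s0 mMx' M00 mMx).
have s20 : 0 <= (2 * s)%:E by rewrite lee_fin mulr_ge0// ltW.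
pose f (h : V) := (\1_[set h : V | (2 * enorm x < enorm h)%R] h *
  (M (x, h) * kernel p s h))%R.
have f0 h : (0 <= f h)%R by rewrite !mulr_ge0 ?kernel_ge0.
have mf : measurable_fun setT (fun h => (f h)%:E).
  apply/measurable_EFinP; apply: measurable_funM.
    by apply: measurable_indic; exact: measurable_gt_enorm.
  by apply: measurable_funM => //; exact: measurable_kernel.
have fE h : f h = ((2 * enorm x < enorm h)%R%:R * (M (x, h) * kernel p s h))%R.
  rewrite /f indicE; congr ((nat_of_bool _)%:R * _)%R.
  by apply/idP/idP; rewrite inE.
rewrite -[X in _ <= _ * X <= _]/(\int[L]_h (f h)%:E).
have mphi : measurable_fun setT (fun h => (farA_kernel p M s (x, h))%:E).
  exact: section_measurable (measurable_farA_kernel _ _ _).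
have phi0 h : 0 <= (farA_kernel p M s (x, h))%:E by rewrite lee_fin (farA_kernel_ge0 _ M0).
apply/andP; split.
  rewrite lee_wpmul2l//; apply: ge0_le_integral => //.
  move=> h _; rewrite lee_fin fE /farA_kernel indic_farA/= ler_wpM2r ?mulr_ge0 ?kernel_ge0//.
  by rewrite ler_nat; case: (2 * _ < _)%R; rewrite ?andbF ?andbT// leq_b1.
have -> : (s * (2 * (mhi * near_bound x)))%:E =
    (2 * s)%:E * \int[L]_h ((mhi * ((2 * enorm x) `^ (n%:R + p))^-1)%:E *
       (\1_(unit_ball : set V) h)%:E).
  have B0 (h : V) : [set: V] h -> 0 <= (\1_(unit_ball : set V) h : R)%:E by rewrite lee_fin.
  have IB : \int[L]_h (\1_(unit_ball : set V) h : R)%:E = (ball_volume n)%:E.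
    exact: etrans (integral_indicT L (@measurable_unit_ball R n)) (ball_volumeE _).
  have c0 : (0 <= mhi * ((2 * enorm x) `^ (n%:R + p))^-1)%R.
    by rewrite mulr_ge0 ?invr_ge0 ?powR_ge0.
  rewrite (ge0_integralZl_EFin L measurableT B0
    (measurable_EFin_indic (@measurable_unit_ball R n)) c0) IB -!EFinM /near_bound.
  by congr EFin; ring.
rewrite -ge0_muleDr; last 2 first.
- exact: integral_ge0.
- by apply: integral_ge0 => h _; rewrite mule_ge0// lee_fin mulr_ge0 ?invr_ge0 ?powR_ge0.
rewrite lee_wpmul2l//.
have mball : measurable_fun setT (fun h : V =>
    (mhi * ((2 * enorm x) `^ (n%:R + p))^-1)%:E * (\1_(unit_ball : set V) h)%:E).
  by apply: emeasurable_funM => //; exact: measurable_EFin_indic (@measurable_unit_ball R n).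
rewrite -ge0_integralD//; last first.
  by move=> h _; rewrite mule_ge0// lee_fin mulr_ge0 ?invr_ge0 ?powR_ge0.
apply: ge0_le_integral => //.
- by move=> h _; rewrite lee_fin.
- exact: emeasurable_funD.
move=> h _; rewrite -EFinM -EFinD lee_fin fE /farA_kernel indic_farA/= indicE.
have [h1|h1] := ltP 1%R (enorm h).
  by rewrite lerDl !mulr_ge0 ?invr_ge0 ?powR_ge0.
rewrite mem_set// mul0r add0r mulr1.
have [xh|xh] := ltP (2 * enorm x)%R (enorm h); last by rewrite mul0r mulr_ge0 ?invr_ge0 ?powR_ge0.
have /andP[_ M1] := M0 (x, h).
rewrite mul1r; apply: ler_pM => //; first exact: kernel_ge0.
apply: le_trans (le_kernel p0 s0 s1 h1) _; rewrite /kernel mul1r.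
have hx : (0 < 2 * enorm x)%R by rewrite mulr_gt0.
rewrite lef_pV2 ?posrE ?powR_gt0// ?(lt_trans hx)//.
apply: ge0_ler_powR; rewrite ?nnegrE ?enorm_ge0 ?(ltW hx) ?(ltW xh)//.
by rewrite addr_ge0// ltW.
Qed.

Lemma cvg_farA_kernel_integral :
  \int[L]_x ((`|u x| `^ p)%:E * ((2 * s_ k)%:E * \int[L]_h (farA_kernel p M (s_ k) (x, h))%:E))
    @[k --> \oo] --> \int[L]_x ((`|u x| `^ p)%:E * b x).
Proof.
apply: (cvg_integral_weighted (C := (2 * mhi * sigma / p)%R) iU).
- by move=> x; exact: powR_ge0.
- move=> k; apply: emeasurable_funM => //.
  have mphi : measurable_fun setT (fun z : V * V => (farA_kernel p M (s_ k) z)%:E).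
    by apply/measurable_EFinP; exact: measurable_farA_kernel.
  by apply: (measurable_fun_fubini_tonelli_F _ mphi) => z; rewrite lee_fin (farA_kernel_ge0 _ M0).
- move=> k x; apply: integral_section_tail_le => //.
  + exact: measurable_farA_kernel.
  + by move=> z; exact: (farA_kernel_ge0 _ M0).
  + by move=> h; exact: farA_kernel_tail_le.
have x_gt0 : {ae L, forall x, (0 < enorm x)%R}.
  exists [set h | enorm h = 0%R]; split.
  - exact: (measurable_preimageT measurable_enorm (measurable_set1 0%R)).
  - exact: lebesgue_Rn_origin.
  - by move=> x /negP; rewrite lt0r enorm_ge0 andbT negbK => /eqP.
have mMs := ae_section mME; near=> x.
have x0 : (0 < enorm x)%R by near: x.
have mMx : {ae L, forall h, m (x, h) = M (x, h)} by near: x.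
have bx : b_coef m p s x @[s --> 0^'+] --> b x by near: x.
have s_right : s_ k @[k --> \oo] --> 0%R^'+.
  move=> P sP; have {}sP : \forall k \near \oo, (0 < s_ k)%R -> P (s_ k) := s_cvg sP.
  by apply: (filterS _ sP) => k /(_ (s_gt0 k)).
have {}bx : b_coef m p (s_ k) x @[k --> \oo] --> b x by exact: cvg_comp s_right bx.
have s1 : \forall k \near \oo, (s_ k <= 1)%R.
  by near=> k; near: k; apply: (cvgr_le 0%R).
apply: (@squeeze_cvge _ _ _ _
  (fun k => b_coef m p (s_ k) x - (s_ k * (2 * (mhi * near_bound x)))%:E) _
  (fun k => b_coef m p (s_ k) x)) => //.
- near=> k; have sk1 : (s_ k <= 1)%R by near: k.
  have /andP[h1 h2] := b_coef_farA_kernel (s_gt0 k) sk1 x0 mMx.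
  by rewrite h1 andbT leeBlDr.
- rewrite -[b x]sube0; apply: cvgeB => //.
  by rewrite fin_num_adde_defl.
Unshelve. all: by end_near. Qed.

End limits.

Section symmetrization.
Context {R : realType} {n : nat}.
Local Open Scope ereal_scope.
Notation L := (lebesgue_Rn R n).
Notation V := (Rn R n).

(** Clipping [m] to $[0,hi]$ makes the bounds hold everywhere, and averaging with the reflected
    function does the same for the symmetry. Where [m] satisfies its assumptions, neither operation
    changes it. *)
Lemma symmetric_kernel (m : V * V -> R) (lo hi : R) :
  measurable_fun setT m -> (0 < lo)%R -> (lo <= hi)%R ->
  {ae L \x L, forall z, (lo <= m z <= hi)%R} ->
  {ae L \x L, forall z, m z = m (swap_Rn z)} ->
  exists M : V * V -> R, [/\ measurable_fun setT M, forall z, (0 <= M z <= hi)%R,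
    forall z, M (swap_Rn z) = M z & {ae L \x L, forall z, m z = M z}].
Proof.
move=> mm lo0 lohi mb ms; have hi0 : (0 <= hi)%R by rewrite (le_trans (ltW lo0)).
pose c z := Num.min (Num.max (m z) 0%R) hi.
have mc : measurable_fun setT c.
  by apply: measurable_minr => //; exact: measurable_maxr.
have c0 z : (0 <= c z <= hi)%R.
  by rewrite /c le_min hi0 le_max lexx orbT/= ge_min lexx orbT.
exists (fun z => (c z + c (swap_Rn z)) / 2)%R; split.
- apply: measurable_funM => //; apply: measurable_funD => //.
  exact: (measurableT_comp mc measurable_swap_Rn).
- by move=> z; have /andP[? ?] := c0 z; have /andP[? ?] := c0 (swap_Rn z); lra.
- by move=> z; rewrite swap_RnK addrC.
- apply: filterS2 mb ms => z /andP[mlo mhi] mz; rewrite /c -mz.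
  by rewrite max_l ?(le_trans (ltW lo0))// min_l//; field.
Qed.

End symmetrization.

Section rescaling.
Context {R : realType}.

Lemma rescale_estimates (e A B Q c k eta s : R) :
  0 <= s -> 0 <= c -> 0 <= k -> 0 <= Q -> 0 <= B ->
  e <= k * Q + (1 + eta) * A + c * B -> A <= (1 + eta) * e + c * B ->
  s * e <= (1 + eta) * (s * A) + (k + c) * (s * Q + s * B) /\
  s * A <= (1 + eta) * (s * e) + (k + c) * (s * Q + s * B).
Proof.
move=> s0 c0 k0 Q0 B0 e1 e2.
have cQ := mulr_ge0 c0 Q0; have kB := mulr_ge0 k0 B0; have kQ := mulr_ge0 k0 Q0.
have g1 : e <= (1 + eta) * A + (k + c) * (Q + B) by lra.
have g2 : A <= (1 + eta) * e + (k + c) * (Q + B) by lra.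
by have := ler_wpM2l s0 g1; have := ler_wpM2l s0 g2; split; lra.
Qed.

End rescaling.

Section energy_limit.
Context {R : realType} {n : nat}.
Notation L := (lebesgue_Rn R n).
Notation V := (Rn R n).
Variables (p : R) (M : V * V -> R) (mhi : R).
Hypotheses (n_gt0 : (0 < n)%N) (p0 : 0 < p).
Hypotheses (M0 : forall z, 0 <= M z <= mhi) (mM : measurable_fun setT M).
Hypothesis MS : forall z, M (swap_Rn z) = M z.
Variables (u : V -> R) (m : V * V -> R) (b : V -> \bar R) (t : R).
Hypothesis mfu : measurable_fun setT u.
Local Open Scope ereal_scope.
Hypothesis iU : L.-integrable setT (fun x => (`|u x| `^ p)%:E).
Hypothesis t0 : (0 < t)%R.
Hypothesis u_fin : \int[L \x L]_z (diff_quotient t p u z)%:E < +oo.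
Hypothesis mME : {ae L \x L, forall z, m z = M z}.
Hypothesis b_lim : {ae L, forall x, b_coef m p s x @[s --> 0^'+] --> b x}.

Let mhi0 : (0 <= mhi)%R.
Proof. by have /andP[+ +] := M0 ([tuple 0%R | i < n], [tuple 0%R | i < n]); exact: le_trans. Qed.

Let Q := fine (\int[L \x L]_z (diff_quotient t p u z)%:E).

Let QE : \int[L \x L]_z (diff_quotient t p u z)%:E = Q%:E.
Proof.
rewrite fineK// ge0_fin_numE//; apply: integral_ge0 => z _.
by rewrite lee_fin diff_quotient_ge0.
Qed.

Let Q0 : (0 <= Q)%R.
Proof. by rewrite fine_ge0// integral_ge0// => z _; rewrite lee_fin diff_quotient_ge0. Qed.

Let avg (f : R -> V * V -> R) s :=
  fine (\int[L]_x ((`|u x| `^ p)%:E * ((2 * s)%:E * \int[L]_h (f s (x, h))%:E))).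

(** Dominated by a multiple of $\int|u|^p$, these integrals are finite and may be replaced by the
    reals [avg f s]. The last bound, whose right side is independent of [s], later shows that the
    limit is finite. *)
Let avgE (f : R -> V * V -> R) C s :
  measurable_fun setT (f s) -> (forall z, 0 <= f s z)%R -> (0 <= C)%R -> (0 < s)%R ->
  (forall x h, f s (x, h) <= C * (\1_[set h : V | (1 < enorm h)%R] h * kernel p s h))%R ->
  \int[L]_x ((`|u x| `^ p)%:E * ((2 * s)%:E * \int[L]_h (f s (x, h))%:E)) =
    (avg f s)%:E /\
  s%:E * (2%:E * \int[L]_x ((`|u x| `^ p)%:E * \int[L]_h (f s (x, h))%:E)) =
    (avg f s)%:E /\ (0 <= avg f s)%R /\
  (avg f s)%:E <= \int[L]_x ((2 * C * fine (sphere_measure [set: V]) / p)%:E * (`|u x| `^ p)%:E).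
Proof.
move=> mf f0 C0 s0 fC.
have bnd x := integral_section_tail_le n_gt0 p0 mf f0 C0 s0 (fC x).
have U0 x : 0 <= (`|u x| `^ p)%:E by rewrite lee_fin powR_ge0.
set I := \int[L]_x _.
have I0 : 0 <= I.
  by apply: integral_ge0 => x _; rewrite mule_ge0//; have /andP[] := bnd x.
have mE : measurable_fun setT (fun z => (f s z)%:E) by exact/measurable_EFinP.
have mF : measurable_fun setT (fun x => \int[L]_h (f s (x, h))%:E).
  by apply: (measurable_fun_fubini_tonelli_F _ mE) => z; rewrite lee_fin.
have mU := measurable_int _ iU.
have s20 : (0 <= 2 * s)%R by rewrite mulr_ge0// ltW.
have mUF : measurable_fun setT (fun x => (`|u x| `^ p)%:E * \int[L]_h (f s (x, h))%:E).
  exact: emeasurable_funM.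
have UF0 (x : V) : [set: V] x -> 0 <= (`|u x| `^ p)%:E * \int[L]_h (f s (x, h))%:E.
  by move=> _; rewrite mule_ge0// integral_ge0// => h _; rewrite lee_fin.
have IE : I = s%:E * (2%:E * \int[L]_x ((`|u x| `^ p)%:E * \int[L]_h (f s (x, h))%:E)).
  rewrite muleA -EFinM mulrC -(ge0_integralZl_EFin L measurableT UF0 mUF s20).
  by apply: eq_integral => x _; rewrite muleCA.
set C' := (2 * C * _ / p)%R in bnd.
have iCU : L.-integrable setT (fun x => C'%:E * (`|u x| `^ p)%:E) by exact: integrableZl.
have IC : I <= \int[L]_x (C'%:E * (`|u x| `^ p)%:E).
  apply: ge0_le_integral => //.
  - by move=> x _; rewrite mule_ge0//; have /andP[] := bnd x.
  - by do 2 apply: emeasurable_funM => //.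
  - exact: measurable_int iCU.
  - by move=> x _; rewrite muleC lee_wpmul2r//; have /andP[] := bnd x.
have IK : I = (avg f s)%:E.
  rewrite /avg -/I fineK// ge0_fin_numE//.
  exact: le_lt_trans IC (integrable_lty measurableT iCU).
split=> //; split; first by rewrite -IE.
by split; [rewrite fine_ge0|rewrite -IK].
Qed.

Let E s := \int[L \x L]_z (M z * diff_quotient s p u z)%:E.

Let E0 s : 0 <= E s.
Proof.
apply: integral_ge0 => z _; rewrite lee_fin mulr_ge0 ?diff_quotient_ge0//.
by have /andP[] := M0 z.
Qed.

Let avg_farA_kernel s (s0 : (0 < s)%R) :=
  avgE (f := farA_kernel p M) (measurable_farA_kernel p mM s)
  (farA_kernel_ge0 p M0 s) mhi0 s0 (farA_kernel_tail_le p M0 s).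

Let avg_farD_kernel s (s0 : (0 < s)%R) := avgE (f := farD_kernel p) (measurable_farD_kernel p s)
  (farD_kernel_ge0 p s) ler01 s0 (farD_kernel_tail_le p s).

Let scaled_estimate (eta : R) : (0 < eta)%R -> exists2 c : R, (0 <= c)%R &
  forall s, (0 < s)%R -> (s <= t)%R ->
  s%:E * E s <= ((1 + eta) * avg (farA_kernel p M) s + c * (s * Q + avg (farD_kernel p) s))%:E /\
  (avg (farA_kernel p M) s)%:E <= (1 + eta)%:E * (s%:E * E s) +
    (c * (s * Q + avg (farD_kernel p) s))%:E.
Proof.
move=> eta0; have [c c0 cP] := energy_estimate p0 M0 mM MS mfu t eta0.
exists (mhi + c)%R => [|s s0 st]; first exact: addr_ge0.
have := cP s s0 st; rewrite /= QE -/(E s) => -[e1 e2].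
have [_ [a1 [a0 _]]] := avg_farA_kernel s0; have [_ [b1 [b0 _]]] := avg_farD_kernel s0.
have div_s (X : \bar R) r : s%:E * X = (s * r)%:E -> X = r%:E.
  move=> /(congr1 (fun y => (s^-1)%:E * y)); rewrite !muleA -!EFinM mulVf ?gt_eqF//.
  by rewrite mul1e => ->; rewrite mulrA mulVf ?gt_eqF// mul1r.
have sV r : exists r', r = (s * r')%R by exists (r / s)%R; rewrite mulrC divfK// gt_eqF.
have [A aE] := sV (avg (farA_kernel p M) s); have [B bE] := sV (avg (farD_kernel p) s).
rewrite aE in a0 a1 *; rewrite bE in b0 b1 *.
rewrite (div_s _ _ a1) in e1 e2; rewrite (div_s _ _ b1) in e1 e2.
rewrite -!EFinM -!EFinD in e1.
have Efin : E s \is a fin_num by rewrite ge0_fin_numE//; exact: le_lt_trans e1 (ltry _).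
move: e1 e2; rewrite -(fineK Efin) -!EFinM -!EFinD !lee_fin.
move: (fine (E s)) => e e1 e2.
have B0 : (0 <= B)%R by rewrite pmulr_rge0 in b0.
exact: rescale_estimates (ltW s0) c0 mhi0 Q0 B0 e1 e2.
Qed.

Lemma scaled_energy_fin s : (0 < s)%R -> (s <= t)%R -> s%:E * E s \is a fin_num.
Proof.
move=> s0 st; have [c _ cP] := scaled_estimate ltr01.
rewrite ge0_fin_numE; last by rewrite mule_ge0// lee_fin ltW.
by have [h _] := cP s s0 st; exact: le_lt_trans h (ltry _).
Qed.

Lemma cvg_scaled_energy :
  s%:E * E s @[s --> 0^'+] --> \int[L]_x ((`|u x| `^ p)%:E * b x).
Proof.
set l := \int[L]_x _.
have farA_kernel_cvg (s_ : R^nat) : (forall k, 0 < s_ k)%R -> s_ k @[k --> \oo] --> 0%R ->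
    (avg (farA_kernel p M) (s_ k))%:E @[k --> \oo] --> l.
  move=> s0 sc; under eq_fun => k do rewrite -(avg_farA_kernel (s0 k)).1.
  exact: (cvg_farA_kernel_integral n_gt0 p0 M0 mM iU mME b_lim s0 sc).
have farD_kernel_cvg (s_ : R^nat) : (forall k, 0 < s_ k)%R -> s_ k @[k --> \oo] --> 0%R ->
    (avg (farD_kernel p) (s_ k))%:E @[k --> \oo] --> 0.
  move=> s0 sc; under eq_fun => k do rewrite -(avg_farD_kernel (s0 k)).1.
  exact: (cvg_farD_kernel_integral n_gt0 p0 iU s0 sc).
(* One sequence tending to 0 is enough: the averages along it are nonnegative and uniformly
   bounded. *)
have lfin : l \is a fin_num.
  pose s_ k : R := k.+1%:R^-1%R.
  have s0 k : (0 < s_ k)%R by rewrite invr_gt0.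
  have /(farA_kernel_cvg _ s0) sl : s_ k @[k --> \oo] --> 0%R by exact: cvg_harmonic.
  have iCU : L.-integrable setT (fun x => (2 * mhi * fine (sphere_measure [set: V]) / p)%:E *
    (`|u x| `^ p)%:E) by exact: integrableZl.
  rewrite -(cvg_lim _ sl)// ge0_fin_numE; last first.
    apply: lime_ge; first by apply/cvg_ex; exists l.
    by apply: nearW => k; rewrite lee_fin; have [_ [_ []]] := avg_farA_kernel (s0 k).
  apply: le_lt_trans (integrable_lty measurableT iCU).
  apply: lime_le; first by apply/cvg_ex; exists l.
  by apply: nearW => k; have [_ [_ []]] := avg_farA_kernel (s0 k).
rewrite -(fineK lfin); apply/fine_cvgP; split.
  near=> s; apply: scaled_energy_fin; first by near: s; exact: nbhs_right_gt.
  by near: s; exact: nbhs_right_le.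
apply/cvg_at_rightP => s_ [s0 sc].
(* The error sequence joins $s_kQ$, which bounds the part $|h|\le1$, with the contribution of the
   region [farD]. *)
apply: (@cvg_sandwich _ _ (fun k => avg (farA_kernel p M) (s_ k))
  (fun k => s_ k * Q + avg (farD_kernel p) (s_ k))%R).
- by move=> k; have [_ [_ []]] := avg_farA_kernel (s0 k).
- move=> k; have [_ [_ [h _]]] := avg_farD_kernel (s0 k); apply: addr_ge0 => //.
  by rewrite mulr_ge0// ltW.
- move=> eta eta0; have [c c0 cP] := scaled_estimate eta0; exists c => //.
  have st : \forall k \near \oo, (s_ k <= t)%R.
    by near=> k; near: k; apply: (cvgr_le 0%R).
  apply: filterS st => k st; have := cP _ (s0 k) st.
  by rewrite -[X in X <= _]fineK ?scaled_energy_fin// 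
    -(fineK (scaled_energy_fin (s0 k) st)) -!EFinM -!EFinD !lee_fin.
- by have := farA_kernel_cvg _ s0 sc; rewrite -(fineK lfin) => /fine_cvgP[].
- rewrite -[0%R]addr0; apply: cvgD; first by rewrite -(mul0r Q); exact: cvgMl.
  by have /fine_cvgP[] := farD_kernel_cvg _ s0 sc.
Unshelve. all: by end_near. Qed.

End energy_limit.

Local Open Scope ereal_scope.

Theorem theorem4p1 (R : realType) (n : nat) (n_ge1 : (1 <= n)%N)
    (p : R) (p_ge1 : (1 <= p)%R)
    (m : Rn R n * Rn R n -> R)
    (m_Linfty : m \in Lfun (lebesgue_Rn R n \x lebesgue_Rn R n) +oo)
    (m_lo m_hi : R) (m_lo_gt0 : (0 < m_lo)%R) (m_lo_hi : (m_lo <= m_hi)%R)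
    (m_bounds : {ae lebesgue_Rn R n \x lebesgue_Rn R n,
      forall z, (m_lo <= m z <= m_hi)%R})
    (m_sym : {ae lebesgue_Rn R n \x lebesgue_Rn R n,
      forall z, m z = m (vsub z.1 z.2, vopp z.2)})
    (b : Rn R n -> \bar R)
    (b_lim : {ae lebesgue_Rn R n,
      forall x, b_coef m p s x @[s --> 0^'+] --> b x})
    (u : Rn R n -> R) (s0 : R) (s0_gt0 : (0 < s0)%R) (s0_lt1 : (s0 < 1)%R)
    (u_Wsp : in_Wsp s0 p u) :
  s%:E * J_energy m p s u @[s --> 0^'+] -->
    (p^-1)%:E * \int[lebesgue_Rn R n]_x ((`|u x| `^ p)%:E * b x).
Proof.
have p_gt0 : (0 < p)%R by exact: lt_le_trans p_ge1.
have mm : measurable_fun setT m by have := sub_Lfun_mfun m_Linfty; rewrite inE.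
have [uLp u_fin] := u_Wsp.
have mu : measurable_fun setT u by have := sub_Lfun_mfun uLp; rewrite inE.
have iU := Lfun_integrable p_ge1 uLp.
have [M [mM M0 MS mME]] := symmetric_kernel mm m_lo_gt0 m_lo_hi m_bounds m_sym.
have Elim := cvg_scaled_energy n_ge1 p_gt0 M0 mM MS mu iU s0_gt0 u_fin mME b_lim.
have -> : (fun s => s%:E * J_energy m p s u) = (fun s => ((1 - s) / p)%:E *
    (s%:E * \int[lebesgue_Rn R n \x lebesgue_Rn R n]_z (M z * diff_quotient s p u z)%:E)).
  apply/funext => s; rewrite /J_energy muleCA; congr (_ * (_ * _)).
  by apply: ae_eq_integralT; apply: filterS mME => z ->.
have c1 : ((1 - s) / p)%R @[s --> 0^'+] --> (p^-1)%R.
  rewrite -[X in _ --> X]mul1r; apply: cvgMl; rewrite -[X in _ --> X]subr0.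
  by apply: cvgB; [exact: cvg_cst|exact: cvg_at_right_filter].
apply: cvgeM Elim; last by apply: cvg_EFin c1; exact: nearW.
(* The limit factor $1/p$ is not 0, so the product makes sense whether or not the integral is
   finite. *)
set I := \int[_]_x _; have [Ifin|Ioo] := boolP (I \is a fin_num).
  exact: mule_def_fin.
by rewrite mule_def_neq0_infty// eqe invr_eq0 gt_eqF.
Qed.
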